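(* Let $H\in(0,1)$ and $1<\alpha\le 2$ with $2H<\alpha$, and let $Z^H=\{Z^H(t),t\ge 0\}$ be the $\alpha$-stable local time $H$-fractional Brownian motion, $Z^H(t)=W^H(L_t)$, with values in $\mathbb{R}$. Then for every Borel set $D\subseteq\mathbb{R}$, $$\limsup_{t\to\infty} t^{-\frac{2H(\alpha-1)}{\alpha-2H}}\log\mathbb{P}\Big\{t^{-\frac{2H(\alpha-1)}{\alpha-2H}}Z^H(t)\in D\Big\}\le-\inf_{x\in\overline{D}}\Lambda_1^*(x)$$ and $$\liminf_{t\to\infty} t^{-\frac{2H(\alpha-1)}{\alpha-2H}}\log\mathbb{P}\Big\{t^{-\frac{2H(\alpha-1)}{\alpha-2H}}Z^H(t)\in D\Big\}\ge-\inf_{x\in D^{\circ}}\Lambda_1^*(x),$$ where $\overline{D}$ and $D^\circ$ denote the closure and the interior of $D$, and $$\Lambda_1^*(x)=\frac{\alpha+2H}{2\alpha}\left(\frac{\alpha-2H}{2\alpha B_1}\right)^{\frac{\alpha-2H}{\alpha+2H}}x^{\frac{2\alpha}{\alpha+2H}},\qquad x\in\mathbb{R},$$ with $B_1$ the positive constant $$B_1=\frac{\alpha-2H}{2\alpha}\left(\frac{H\,A_1^{\alpha}}{(1-\frac1\alpha)^{\alpha-1}}\right)^{\frac{2H}{\alpha-2H}}$$ and $$A_1=\frac{\Gamma(1-\frac1\alpha)\,\Gamma(\frac1\alpha)\,\chi^{1/\alpha}\cos\big(\frac1\alpha\arctan(\nu\tan(\frac{\pi\alpha}{2}))\big)}{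\pi\alpha\,[1+(\nu\tan(\frac{\pi\alpha}{2}))^2]^{1/(2\alpha)}}.$$
   Context: $W^H=\{W^H(t),t\in\mathbb{R}\}$ is a real-valued fractional Brownian motion of Hurst index $H$: a centered Gaussian process with continuous sample paths, $W^H(0)=0$ and $\mathbb{E}(W^H(s)W^H(t))=\frac12(|s|^{2H}+|t|^{2H}-|s-t|^{2H})$. $X=\{X_t,t\ge0\}$ is a real-valued strictly stable Lévy process of index $\alpha\in(1,2]$ (with $X_0=0$), independent of $W^H$, with characteristic function $\mathbb{E}[e^{i\xi X_t}]=\exp\big(-t|\xi|^\alpha\frac{1+i\nu\,\mathrm{sgn}(\xi)\tan(\pi\alpha/2)}{\chi}\big)$, where $-1\le\nu\le1$ and $\chi>0$ are constants. The local time $L(x,t)$ of $X$ is the density with respect to Lebesgue measure of the occupation measure $A\mapsto\lambda_1\{s\in[0,t]:X_s\in A\}$, in a version jointly continuous in $(x,t)$; $L_t:=L(0,t)$ is the local time at zero. $Z^H(t)=W^H(L_t)$ for $t\ge0$. Convention: for $\gamma>0$ and $x\in\mathbb{R}$, $x^{2\gamma}$ means $(x^2)^\gamma$. The infimum over the empty set is $+\infty$ and $\log 0=-\infty$. *)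

(* Defs.v *)
From HB Require Import structures.
From mathcomp Require Import all_boot all_order all_algebra.
From mathcomp Require Import all_classical all_reals all_analysis.
From mathcomp.real_closed Require Import complex.

Set Implicit Arguments.
Unset Strict Implicit.
Unset Printing Implicit Defensive.

Import Order.TTheory GRing.Theory Num.Theory.
Import numFieldNormedType.Exports.

Local Open Scope classical_set_scope.
Local Open Scope ring_scope.

Definition Gamma {R : realType} (x : R) : R :=
  (\int[lebesgue_measure]_(u in `]0%R, +oo[) (u `^ (x - 1) * expR (- u)))%R.

Definition cexp {R : realType} (z : R[i]) : R[i] :=
  (expR (complex.Re z) * cos (complex.Im z)
    +i* (expR (complex.Re z) * sin (complex.Im z)))%C.

(* 'E_P is only available for real-valued functions. *)
Definition cexpectation {d} {T : measurableType d} {R : realType}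
    (P : probability T R) (Y : T -> R[i]) : R[i] :=
  (fine 'E_P[fun w => complex.Re (Y w)]
    +i* fine 'E_P[fun w => complex.Im (Y w)])%C.

Definition char_fun {d} {T : measurableType d} {R : realType}
    (P : probability T R) (Y : T -> R) (xi : R) : R[i] :=
  cexpectation P (fun w => cexp ('i%C * ((xi * Y w)%:C)%C)).

(* Degenerate laws are Gaussian; they are treated apart because [normal_prob m 0]
   is the uniform law on [0, 1]. *)
Definition gaussian_rv {d} {T : measurableType d} {R : realType}
    (P : probability T R) (Y : T -> R) : Prop :=
  exists m s : R, forall B : set R, measurable B ->
    P (Y @^-1` B) = if s == 0 then \d_m B else normal_prob m s B.

Definition gaussian_process {d} {T : measurableType d} {R : realType}
    (P : probability T R) (Y : R -> {RV P >-> R}) : Prop :=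
  forall (n : nat) (c t : 'I_n -> R),
    gaussian_rv P (fun w => \sum_(i < n) c i * Y (t i) w).

Record fractional_brownian_motion {d} {T : measurableType d} {R : realType}
    (P : probability T R) (H : R) (W : R -> {RV P >-> R}) : Prop := {
  fbm_gaussian : gaussian_process W ;
  fbm_centered : forall t : R, ('E_P[W t] = 0)%E ;
  fbm_covariance : forall s t : R, ('E_P[(fun w => W s w * W t w)%R] =
    (2^-1 * (`|s| `^ (2 * H) + `|t| `^ (2 * H) - `|s - t| `^ (2 * H)))%:E)%E ;
  fbm_continuous : forall w, continuous (fun t => W t w) ;
  fbm_start : forall w, W 0 w = 0 }.

(* A process indexed by t >= 0 is represented by a family indexed by R whose
   members at negative times are never used. *)
Definition independent_increments {d} {T : measurableType d} {R : realType}
    (P : probability T R) (X : R -> {RV P >-> R}) : Prop :=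
  forall (n : nat) (t : nat -> R) (B : nat -> set R),
    0 <= t 0%N -> (forall i, t i <= t i.+1) -> (forall i, measurable (B i)) ->
    P (\bigcap_(i in `I_n) [set w | B i (X (t i.+1) w - X (t i) w)]) =
    (\prod_(i < n) P [set w | B i (X (t i.+1) w - X (t i) w)%R])%E.

Definition stationary_increments {d} {T : measurableType d} {R : realType}
    (P : probability T R) (X : R -> {RV P >-> R}) : Prop :=
  forall (s h : R) (B : set R), 0 <= s -> 0 <= h -> measurable B ->
    P [set w | B (X (s + h) w - X s w)] = P [set w | B (X h w - X 0 w)].

Definition cadlag {R : realType} (f : R -> R) : Prop :=
  (forall t, 0 <= t -> f s @[s --> t^'+] --> f t) /\
  (forall t, 0 < t -> cvg (f s @[s --> t^'-])).

Record levy_process {d} {T : measurableType d} {R : realType}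
    (P : probability T R) (X : R -> {RV P >-> R}) : Prop := {
  levy_start : {ae P, forall w, X 0 w = 0} ;
  levy_independent : independent_increments X ;
  levy_stationary : stationary_increments X ;
  levy_cadlag : {ae P, forall w, cadlag (fun t => X t w)} }.

Record stable_levy_process {d} {T : measurableType d} {R : realType}
    (P : probability T R) (alpha nu chi : R) (X : R -> {RV P >-> R}) : Prop := {
  stable_levy : levy_process X ;
  stable_char_fun : forall t xi : R, 0 <= t ->
    char_fun P (X t) xi =
      cexp (- (t * `|xi| `^ alpha)%:C%C *
        ((1 + 'i%C * (nu * Num.sg xi * tan (pi * alpha / 2))%:C%C)
          / chi%:C%C)) }.

Record local_time {d} {T : measurableType d} {R : realType}
    (P : probability T R) (X : R -> {RV P >-> R})
    (L : R -> R -> {RV P >-> R}) : Prop := {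
  local_time_density : {ae P, forall w, forall (t : R) (A : set R),
    0 <= t -> measurable A ->
    lebesgue_measure [set s | 0 <= s <= t /\ A (X s w)] =
    (\int[lebesgue_measure]_(x in A) (L x t w)%:E)%E} ;
  local_time_continuous : {ae P, forall w,
    {within [set p : R * R | 0 <= p.2],
      continuous (fun p : R * R => L p.1 p.2 w)}} }.

Definition process_sigma_algebra {d} {T : measurableType d} {R : realType}
    (I : set R) (Y : R -> T -> R) : set (set T) :=
  <<s \bigcup_(t in I) preimage_set_system [set: T] (Y t) measurable >>.

Definition independent_processes {d} {T : measurableType d} {R : realType}
    (P : probability T R) (I J : set R) (Y Z : R -> T -> R) : Prop :=
  forall A B : set T, process_sigma_algebra I Y A ->
    process_sigma_algebra J Z B -> P (A `&` B) = (P A * P B)%E.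

Definition local_time_fbm {d} {T : measurableType d} {R : realType}
    {P : probability T R} (W : R -> {RV P >-> R}) (L : R -> R -> {RV P >-> R})
    (t : R) (w : T) : R :=
  W (L 0 t w) w.

Definition A1 {R : realType} (alpha nu chi : R) : R :=
  Gamma (1 - 1 / alpha) * Gamma (1 / alpha) * chi `^ (1 / alpha) *
    cos (1 / alpha * atan (nu * tan (pi * alpha / 2))) /
  (pi * alpha *
    (1 + (nu * tan (pi * alpha / 2)) ^+ 2) `^ (1 / (2 * alpha))).

Definition B1 {R : realType} (H alpha nu chi : R) : R :=
  (alpha - 2 * H) / (2 * alpha) *
  (H * A1 alpha nu chi `^ alpha / (1 - 1 / alpha) `^ (alpha - 1))
    `^ (2 * H / (alpha - 2 * H)).

(* x ^ (2 gamma) means (x ^ 2) ^ gamma, as x may be negative. *)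
Definition Lambda1_star {R : realType} (H alpha nu chi x : R) : R :=
  (alpha + 2 * H) / (2 * alpha) *
  ((alpha - 2 * H) / (2 * alpha * B1 H alpha nu chi))
    `^ ((alpha - 2 * H) / (alpha + 2 * H)) *
  (x ^+ 2) `^ (alpha / (alpha + 2 * H)).

Definition ldp_exponent {R : realType} (H alpha : R) : R :=
  2 * H * (alpha - 1) / (alpha - 2 * H).

(* t^(-p) log P{t^(-p) Z(t) in D}; [lne 0 = -oo]. *)
Definition scaled_log_prob {d} {T : measurableType d} {R : realType}
    (P : probability T R) (p : R) (Z : R -> T -> R) (D : set R) (t : R) : \bar R :=
  ((t `^ (- p))%:E * lne (P [set w | D (t `^ (- p) * Z t w)%R]))%E.

(* Main.v *)
Require Import Defs.
From mathcomp Require Import all_boot all_order all_algebra.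
From mathcomp Require Import all_classical all_reals all_analysis.
From mathcomp Require Import measurable_realfun ring lra.
From mathcomp.real_closed Require Import complex.

Set Implicit Arguments.
Unset Strict Implicit.
Unset Printing Implicit Defensive.

Import Order.TTheory GRing.Theory Num.Theory.
Import numFieldNormedType.Exports.
Local Open Scope classical_set_scope.
Local Open Scope ring_scope.

(** Given the local time [L 0 t = y], the variable [Z t] is a centred Gaussian
    variable of variance [y ^ (2 H)], because [W] is independent of the path of
    [X] and the local time is almost surely a function of that path
    ([local_time_fbm_law]). With [r = (alpha - 1) / (alpha - 2 H)], so that [2 H
    r] is the exponent [p] of the statement, write [L 0 t = t ^ r l]. Placing [Z
    t] near [t ^ p x] then costs [t ^ p x ^ 2 / (2 l ^ (2 H))] through the
    Gaussian density. The rescaled local time satisfies [log E exp (theta t ^ (p -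
    r) L 0 t) ~ t ^ p K theta] with [K theta = (theta A1) ^ (alpha / (alpha -
    1))], so that the value [l] costs [t ^ p] times the Legendre transform of [K]
    at [l]. The rate [Lambda1_star x] is the minimum over [l] of the sum of the
    two costs. Its minimiser [l] and the tilt [theta] dual to it are explicit
    ([rate_data]).

    What has to be known about the local time is thus a two-sided estimate of its
    exponential moments, with a growth rate of [E exp (theta L 0 t)] in [t] that
    is exactly [(theta A1) ^ (alpha / (alpha - 1))] ([local_time_exp_le],
    [local_time_exp_ge]). The local time is the limit, almost surely, of the time
    spent in [[- eps, eps]] divided by [2 eps], and that time is a limit of
    Riemann sums over a mesh [h]. The exponential of such a sum is a product of
    factors [1 + c 1_{|S_j| <= eps}] along the random walk [S_j = X (j h)]. By
    independence of increments its mean satisfies, up to small errors, a discrete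
    renewal equation with weights [c P (|y + S_i| <= eps)] for some [y] in [[-
    eps, eps]] ([walk_exp_le], [walk_exp_ge]). By Fourier inversion these
    probabilities are close to [2 eps q (i h) ^ (- 1 / alpha)], where [q] is the
    density of [X 1] at the origin ([visit_probability], [cosine_gamma]). In the
    limit the growth rate [la] solves [theta q (int_0^oo s ^ (- 1 / alpha) e ^ (-
    la s) ds) = 1], and since the integral is [Gamma (1 - 1 / alpha) la ^ (1 /
    alpha - 1)] this gives [la = (theta A1) ^ (alpha / (alpha - 1))] with [A1 =
    Gamma (1 - 1 / alpha) q].

    For the upper bound, the function [l |-> x ^ 2 / (2 l ^ (2 H))] is convex, and
    its tangent at the minimiser has slope [- theta]; the Gaussian tail is
    therefore at most an exponential of the local time, whose mean is known
    ([ldp_upper_exp]). As [Lambda1_star] increases with [|x|], it suffices to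
    bound the probability of [|Z t| >= t ^ p a] for the points [a] whose rate is
    below the infimum over the closure of [D]. For the lower bound, the estimates
    of the exponential moments at tilts close to [theta] show that under the
    tilted law the rescaled local time concentrates near [l]
    ([local_time_window]); on that event the Gaussian density supplies the
    remaining factor ([ldp_lower_exp]). *)

(** * Substitution of powers and Gamma integrals *)

Section power_analysis.
Context {R : realType}.
Implicit Types (a b c p r x : R) (G : R -> R).
Notation mu := (@lebesgue_measure R).

Lemma cvgy_powR r : 0 < r -> x `^ r @[x --> +oo%R] --> +oo%R.
Proof.
move=> r0; apply/cvgryPge => A; near=> x.
have x0 : 0 <= x by near: x; exact: nbhs_pinfty_ge.
have A0 : 0 <= Num.max A 0 by rewrite le_max lexx orbT.
apply: (@le_trans _ _ ((Num.max A 0) `^ r^-1 `^ r)).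
  by rewrite -powRrM mulVf ?gt_eqF// powRr1// le_max lexx.
apply: ge0_ler_powR; rewrite ?nnegrE ?powR_ge0 ?(ltW r0)//.
Unshelve. all: by end_near. Qed.

Lemma cvgy_powRN r : r < 0 -> x `^ r @[x --> +oo%R] --> (0 : R).
Proof.
move=> r0.
have -> : (fun x => x `^ r) = (fun x => (x `^ (- r))^-1).
  by apply/funext => x; rewrite -powRN opprK.
apply/gtr0_cvgV0; last by apply: cvgy_powR; rewrite oppr_gt0.
by near=> x; rewrite powR_gt0.
Unshelve. all: by end_near. Qed.

Lemma is_derive_powR_div r c (u : R) : 0 < c -> 0 < u ->
  is_derive u 1 (fun u : R => (u / c) `^ r) (r * c^-1 * (u / c) `^ (r - 1)).
Proof.
move=> c0 u0; have uc : 0 < u / c by rewrite divr_gt0.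
have h1 : is_derive u 1 (fun u : R => u / c) c^-1.
  by apply: is_derive_eq; rewrite ?scaler1 ?scaler0 ?add0r.
have h2 := @is_derive1_comp R (fun x => x `^ r) (fun u : R => u / c) u _ _
  (is_derive1_powR r uc) h1.
have -> : r / c * (u / c) `^ (r - 1) = r * (u / c) `^ (r - 1) * c^-1 by ring.
exact: h2.
Qed.

Lemma is_derive_continuous (f : R -> R) (x d : R) :
  is_derive x 1 f d -> {for x, continuous f}.
Proof.
by move=> h; apply/differentiable_continuous/derivable1_diffP; case: h.
Qed.

Lemma continuous_powR r (x : R) : 0 < x -> {for x, continuous (fun x => x `^ r)}.
Proof. by move=> x0; apply: is_derive_continuous (is_derive1_powR r x0). Qed.

(** The change of variable is [x = (u / c) ^ r]. The exponent is at most one so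
    that its derivative has a limit at infinity; the singularity that this
    derivative may have at the origin is avoided by exhausting the half-line by
    intervals that start at [1 / (n + 1)]. *)
Lemma integral_subst_powR r c G : 0 < r <= 1 -> 0 < c ->
  {in `]0, +oo[, continuous G} -> (forall x, 0 < x -> 0 <= G x) ->
  (\int[mu]_(x in `]0%R, +oo[) (G x)%:E =
   \int[mu]_(u in `]0%R, +oo[)
     (G ((u / c) `^ r) * (r * c^-1 * (u / c) `^ (r - 1)))%:E)%E.
Proof.
move=> /andP[r0 r1] c0 cG G0.
pose F (u : R) := (u / c) `^ r.
pose F' (u : R) := r * c^-1 * (u / c) `^ (r - 1).
have dF (u : R) : 0 < u -> is_derive u 1 F (F' u).
  by move=> u0; exact: is_derive_powR_div.
have F'E : {in `]0, +oo[, F^`()%classic =1 F'}.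
  move=> u; rewrite in_itv/= andbT => u0.
  by rewrite derive1E (@derive_val _ _ _ _ _ _ _ (dF u u0)).
have cF' : {in `]0, +oo[, continuous F'}.
  move=> u; rewrite in_itv/= andbT => u0.
  apply: (@continuousM _ _ (cst (r * c^-1)) (fun u : R => (u / c) `^ (r - 1)) u).
    exact: cst_continuous.
  exact: is_derive_continuous (is_derive_powR_div _ c0 u0).
have incF : {in `[0, +oo[ &, {homo F : x y / (x < y)%R}}.
  move=> x y; rewrite !in_itv/= !andbT => x0 y0 xy.
  apply: gt0_ltr_powR => //; rewrite ?nnegrE ?divr_ge0 ?(ltW c0)//.
  by rewrite ltr_pM2r ?invr_gt0.
have Fgt0 (u : R) : 0 < u -> 0 < F u by move=> u0; rewrite powR_gt0 ?divr_gt0.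
(* away from the origin the change of variable is continuously differentiable *)
have key (a : R) : 0 < a -> (\int[mu]_(x in `[F a, +oo[) (G x)%:E =
    \int[mu]_(u in `[a, +oo[) (G (F u) * F' u)%:E)%E.
  move=> a0.
  have sub1 (x : R) : x \in `]a, +oo[ -> x \in `]0, +oo[.
    by rewrite !in_itv/= !andbT; exact: lt_trans.
  have eqF : {in `]a, +oo[, F^`()%classic =1 F'}.
    by move=> x xa; apply: F'E; apply: sub1.
  have nearF : \forall x \near a^'+, F' x = F^`()%classic x.
    by near=> x; rewrite eqF// in_itv/= andbT.
  have nearFy : \forall x \near +oo%R, F' x = F^`()%classic x.
    near=> x; rewrite eqF// in_itv/= andbT.
    by near: x; apply: nbhs_pinfty_gt; rewrite num_real.
  have caF : F' x @[x --> a^'+] --> F' a.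
    by apply: cvg_at_right_filter; apply: cF'; rewrite in_itv/= andbT.
  rewrite increasing_ge0_integration_by_substitutiony//.
  - rewrite -integral_itv_obnd_cbnd -?integral_itv_obnd_cbnd.
    + apply: eq_integral => x; rewrite inE => xa.
      by rewrite !fctE eqF.
    + apply/measurable_EFinP; apply: open_continuous_measurable_fun => //.
      move=> x; rewrite inE/= in_itv/= andbT => ax.
      have x0 : 0 < x by apply: lt_trans ax.
      apply: continuousM; last by apply: cF'; rewrite in_itv/= andbT.
      apply: (@continuous_comp _ _ _ F G).
        exact: is_derive_continuous (dF _ x0).
      by apply: cG; rewrite in_itv/= andbT Fgt0.
    + apply/measurable_EFinP; apply: (eq_measurable_fun (fun x => G (F x) * F' x)).
        by move=> x; rewrite inE => xa; rewrite !fctE eqF.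
      apply: open_continuous_measurable_fun => //.
      move=> x; rewrite inE/= in_itv/= andbT => ax.
      have x0 : 0 < x by apply: lt_trans ax.
      apply: continuousM; last by apply: cF'; rewrite in_itv/= andbT.
      apply: (@continuous_comp _ _ _ F G).
        exact: is_derive_continuous (dF _ x0).
      by apply: cG; rewrite in_itv/= andbT Fgt0.
  - move=> x y; rewrite !in_itv/= !andbT => ax ay xy.
    by apply: incF => //; rewrite in_itv/= andbT ltW// (lt_le_trans a0).
  - move=> x; rewrite in_itv/= andbT => ax.
    have x0 : 0 < x by apply: lt_trans ax.
    have n1 : \forall y \near x, F' y = F^`()%classic y.
      near=> y; rewrite F'E// in_itv/= andbT.
      by near: y; exact: lt_nbhsr.
    have cx : {for x, continuous F'} by apply: cF'; rewrite in_itv/= andbT.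
    rewrite /prop_for /continuous_at F'E ?in_itv/= ?andbT//.
    by apply: (cvg_trans (near_eq_cvg n1)); exact: cx.
  - apply/cvg_ex; exists (F' a).
    by apply: (cvg_trans (near_eq_cvg nearF)); exact: caF.
  - have nearK : \forall x \near +oo%R, r / c * c^-1 `^ (r - 1) * x `^ (r - 1) = F' x.
      near=> x; rewrite /F' powRM ?invr_ge0 ?(ltW c0)//.
      by rewrite [x `^ _ * _]mulrC mulrA.
    have [re|rn1] := eqVneq r 1.
      apply/cvg_ex; exists (r / c * c^-1 `^ (r - 1)).
      apply: (cvg_trans (near_eq_cvg nearFy)).
      apply: (cvg_trans (near_eq_cvg nearK)).
      apply: cvg_near_cst; near=> x.
      by rewrite [X in x `^ (X - 1)]re subrr powRr0 mulr1.
    apply/cvg_ex; exists (r / c * c^-1 `^ (r - 1) * 0).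
    apply: (cvg_trans (near_eq_cvg nearFy)).
    apply: (cvg_trans (near_eq_cvg nearK)).
    apply: cvgMr; apply: cvgy_powRN.
    by rewrite subr_lt0 lt_neqAle rn1.
  - split.
      move=> x; rewrite in_itv/= andbT => ax.
      by have [] := dF x (lt_trans a0 ax).
    apply: cvg_at_right_filter.
    exact: is_derive_continuous (dF _ a0).
  - apply: (cvg_trans (near_eq_cvg (g := F) (f := fun x => x `^ r * c^-1 `^ r) _)).
      by near=> x; rewrite /F powRM ?invr_ge0 ?(ltW c0).
    by apply: gt0_cvgMly; [rewrite powR_gt0 ?invr_gt0|exact: cvgy_powR].
  - apply: continuous_in_subspaceT => x; rewrite inE/= in_itv/= andbT => ax.
    by apply: cG; rewrite in_itv/= andbT (lt_le_trans _ ax)// Fgt0.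
  - move=> x; rewrite in_itv/= andbT => ax.
    by apply: G0; rewrite (lt_trans _ ax)// Fgt0.
pose A n : set R := [set` `[F n.+1%:R^-1, +oo[].
pose B n : set R := [set` `[n.+1%:R^-1 : R, +oo[].
have ndA : nondecreasing_seq A.
  move=> m n mn; apply/subsetPset => x; rewrite /A/= !in_itv/= !andbT.
  apply: le_trans; rewrite /F ge0_ler_powR ?nnegrE ?divr_ge0 ?(ltW c0) ?(ltW r0)//.
  by rewrite ler_pM2r ?invr_gt0// lef_pV2 ?posrE// ler_nat.
have ndB : nondecreasing_seq B.
  move=> m n mn; apply/subsetPset => x; rewrite /B/= !in_itv/= !andbT.
  by apply: le_trans; rewrite lef_pV2 ?posrE// ler_nat.
have UB : \bigcup_n B n = `]0, +oo[%classic.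
  apply/seteqP; split=> x /=.
    by move=> [n _]; rewrite /B/= !in_itv/= !andbT; apply: lt_le_trans.
  rewrite in_itv/= andbT => x0; exists (Num.truncn x^-1) => //=.
  rewrite /B /= in_itv/= andbT -[leRHS]invrK lef_pV2 ?posrE ?invr_gt0//.
  by rewrite ltW// truncnS_gt.
have UA : \bigcup_n A n = `]0, +oo[%classic.
  apply/seteqP; split=> x /=.
    move=> [n _]; rewrite /A/= !in_itv/= !andbT; apply: lt_le_trans.
    by rewrite Fgt0// invr_gt0.
  rewrite in_itv/= andbT => x0.
  have : (\bigcup_n B n) (x `^ r^-1 * c).
    by rewrite UB/= in_itv/= andbT mulr_gt0// powR_gt0.
  move=> [n _]; rewrite /B/= in_itv/= andbT => nx; exists n => //.
  rewrite /A/= in_itv/= andbT.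
  have -> : x = F (x `^ r^-1 * c).
    by rewrite /F mulfK ?gt_eqF// -powRrM mulVf ?gt_eqF// powRr1// ltW.
  rewrite /F ge0_ler_powR ?nnegrE ?divr_ge0 ?mulr_ge0 ?powR_ge0 ?(ltW c0) ?(ltW r0)//.
  by rewrite ler_pM2r ?invr_gt0.
have mG0 : measurable_fun (`]0%R, +oo[%classic : set R) (fun x => (G x)%:E).
  apply/measurable_EFinP; apply: open_continuous_measurable_fun => //.
  by move=> x; rewrite inE; exact: cG.
have mGF0 : measurable_fun (`]0%R, +oo[%classic : set R) (fun x => (G (F x) * F' x)%:E).
  apply/measurable_EFinP; apply: open_continuous_measurable_fun => //.
  move=> x; rewrite inE/= in_itv/= andbT => x0.
  apply: continuousM; last by apply: cF'; rewrite in_itv/= andbT.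
  apply: (@continuous_comp _ _ _ F G).
    exact: is_derive_continuous (dF _ x0).
  by apply: cG; rewrite in_itv/= andbT Fgt0.
have subA n : A n `<=` `]0, +oo[%classic by rewrite -UA; exact: bigcup_sup.
have subB n : B n `<=` `]0, +oo[%classic by rewrite -UB; exact: bigcup_sup.
have cA : (\int[mu]_(x in A n) (G x)%:E @[n --> \oo] -->
    \int[mu]_(x in `]0%R, +oo[) (G x)%:E)%E.
  rewrite -UA; apply: ge0_nondecreasing_set_cvg_integral => //.
  - by move=> n; exact: measurable_itv.
  - by move=> n; apply: measurable_funS mG0; [exact: measurable_itv|exact: subA].
  - move=> n x /subA/=; rewrite in_itv/= andbT => x0.
    by rewrite lee_fin G0.
have cB : (\int[mu]_(x in B n) (G (F x) * F' x)%:E @[n --> \oo] -->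
    \int[mu]_(x in `]0%R, +oo[) (G (F x) * F' x)%:E)%E.
  rewrite -UB; apply: ge0_nondecreasing_set_cvg_integral => //.
  - by move=> n; exact: measurable_itv.
  - by move=> n; apply: measurable_funS mGF0; [exact: measurable_itv|exact: subB].
  - move=> n x /subB/=; rewrite in_itv/= andbT => x0.
    by rewrite lee_fin mulr_ge0 ?G0 ?Fgt0// !mulr_ge0 ?powR_ge0 ?invr_ge0 ?(ltW c0) ?(ltW r0).
apply: (cvg_unique _ cA); first exact: ereal_hausdorff.
rewrite (_ : (fun n => _) = (fun n => (\int[mu]_(x in B n) (G (F x) * F' x)%:E)%E)) //.
by apply/funext => n; rewrite /A key ?invr_gt0.
Unshelve. all: by end_near. Qed.
End power_analysis.

Section gamma_integrals.
Context {R : realType}.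
Implicit Types (a b c p r x : R) (f g F : R -> R).
Notation mu := (@lebesgue_measure R).
Notation Rp := (`]0%R, +oo[%classic : set R).

Lemma in_Rp x : (x \in `]0, +oo[) = (0 < x).
Proof. by rewrite in_itv/= andbT. Qed.

Lemma measurable_fun_Rp f : (forall x, 0 < x -> {for x, continuous f}) ->
  measurable_fun Rp f.
Proof.
move=> cf; apply: open_continuous_measurable_fun => //.
by move=> x; rewrite inE/= in_Rp; exact: cf.
Qed.

Lemma integrable_Rp_le f g : (forall x, 0 < x -> {for x, continuous f}) ->
  (forall x, 0 < x -> `|f x| <= g x) ->
  mu.-integrable Rp (EFin \o g) -> mu.-integrable Rp (EFin \o f).
Proof.
move=> cf fg; apply: le_integrable => //.
  by apply/measurable_EFinP; exact: measurable_fun_Rp.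
move=> x /=; rewrite in_Rp => x0; rewrite lee_fin.
by rewrite (le_trans (fg _ x0))// ler_norm.
Qed.

(** On the open half-line the integrands below are continuous but may be singular
    at the origin, so that integrability comes from a finite integral. *)
Lemma integrable_Rp_ge0 g : (forall x, 0 < x -> {for x, continuous g}) ->
  (forall x, 0 < x -> 0 <= g x) ->
  (\int[mu]_(x in Rp) (g x)%:E < +oo)%E -> mu.-integrable Rp (EFin \o g).
Proof.
move=> cg g0 ig; apply/integrableP; split.
  by apply/measurable_EFinP; exact: measurable_fun_Rp.
rewrite [ltLHS](_ : _ = \int[mu]_(x in Rp) (g x)%:E)%E//; apply: eq_integral => x.
by rewrite inE/= in_Rp => x0; rewrite /= ger0_norm// g0.
Qed.

(** Fundamental theorem of calculus for an integrand that may blow up at the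
    origin and change sign: exhaust the half-line by compact intervals and use
    dominated convergence. *)
Lemma Rintegral_FTC2_Rp f F (l0 l : R) :
  (forall x, 0 < x -> {for x, continuous f}) ->
  mu.-integrable Rp (EFin \o f) ->
  (forall x, 0 < x -> is_derive x 1 F (f x)) ->
  F x @[x --> 0^'+] --> l0 -> F x @[x --> +oo%R] --> l ->
  \int[mu]_(x in Rp) f x = l - l0.
Proof.
move=> cf intf dF F0 Fy.
pose I n : set R := [set` `[n.+2%:R^-1, (n.+2%:R : R)]].
have mI n : measurable (I n) by exact: measurable_itv.
have lt2 n : (n.+2%:R^-1 : R) < n.+2%:R.
  by rewrite (@lt_trans _ _ 1)// ?invf_lt1 ?ltr1n.
have i0 n : 0 < n.+2%:R^-1 :> R by rewrite invr_gt0.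
have IRp n : I n `<=` Rp.
  move=> x; rewrite /I/= !in_itv/= andbT => /andP[h _].
  exact: lt_le_trans h.
have FTC n : (\int[mu]_(x in I n) (f x)%:E = (F n.+2%:R - F n.+2%:R^-1)%:E)%E.
  rewrite EFinB; apply: continuous_FTC2 => //.
  - apply: continuous_in_subspaceT => x; rewrite inE => /(IRp n)/=.
    by rewrite in_Rp; exact: cf.
  - split.
    + move=> x xI; have /= : Rp x.
        by apply: (IRp n); move: xI; rewrite /I/= !in_itv/= => /andP[/ltW-> /ltW->].
      by rewrite in_Rp => /dF[].
    + by apply: cvg_at_right_filter; exact: is_derive_continuous (dF _ _).
    + by apply: cvg_at_left_filter; exact: is_derive_continuous (dF _ _).
  - move=> x xI; have /= : Rp x.
      by apply: (IRp n); move: xI; rewrite /I/= !in_itv/= => /andP[/ltW-> /ltW->].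
    by rewrite in_Rp => /dF h; rewrite derive1E derive_val.
have cvg1 : (\int[mu]_(x in I n) (f x)%:E @[n --> \oo] --> \int[mu]_(x in Rp) (f x)%:E)%E.
  have mf : measurable_fun Rp (EFin \o f).
    by apply/measurable_EFinP; exact: measurable_fun_Rp.
  have [] := @dominated_convergence _ _ R mu Rp (measurable_itv _)
    (fun n => (EFin \o f) \_ (I n)) (EFin \o f) (abse \o (EFin \o f)) => //.
  - move=> n; apply/measurable_restrict => //; first exact: mI.
    by apply: measurable_funS mf; [exact: measurable_itv|exact: subIsetl].
  - apply: aeW => x; rewrite /= in_Rp => x0.
    apply: cvg_near_cst; near=> n.
    rewrite patchE ifT// inE /I/= in_itv/=; apply/andP; split.
      rewrite -[leRHS]invrK lef_pV2 ?posrE ?invr_gt0//.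
      rewrite (@le_trans _ _ n%:R)// ?ler_nat ?leqW//.
      by near: n; exact: nbhs_infty_ger.
    rewrite (@le_trans _ _ n%:R)// ?ler_nat ?leqW//.
    by near: n; exact: nbhs_infty_ger.
  - exact: integrable_abse.
  - apply: aeW => x n _; rewrite patchE /=; case: ifPn => // _.
    by rewrite abse0 lee_fin.
  move=> _ _; apply: cvg_trans; apply: near_eq_cvg; near=> n => /=.
  by rewrite -integral_mkcondr setIidr.
have : F n.+2%:R - F n.+2%:R^-1 @[n --> \oo] --> l - l0.
  apply: cvgB.
  - apply: (cvg_comp (fun n => n.+2%:R : R) F _ Fy).
    apply/cvgryPge => A; near=> n.
    rewrite (@le_trans _ _ n%:R)// ?ler_nat ?leqW//.
    by near: n; exact: nbhs_infty_ger.
  - move/cvg_at_rightP : F0 => /(_ (fun n => n.+2%:R^-1)); apply; split => //.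
    apply/gtr0_cvgV0; first by near=> n; rewrite ltr0n.
    apply/cvgryPge => A; near=> n.
    rewrite (@le_trans _ _ n%:R)// ?ler_nat ?leqW//.
    by near: n; exact: nbhs_infty_ger.
move=> cvg2.
suff : ((\int[mu]_(x in Rp) f x)%:E = (l - l0)%:E)%E by case.
rewrite /Rintegral fineK; last exact: integrable_fin_num.
have cvg3 : (\int[mu]_(x in I n) (f x)%:E @[n --> \oo] --> (l - l0)%:E)%E.
  rewrite (_ : (fun n => _) = (fun n => (F n.+2%:R - F n.+2%:R^-1)%:E)).
    by apply: cvg_EFin => //; exact: nearW.
  by apply/funext => n; rewrite FTC.
by apply: (cvg_unique _ cvg1 cvg3); exact: ereal_hausdorff.
Unshelve. all: by end_near. Qed.

Lemma is_derive_comp_eq f g x a b c : is_derive (g x) 1 f a ->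
  is_derive x 1 g b -> c = a * b -> is_derive x 1 (fun x => f (g x)) c.
Proof. by move=> df dg ->; exact: (is_derive1_comp df dg). Qed.

Lemma is_derive_expRM b x :
  is_derive x 1 (fun x => expR (- (b * x))) (- b * expR (- (b * x))).
Proof.
have h : is_derive x 1 (fun x => - (b * x)) (- b).
  by apply: is_derive_eq; rewrite /GRing.scale/= mulr1.
by apply: (is_derive_comp_eq (f := expR) (is_derive_expR _) h); rewrite mulrC.
Qed.

Lemma continuous_expRM b x : {for x, continuous (fun x => expR (- (b * x)))}.
Proof. exact: is_derive_continuous (is_derive_expRM b x). Qed.

Lemma cvgy_expRM b : 0 < b -> expR (- (b * x)) @[x --> +oo%R] --> (0 : R).
Proof.
move=> b0; apply: (cvg_comp (fun x => b * x) (fun y => expR (- y))).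
  by apply: gt0_cvgMry => //; exact: cvg_id.
exact: cvgr_expR.
Qed.

Lemma integrable_expRM b : 0 < b ->
  mu.-integrable Rp (EFin \o (fun x => expR (- (b * x)))).
Proof.
move=> b0; apply: integrable_Rp_ge0.
- by move=> x _; exact: continuous_expRM.
- by move=> x _; exact: expR_ge0.
rewrite integral_itv_obnd_cbnd; last first.
  apply/measurable_EFinP; apply: measurable_fun_Rp => x _.
  exact: continuous_expRM.
have dE x : is_derive x 1 (fun x => - b^-1 * expR (- (b * x))) (expR (- (b * x))).
  have h := is_derive_expRM b x.
  apply: is_derive_eq; rewrite /GRing.scale/=.
  by field; rewrite gt_eqF.
rewrite (@ge0_continuous_FTC2y _ _ (fun x => - b^-1 * expR (- (b * x))) 0 0).
- by rewrite -EFinB ltry.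
- by move=> x _; exact: expR_ge0.
- by apply: continuous_subspaceT => x; exact: continuous_expRM.
- by rewrite -(mulr0 (- b^-1)); apply: cvgMr; exact: cvgy_expRM.
- by move=> x _; case: (dE x).
- by apply: cvg_at_right_filter; apply: cvgMr; exact: continuous_expRM.
- by move=> x _; rewrite derive1E; have h := dE x; rewrite derive_val.
Qed.

End gamma_integrals.

Section integrable_EFin.
Context d (T : measurableType d) (R : realType) (mu : {measure set T -> \bar R}).
Variables (D : set T) (mD : measurable D).
Implicit Types f g : T -> R.

Lemma integrable_EFinD f g : mu.-integrable D (EFin \o f) ->
  mu.-integrable D (EFin \o g) -> mu.-integrable D (EFin \o (fun x => f x + g x)).
Proof. by move=> fi gi; exact: (integrableD mD fi gi). Qed.

Lemma integrable_EFinB f g : mu.-integrable D (EFin \o f) ->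
  mu.-integrable D (EFin \o g) -> mu.-integrable D (EFin \o (fun x => f x - g x)).
Proof. by move=> fi gi; exact: (integrableB mD fi gi). Qed.

Lemma integrable_EFinZl f (r : R) : mu.-integrable D (EFin \o f) ->
  mu.-integrable D (EFin \o (fun x => r * f x)).
Proof. by move=> fi; exact: (integrableZl mD _ fi). Qed.

End integrable_EFin.

Section gamma_integrals2.
Context {R : realType}.
Implicit Types (a b c p r x : R) (f g F : R -> R).
Notation mu := (@lebesgue_measure R).
Notation Rp := (`]0%R, +oo[%classic : set R).

Lemma continuous_at_comp f g x : {for x, continuous f} ->
  {for f x, continuous g} -> {for x, continuous (fun x => g (f x))}.
Proof. by move=> cf cg; exact: (cvg_comp f g cf cg). Qed.

Lemma continuous_scale c x : {for x, continuous (fun x => c * x)}.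
Proof. by apply: cvgMr; exact: cvg_id. Qed.

Lemma continuous_stretched (gam c alpha x : R) : 0 < x ->
  {for x, continuous (fun x => x `^ gam * expR (- (c * x `^ alpha)))}.
Proof.
move=> x0; apply: continuousM; first exact: continuous_powR.
apply: (@continuous_at_comp (fun x => x `^ alpha) (fun y => expR (- (c * y)))).
  exact: continuous_powR.
exact: continuous_expRM.
Qed.

Lemma continuous_cst1 x : {for x, continuous (cst 1 : R -> R)}.
Proof. exact: cst_continuous. Qed.

(** The substitution [u = c * x ^ alpha] absorbs both the scale [c] and the
    exponent [alpha]; the factor [g] serves for the constant one and for an
    oscillating factor. *)
Lemma integral_gamma_subst (alpha c gam : R) g : 1 <= alpha -> 0 < c ->
  (forall x, 0 < x -> {for x, continuous g}) -> (forall x, 0 < x -> 0 <= g x) ->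
  (\int[mu]_(x in Rp)
     (x `^ gam * expR (- (c * x `^ alpha)) * g (c * x `^ alpha))%:E =
   \int[mu]_(u in Rp) (alpha^-1 * c `^ (- ((1 + gam) / alpha)) *
     (u `^ ((1 + gam) / alpha - 1) * expR (- u) * g u))%:E)%E.
Proof.
move=> al1 c0 cg g0.
have al0 : 0 < alpha by apply: lt_le_trans al1.
rewrite (@integral_subst_powR _ alpha^-1 c _ _ c0).
- apply: eq_integral => u; rewrite inE/= in_Rp => u0; congr EFin.
  have uc : 0 < u / c by rewrite divr_gt0.
  rewrite -!powRrM mulVf ?gt_eqF// powRr1 ?ltW//.
  rewrite [c * (u / c)]mulrC divfK ?gt_eqF//.
  have -> : (u / c) `^ (alpha^-1 * gam) * expR (- u) * g u *
      (alpha^-1 / c * (u / c) `^ (alpha^-1 - 1)) = alpha^-1 * c^-1 *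
      ((u / c) `^ (alpha^-1 * gam) * (u / c) `^ (alpha^-1 - 1)) *
      (expR (- u) * g u) by ring.
  rewrite -powRD ?(gt_eqF uc) ?implybT//.
  have -> : alpha^-1 * gam + (alpha^-1 - 1) = (1 + gam) / alpha - 1 by field; rewrite gt_eqF.
  have -> : c `^ (- ((1 + gam) / alpha)) = c^-1 * c^-1 `^ ((1 + gam) / alpha - 1).
    rewrite -[in RHS](powR_inv1 (ltW c0)) -[in RHS]powRrM -powRD ?(gt_eqF c0) ?implybT//.
    by congr (_ `^ _); ring.
  by rewrite powRM ?invr_ge0 ?ltW//; ring.
- by rewrite invr_gt0 al0 invf_le1.
- move=> x; rewrite in_Rp => x0.
  have cx : {for x, continuous (fun x => c * x `^ alpha)}.
    apply: (continuous_at_comp (f := fun x => x `^ alpha)); first exact: continuous_powR.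
    exact: continuous_scale.
  change {for x, continuous (fun x : R =>
    x `^ gam * expR (- (c * x `^ alpha)) * g (c * x `^ alpha))}.
  apply: continuousM; first exact: continuous_stretched.
  by apply: (continuous_at_comp cx); apply: cg; rewrite mulr_gt0 ?powR_gt0.
- by move=> x x0; rewrite !mulr_ge0 ?powR_ge0 ?expR_ge0// g0// mulr_gt0 ?powR_gt0.
Qed.

Lemma continuous_gamma_kernel a x : 0 < x ->
  {for x, continuous (fun u => u `^ a * expR (- u))}.
Proof.
move=> x0; apply: continuousM; first exact: continuous_powR.
apply: (continuous_at_comp (f := fun y => - y)); first exact: continuousN.
exact: continuous_expR.
Qed.

(** The substitution of [integral_gamma_subst] with [alpha = 1 / a] and [gam = 0]
    removes the singularity at the origin: what remains is a stretched
    exponential, at most [exp (1 - x)]. *)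
Lemma integrable_gamma a : 0 < a <= 1 ->
  mu.-integrable Rp (EFin \o (fun u => u `^ (a - 1) * expR (- u))).
Proof.
move=> /andP[a0 a1].
apply: integrable_Rp_ge0.
- by move=> x x0; exact: continuous_gamma_kernel.
- by move=> x x0; rewrite mulr_ge0 ?powR_ge0 ?expR_ge0.
(* read from right to left, the substitution makes the singular power
   disappear *)
have := @integral_gamma_subst a^-1 1 0 (cst 1).
rewrite invf_ge1// => /(_ a1 ltr01 (fun x _ => @continuous_cst1 x) (fun _ _ => ler01)).
rewrite /= addr0 invrK powR1 mul1r mulr1 => h.
suff : (\int[mu]_(x in Rp) (a * (x `^ (a - 1) * expR (- x)))%:E < +oo)%E.
  under eq_integral do rewrite EFinM.
  rewrite ge0_integralZl//; last 3 first.
  - by apply/measurable_EFinP; apply: measurable_fun_Rp => x x0; exact: continuous_gamma_kernel.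
  - by move=> x _; rewrite lee_fin mulr_ge0 ?powR_ge0 ?expR_ge0.
  - by rewrite lee_fin ltW.
  set I := (\int[mu]_(_ in _) _)%E.
  case: I => //=; first by move=> s _; rewrite ltry.
  by rewrite gt0_muley ?lte_fin.
rewrite [ltLHS](_ : _ = \int[mu]_(x in Rp)
    (x `^ 0 * expR (- (1 * x `^ a^-1)) * 1)%:E)%E; last first.
  by rewrite h; apply: eq_integral => u _; rewrite mulr1.
apply: (@le_lt_trans _ _ (\int[mu]_(x in Rp) (expR 1 * expR (- (1 * x)))%:E)%E).
  apply: ge0_le_integral => //.
  - by move=> x _; rewrite lee_fin !mulr_ge0 ?powR_ge0 ?expR_ge0.
  - apply/measurable_EFinP; apply: measurable_fun_Rp => x x0.
    apply: continuousM; last exact: cst_continuous.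
    exact: continuous_stretched.
  - apply/measurable_EFinP; apply: measurable_fun_Rp => x x0.
    by apply: continuousM; [exact: cst_continuous|exact: continuous_expRM].
  - move=> x; rewrite /= in_Rp => x0.
    rewrite lee_fin powRr0 mulr1 !mul1r -expRD ler_expR.
    have [x1|x1] := leP x 1.
      by rewrite (@le_trans _ _ 0)// ?oppr_le0 ?powR_ge0// subr_ge0.
    have : x <= x `^ a^-1 by apply: le1r_powR; rewrite ?invf_ge1// ltW.
    lra.
under eq_integral do rewrite EFinM.
have := integrable_expRM (@ltr01 R) => ie.
rewrite integralZl//.
have /integrable_fin_num : mu.-integrable Rp (EFin \o (fun x => expR (- (1 * x)))) by [].
move=> /(_ (measurable_itv _)); rewrite ge0_fin_numE => [h2|]; last first.
  by apply: integral_ge0 => x _; rewrite lee_fin expR_ge0.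
by rewrite lte_mul_pinfty// lee_fin expR_ge0.
Qed.

Lemma GammaE a : 0 < a <= 1 ->
  ((Gamma a)%:E = \int[mu]_(u in Rp) (u `^ (a - 1) * expR (- u))%:E)%E.
Proof.
move=> a01; rewrite /Gamma /Rintegral fineK//.
exact: (integrable_fin_num _ (integrable_gamma a01)).
Qed.

Lemma Gamma_gt0 a : 0 < a <= 1 -> 0 < Gamma a.
Proof.
move=> a01.
have ge0 : 0 <= Gamma a.
  by apply: Rintegral_ge0 => u _; rewrite mulr_ge0 ?powR_ge0 ?expR_ge0.
rewrite lt_neqAle ge0 andbT eq_sym; apply/eqP => G0.
have := GammaE a01; rewrite G0 => /esym/eqP.
have sub : `[1, 2]%classic `<=` Rp.
  by move=> x /=; rewrite !in_itv/= andbT => /andP[x1 _]; apply: lt_le_trans x1.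
have mk : measurable_fun Rp (fun u => (u `^ (a - 1) * expR (- u))%:E).
  by apply/measurable_EFinP; apply: measurable_fun_Rp => x x0; exact: continuous_gamma_kernel.
rewrite gt_eqF//.
apply: (@lt_le_trans _ _ (\int[mu]_(u in `[1%R, 2%R]) (2 `^ (a - 1) * expR (- 2))%:E)%E).
  rewrite integral_cst//= lebesgue_measure_itv/= lte_fin ltr1n -EFinB -EFinM lte_fin.
  by rewrite !mulr_gt0 ?powR_gt0 ?expR_gt0//; lra.
apply: (@le_trans _ _ (\int[mu]_(u in `[1%R, 2%R]) (u `^ (a - 1) * expR (- u))%:E)%E).
  apply: ge0_le_integral => //.
  - by apply: (measurable_funS (measurable_itv _) sub mk).
  - move=> x /=; rewrite in_itv/= => /andP[x1 x2].
    rewrite lee_fin ler_pM ?powR_ge0 ?expR_ge0// ?ler_expR; last by lra.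
    have xp : 0 < x by apply: lt_le_trans x1.
    have -> : a - 1 = - (1 - a) by ring.
    rewrite !powRN lef_pV2 ?posrE ?powR_gt0//.
    case/andP: a01 => _ a1; apply: ge0_ler_powR => //; rewrite ?nnegrE ?subr_ge0//.
    exact: ltW.
apply: ge0_subset_integral => //.
by move=> x _; rewrite lee_fin mulr_ge0 ?powR_ge0 ?expR_ge0.
Qed.

Lemma integral_stretched (alpha c gam : R) : 1 <= alpha -> 0 < c ->
  -1 < gam -> 1 + gam <= alpha ->
  (\int[mu]_(x in Rp) (x `^ gam * expR (- (c * x `^ alpha)))%:E =
   (alpha^-1 * Gamma ((1 + gam) / alpha) * c `^ (- ((1 + gam) / alpha)))%:E)%E.
Proof.
move=> al1 c0 gam1 gam2.
have al0 : 0 < alpha by apply: lt_le_trans al1.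
have a01 : 0 < (1 + gam) / alpha <= 1.
  by rewrite divr_gt0//= ?ler_pdivrMr ?mul1r//; lra.
have := @integral_gamma_subst alpha c gam (cst 1) al1 c0
  (fun x _ => @continuous_cst1 x) (fun _ _ => ler01).
under eq_integral do rewrite mulr1.
move=> ->.
under eq_integral do rewrite /= mulr1 EFinM.
rewrite integralZl//; last exact: integrable_gamma.
rewrite -GammaE// -EFinM; congr EFin; ring.
Qed.

Lemma integrable_stretched (alpha c gam : R) : 1 <= alpha -> 0 < c ->
  -1 < gam -> 1 + gam <= alpha ->
  mu.-integrable Rp (EFin \o (fun x => x `^ gam * expR (- (c * x `^ alpha)))).
Proof.
move=> al1 c0 gam1 gam2; apply: integrable_Rp_ge0.
- by move=> x x0; exact: continuous_stretched.
- by move=> x x0; rewrite mulr_ge0 ?powR_ge0 ?expR_ge0.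
- by rewrite integral_stretched// ltry.
Qed.

End gamma_integrals2.

(** * The cosine transform of the Gamma kernel *)

Section cosine_gamma.
Context {R : realType}.
Implicit Types (b c p r x t u : R) (f g F : R -> R).
Notation mu := (@lebesgue_measure R).
Notation Rp := (`]0%R, +oo[%classic : set R).
Variable a : R.
Hypothesis a01 : 0 < a <= 1.

Let a0 : 0 < a. Proof. by case/andP: a01. Qed.
Let a1 : a <= 1. Proof. by case/andP: a01. Qed.

Let k u := u `^ (a - 1) * expR (- u).
Let k1 u := u `^ a * expR (- u).

Let k1E u : 0 < u -> k1 u = u * k u.
Proof.
by move=> u0; rewrite /k1 /k mulrA -{1}(mulr_powRB1 (ltW u0) a0).
Qed.

Let mul_expR_half u : 0 < u -> u * expR (- u) <= 2 * expR (- (2^-1 * u)).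
Proof.
move=> u0.
have e2 : expR (- u) = expR (- (2^-1 * u)) * expR (- (2^-1 * u)).
  by rewrite -expRD; congr expR; field.
rewrite e2 mulrA ler_wpM2r ?expR_ge0// expRN ler_pdivrMr ?expR_gt0//.
have := expR_ge1Dx (2^-1 * u); lra.
Qed.

Let integrable_k1 : mu.-integrable Rp (EFin \o k1).
Proof.
apply: (@integrable_Rp_le _ _ (fun u => 2 * (u `^ (a - 1) * expR (- (2^-1 * u `^ 1))))).
- by move=> x x0; exact: continuous_gamma_kernel.
- move=> x x0; rewrite ger0_norm ?mulr_ge0 ?powR_ge0 ?expR_ge0//.
  rewrite -/(k1 x) k1E// /k powRr1 ?(ltW x0)//.
  have -> : x * (x `^ (a - 1) * expR (- x)) = x `^ (a - 1) * (x * expR (- x)) by ring.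
  have -> : 2 * (x `^ (a - 1) * expR (- (2^-1 * x))) =
    x `^ (a - 1) * (2 * expR (- (2^-1 * x))) by ring.
  by apply: ler_wpM2l; [exact: powR_ge0|exact: mul_expR_half].
- apply: integrable_EFinZl => //; apply: integrable_stretched => //.
  by rewrite ltrBDr addNr.
  by rewrite addrC subrK.
Qed.

(* The pair [h, h'] stands for cosine and minus sine, and for sine and
   cosine. *)
Variables h h' : R -> R.
Hypothesis dh : forall x, is_derive x 1 h (h' x).
Hypothesis h1 : forall x, `|h x| <= 1.
Hypothesis h'1 : forall x, `|h' x| <= 1.
Hypothesis ch' : continuous h'.

Let ch x : {for x, continuous h}.
Proof. exact: is_derive_continuous (dh x). Qed.

Let cht t x : {for x, continuous (fun x => h (t * x))}.
Proof.
by apply: (@continuous_at_comp _ (fun x => t * x) h); [exact: continuous_scale|exact: ch].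
Qed.

Let ch't t x : {for x, continuous (fun x => h' (t * x))}.
Proof.
by apply: (@continuous_at_comp _ (fun x => t * x) h'); [exact: continuous_scale|exact: ch'].
Qed.

Lemma integrable_gamma_osc t : mu.-integrable Rp (EFin \o (fun u => k u * h (t * u))).
Proof.
apply: (@integrable_Rp_le _ _ k _ _ (integrable_gamma a01)).
- by move=> x x0; apply: continuousM; [exact: continuous_gamma_kernel|exact: cht].
- move=> x x0; rewrite normrM ger0_norm ?mulr_ge0 ?powR_ge0 ?expR_ge0//.
  by rewrite ler_piMr// mulr_ge0 ?powR_ge0 ?expR_ge0.
Qed.

Lemma integrable_gammaS_osc t : mu.-integrable Rp (EFin \o (fun u => k1 u * h (t * u))).
Proof.
apply: (@integrable_Rp_le _ _ k1 _ _ integrable_k1).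
- by move=> x x0; apply: continuousM; [exact: continuous_gamma_kernel|exact: cht].
- move=> x x0; rewrite normrM ger0_norm ?mulr_ge0 ?powR_ge0 ?expR_ge0//.
  by rewrite ler_piMr// mulr_ge0 ?powR_ge0 ?expR_ge0.
Qed.

Lemma integrable_gammaS_osc' t : mu.-integrable Rp (EFin \o (fun u => k1 u * h' (t * u))).
Proof.
apply: (@integrable_Rp_le _ _ k1 _ _ integrable_k1).
- by move=> x x0; apply: continuousM; [exact: continuous_gamma_kernel|exact: ch't].
- move=> x x0; rewrite normrM ger0_norm ?mulr_ge0 ?powR_ge0 ?expR_ge0//.
  by rewrite ler_piMr// mulr_ge0 ?powR_ge0 ?expR_ge0.
Qed.

(** Differentiation under the integral sign: the derivative in [t] is dominated by
    the Gamma kernel of exponent [a + 1]. *)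
Lemma is_derive_gamma_osc t :
  is_derive t 1 (fun t => \int[mu]_(u in Rp) (k u * h (t * u)))
    (\int[mu]_(u in Rp) (k1 u * h' (t * u))).
Proof.
have It : (`]t - 1, t + 1[%classic : set R) t.
  by rewrite /= in_itv/=; apply/andP; split; lra.
have dx x u : is_derive x 1 (fun x => k u * h (x * u)) (k u * (u * h' (x * u))).
  have dxu : is_derive x 1 (fun x => x * u) u.
    by apply: is_derive_eq; rewrite /GRing.scale/=; ring.
  have h2 := @is_derive_comp_eq _ h (fun x => x * u) x _ _ (u * h' (x * u))
    (dh (x * u)) dxu (mulrC _ _).
  by apply: is_derive_eq; rewrite /GRing.scale/=.
have d1E x u : partial1of2 (fun t u => k u * h (t * u)) x u = k u * (u * h' (x * u)).
  rewrite partial1of2E; have h2 := dx x u; exact: derive_val.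
have intf x : (`]t - 1, t + 1[%classic : set R) x ->
    mu.-integrable Rp (EFin \o (fun u => k u * h (x * u))).
  by move=> _; exact: integrable_gamma_osc.
have derf x u : (`]t - 1, t + 1[%classic : set R) x -> Rp u ->
    derivable (fun x => k u * h (x * u)) x 1.
  by move=> _ _; case: (dx x u).
have k1_ge0 u : 0 <= k1 u by rewrite mulr_ge0 ?powR_ge0 ?expR_ge0.
have ub x u : (`]t - 1, t + 1[%classic : set R) x -> Rp u ->
    `|partial1of2 (fun t u => k u * h (t * u)) x u| <= k1 u.
  move=> _; rewrite /= in_Rp => u0; rewrite d1E k1E// mulrA normrM.
  rewrite [k u * u]mulrC (@ger0_norm _ (u * k u)).
    by rewrite ler_piMr// !mulr_ge0 ?powR_ge0 ?expR_ge0 ?ltW.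
  by rewrite !mulr_ge0 ?powR_ge0 ?expR_ge0 ?ltW.
have D := @derivable_under_integral R _ _ mu (fun t u => k u * h (t * u)) Rp
  (measurable_itv _) t (t - 1) (t + 1) It intf derf k1 k1_ge0 integrable_k1 ub.
have E := @differentiation_under_integral R _ _ mu (fun t u => k u * h (t * u)) Rp
  (measurable_itv _) t (t - 1) (t + 1) It intf derf k1 k1_ge0 integrable_k1 ub.
apply: DeriveDef => //; rewrite -derive1E E.
apply: eq_Rintegral => u; rewrite inE/= in_Rp => u0.
by rewrite d1E k1E//; ring.
Qed.

(** The derivative of [u ^ a e ^ (- u) h (t u)] integrates to zero. Together with
    [is_derive_gamma_osc] this closes the system of differential equations
    satisfied by the cosine and sine transforms. *)
Lemma gamma_osc_by_parts t :
  a * (\int[mu]_(u in Rp) (k u * h (t * u))) =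
  \int[mu]_(u in Rp) (k1 u * h (t * u)) -
  t * (\int[mu]_(u in Rp) (k1 u * h' (t * u))).
Proof.
pose f u := a * (k u * h (t * u)) - k1 u * h (t * u) + t * (k1 u * h' (t * u)).
pose F u := k1 u * h (t * u).
have i1 : mu.-integrable Rp (EFin \o (fun u => a * (k u * h (t * u)))).
  rewrite (_ : _ \o _ = (fun u => a%:E * (k u * h (t * u))%:E)%E); last first.
    by apply/funext => u; rewrite /= EFinM.
  by apply: integrableZl => //; exact: integrable_gamma_osc.
have i3 : mu.-integrable Rp (EFin \o (fun u => t * (k1 u * h' (t * u)))).
  rewrite (_ : _ \o _ = (fun u => t%:E * (k1 u * h' (t * u))%:E)%E); last first.
    by apply/funext => u; rewrite /= EFinM.
  by apply: integrableZl => //; exact: integrable_gammaS_osc'.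
have i12 : mu.-integrable Rp (EFin \o (fun u => a * (k u * h (t * u)) - k1 u * h (t * u))).
  by apply: integrable_EFinB => //; exact: integrable_gammaS_osc.
have intf : mu.-integrable Rp (EFin \o f) by exact: integrable_EFinD.
suff : \int[mu]_(u in Rp) f u = 0 - 0.
  rewrite RintegralD// RintegralB//; last exact: integrable_gammaS_osc.
  rewrite RintegralZl//; last exact: integrable_gamma_osc.
  rewrite RintegralZl//; last exact: integrable_gammaS_osc'.
  move: (Rintegral _ _ _) (Rintegral _ _ _) (Rintegral _ _ _) => A B C; lra.
apply: (Rintegral_FTC2_Rp (F := F)) => //.
- move=> x x0; apply: continuousD; [apply: continuousB|].
  + apply: continuousM; first exact: cst_continuous.
    by apply: continuousM; [exact: continuous_gamma_kernel|exact: cht].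
  + by apply: continuousM; [exact: continuous_gamma_kernel|exact: cht].
  + apply: continuousM; first exact: cst_continuous.
    by apply: continuousM; [exact: continuous_gamma_kernel|exact: ch't].
- move=> x x0.
  have dp := is_derive1_powR a x0.
  have de : is_derive x 1 (fun x : R => expR (- x)) (- expR (- x)).
    have dN : is_derive x 1 (fun x : R => - x) (- 1) by apply: is_derive_eq.
    by apply: (is_derive_comp_eq (f := expR) (is_derive_expR _) dN); rewrite mulrN1.
  have dhx : is_derive x 1 (fun x : R => h (t * x)) (t * h' (t * x)).
    have dt : is_derive x 1 (fun x : R => t * x) t.
      by apply: is_derive_eq; rewrite /GRing.scale/= mulr1.
    by apply: (is_derive_comp_eq (f := h) (dh _) dt); rewrite mulrC.
  by apply: is_derive_eq; rewrite /f /k1 /k /GRing.scale/=; ring.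
- have F_le : \forall x \near 0^'+, - (x `^ a) <= F x <= x `^ a.
    near=> x; have x0 : 0 < x by [].
    rewrite -ler_norml normrM ger0_norm ?mulr_ge0 ?powR_ge0 ?expR_ge0//.
    rewrite /k1 -mulrA ler_piMr ?powR_ge0// mulr_ile1 ?expR_ge0//.
    by rewrite -expR0 ler_expR oppr_le0 ltW.
  apply: (squeeze_cvgr F_le); last exact: powR_cvg0.
  by have := cvgN (powR_cvg0 (R := R) a0); rewrite oppr0; exact.
- have F_le : \forall x \near +oo%R, - (2 * expR (- (2^-1 * x))) <= F x <= 2 * expR (- (2^-1 * x)).
    near=> x; have x1 : 1 <= x by [].
    rewrite -ler_norml normrM ger0_norm ?mulr_ge0 ?powR_ge0 ?expR_ge0//.
    apply: (@le_trans _ _ (k1 x)).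
      by rewrite ler_piMr// mulr_ge0 ?powR_ge0 ?expR_ge0.
    apply: le_trans (mul_expR_half _); last by apply: lt_le_trans x1.
    rewrite ler_wpM2r ?expR_ge0// -[leRHS]powRr1; last by apply: le_trans x1.
    by rewrite ler_powR.
  have lim0 : 2 * expR (- (2^-1 * x)) @[x --> +oo%R] --> (0 : R).
    by rewrite -(mulr0 2); apply: cvgMr; apply: cvgy_expRM.
  apply: (squeeze_cvgr F_le) => //.
  by rewrite -oppr0; apply: cvgN.
Unshelve. all: by end_near. Qed.

End cosine_gamma.

Section cosine_gamma_value.
Context {R : realType}.
Notation mu := (@lebesgue_measure R).
Notation Rp := (`]0%R, +oo[%classic : set R).

(** The complex identity [int u ^ (a - 1) e ^ (- (1 + i t) u) du =
    Gamma a * (1 + i t) ^ (- a)] in real form: after multiplication by the modulus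
    and rotation by the argument of [(1 + i t) ^ a], both coordinates have zero
    derivative in [t]. *)
Lemma cosine_gamma (a t : R) : 0 < a <= 1 ->
  \int[mu]_(u in Rp) (u `^ (a - 1) * expR (- u) * cos (t * u)) =
  Gamma a * (1 + t ^+ 2) `^ (- (a / 2)) * cos (a * atan t).
Proof.
move=> a01.
pose k u : R := u `^ (a - 1) * expR (- u).
pose k1 u : R := u `^ a * expR (- u).
pose C t := \int[mu]_(u in Rp) (k u * cos (t * u)).
pose S t := \int[mu]_(u in Rp) (k u * sin (t * u)).
pose C1 t := \int[mu]_(u in Rp) (k1 u * cos (t * u)).
pose S1 t := \int[mu]_(u in Rp) (k1 u * sin (t * u)).
have cosd (x : R) : is_derive x 1 cos ((fun x => - sin x) x) by exact: is_derive_cos.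
have sind (x : R) : is_derive x 1 sin (cos x) by exact: is_derive_sin.
have sinN1 (x : R) : `|- sin x| <= 1 by rewrite normrN sin_max.
have csinN : continuous (fun x : R => - sin x).
  by move=> x; apply: continuousN; exact: continuous_sin.
have NS1 x : \int[mu]_(u in Rp) (k1 u * - sin (x * u)) = - S1 x.
  rewrite /S1 -mulN1r -RintegralZl//.
    by apply: eq_Rintegral => u _; ring.
  exact: (integrable_gammaS_osc a01 sind (@sin_max R)).
have dC (x : R) : is_derive x 1 C (- S1 x).
  rewrite -NS1.
  exact: (is_derive_gamma_osc a01 cosd (@cos_max R) sinN1).
have dS (x : R) : is_derive x 1 S (C1 x).
  exact: (is_derive_gamma_osc a01 sind (@sin_max R) (@cos_max R)).
have bC x : a * C x = C1 x + x * S1 x.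
  rewrite (gamma_osc_by_parts a01 cosd (@cos_max R) sinN1 csinN).
  by rewrite NS1 mulrN opprK.
have bS x : a * S x = S1 x - x * C1 x.
  exact: (gamma_osc_by_parts a01 sind (@sin_max R) (@cos_max R) (@continuous_cos R)).
have p0 (x : R) : 0 < 1 + x ^+ 2 by rewrite ltr_pwDl// sqr_ge0.
(* solve the two relations obtained by parts for the derivatives *)
have C1E x : C1 x = (a * C x - x * (a * S x)) / (1 + x ^+ 2).
  by rewrite bC bS; field; rewrite gt_eqF.
have S1E x : S1 x = (a * S x + x * (a * C x)) / (1 + x ^+ 2).
  by rewrite bC bS; field; rewrite gt_eqF.
(* [rho] and [phi] are the modulus and the argument of [(1 + i x) ^ a] *)
pose rho x : R := (1 + x ^+ 2) `^ (a / 2).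
pose phi x : R := a * atan x.
have drho (x : R) : is_derive x 1 rho (a * x / (1 + x ^+ 2) * rho x).
  have d2 : is_derive x 1 (fun x : R => 1 + x ^+ 2) (2 * x).
    by apply: is_derive_eq; rewrite /GRing.scale/= -mulr_natl; ring.
  apply: (@is_derive_comp_eq _ (fun x => x `^ (a / 2)) (fun x => 1 + x ^+ 2) _ _ _ _
    (is_derive1_powR _ (p0 x)) d2).
  rewrite /rho powRB; last by rewrite (gt_eqF (p0 x)) implybT.
  by rewrite powRr1 ?ltW//; field; rewrite gt_eqF.
have dphi (x : R) : is_derive x 1 phi (a / (1 + x ^+ 2)).
  by apply: is_derive_eq; rewrite /GRing.scale/=.
have dcphi (x : R) : is_derive x 1 (fun x => cos (phi x)) (- sin (phi x) * (a / (1 + x ^+ 2))).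
  exact: (is_derive_comp_eq (f := cos) (is_derive_cos _) (dphi x)).
have dsphi (x : R) : is_derive x 1 (fun x => sin (phi x)) (cos (phi x) * (a / (1 + x ^+ 2))).
  exact: (is_derive_comp_eq (f := sin) (is_derive_sin _) (dphi x)).
pose D x := rho x * (C x * cos (phi x) + S x * sin (phi x)).
pose E x := rho x * (S x * cos (phi x) - C x * sin (phi x)).
have dD (x : R) : is_derive x 1 D 0.
  apply: is_derive_eq; rewrite /GRing.scale/= C1E S1E.
  by field; rewrite gt_eqF.
have dE (x : R) : is_derive x 1 E 0.
  apply: is_derive_eq; rewrite /GRing.scale/= C1E S1E.
  by field; rewrite gt_eqF.
have D0 : D t = Gamma a.
  rewrite (is_derive_0_is_cst t 0 dD) /D /rho /phi atan0 mulr0 cos0 sin0 expr0n/= addr0.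
  rewrite powR1 mul1r mulr1 mulr0 addr0.
  by apply: eq_Rintegral => u _; rewrite mul0r cos0 mulr1.
have E0 : E t = 0.
  rewrite (is_derive_0_is_cst t 0 dE) /E /rho /phi atan0 mulr0 cos0 sin0 mulr0 subr0 mulr1.
  rewrite /S (_ : \int[mu]_(u in Rp) _ = 0) ?mulr0//.
  under eq_Rintegral do rewrite mul0r sin0 mulr0.
  by rewrite Rintegral_cst// mul0r.
have rho0 : 0 < rho t by rewrite powR_gt0.
rewrite -[LHS]/(C t) powRN -/(rho t) -/(phi t) -D0.
have -> : C t = (cos (phi t) ^+ 2 + sin (phi t) ^+ 2) * C t by rewrite cos2Dsin2 mul1r.
suff -> : (cos (phi t) ^+ 2 + sin (phi t) ^+ 2) * C t =
    (cos (phi t) * D t - sin (phi t) * E t) / rho t.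
  by rewrite E0 mulr0 subr0; ring.
by rewrite /D /E; field; rewrite gt_eqF.
Qed.

(** The integral that Fourier inversion yields for the density of a stable law at
    the origin. *)
Lemma integral_stretched_cos (alpha c t : R) : 1 <= alpha -> 0 < c ->
  \int[mu]_(x in Rp) (expR (- (c * x `^ alpha)) * cos (t * (c * x `^ alpha))) =
  c `^ (- alpha^-1) * (alpha^-1 * Gamma alpha^-1 *
    (1 + t ^+ 2) `^ (- (alpha^-1 / 2)) * cos (alpha^-1 * atan t)).
Proof.
move=> al1 c0.
have al0 : 0 < alpha by apply: lt_le_trans al1.
have a01 : 0 < alpha^-1 <= 1 by rewrite invr_gt0 al0 invf_le1.
have a1 : (1 + 0) / alpha = alpha^-1 by rewrite addr0 mul1r.
have cc (x : R) : {for x, continuous (fun x => cos (t * x))}.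
  by apply: (@continuous_at_comp _ (fun x => t * x) cos); [exact: continuous_scale|exact: continuous_cos].
(* the substitution is available for nonnegative integrands: shift the cosine
   by one *)
pose g (x : R) := 1 + cos (t * x).
have g0 (x : R) : 0 < x -> 0 <= g x by move=> _; rewrite /g; have := cos_geN1 (t * x); lra.
have cg (x : R) : 0 < x -> {for x, continuous g}.
  by move=> _; apply: continuousD; [exact: cst_continuous|exact: cc].
have := @integral_gamma_subst R alpha c 0 g al1 c0 cg g0.
rewrite a1.
have i0 := @integrable_stretched R alpha c 0 al1 c0.
have {}i0 : mu.-integrable Rp (EFin \o (fun x => expR (- (c * x `^ alpha)))).
  apply: eq_integrable (i0 _ _); rewrite ?addr0 //.
  by move=> x _; rewrite /= powRr0 mul1r.
have i1 : mu.-integrable Rp (EFin \o (fun x => expR (- (c * x `^ alpha)) * cos (t * (c * x `^ alpha)))).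
  apply: integrable_Rp_le i0.
    move=> x x0; apply: continuousM.
      apply: (@continuous_at_comp _ (fun x => x `^ alpha) (fun y => expR (- (c * y)))).
        exact: continuous_powR.
      exact: continuous_expRM.
    apply: (@continuous_at_comp _ (fun x => c * x `^ alpha) (fun y => cos (t * y))) => //.
    apply: (@continuous_at_comp _ (fun x => x `^ alpha) (fun y => c * y)).
      exact: continuous_powR.
    exact: continuous_scale.
  move=> x x0; rewrite normrM (ger0_norm (expR_ge0 _)) ler_piMr ?expR_ge0//.
  exact: cos_max.
have j0 := integrable_gamma a01.
have cosd (x : R) : is_derive x 1 cos ((fun x => - sin x) x) by exact: is_derive_cos.
have j1 := integrable_gamma_osc a01 cosd (@cos_max R) t.
move=> /(congr1 fine).
rewrite -[LHS]/(\int[mu]_(x in Rp) _) -[RHS]/(\int[mu]_(x in Rp) _).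
under eq_Rintegral do rewrite powRr0 mul1r /g mulrDr mulr1.
rewrite RintegralD//.
under [in RHS]eq_Rintegral do rewrite /g mulrDr mulr1.
rewrite RintegralZl//; last exact: integrable_EFinD.
rewrite RintegralD// cosine_gamma//.
have -> : \int[mu]_(x in Rp) expR (- (c * x `^ alpha)) =
    alpha^-1 * Gamma alpha^-1 * c `^ (- alpha^-1).
  rewrite /Rintegral.
  have := @integral_stretched R alpha c 0 al1 c0; rewrite a1 addr0 => /(_ (ltrN10 R) al1) /(congr1 fine) /= <-.
  by congr fine; apply: eq_integral => x _; rewrite powRr0 mul1r.
rewrite -/(Gamma _).
lra.
Qed.

End cosine_gamma_value.

(** * Small balls of a stable process *)

Section stable_characteristic.
Context d (T : measurableType d) (R : realType) (P : probability T R).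
Variables (alpha nu chi : R) (X : R -> {RV P >-> R}).
Hypothesis chi0 : 0 < chi.
Hypothesis stX : stable_levy_process alpha nu chi X.
Let tau := nu * tan (pi * alpha / 2).

Let exponentE t xi : 0 < xi ->
  (- (t * `|xi| `^ alpha)%:C%C *
        ((1 + 'i%C * (nu * Num.sg xi * tan (pi * alpha / 2))%:C%C)
          / chi%:C%C)) =
  (- (t / chi * xi `^ alpha) +i* - (tau * (t / chi * xi `^ alpha)))%C.
Proof.
move=> xi0; rewrite gtr0_sg// gtr0_norm// mulr1 -/tau.
rewrite -(fmorphV (real_complex R)) /=.
apply/eqP; rewrite eq_complex /=; apply/andP; split; apply/eqP; ring.
Qed.

Lemma stable_char_fun_cos t xi : 0 <= t -> 0 < xi ->
  \int[P]_w cos (xi * X t w) =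
  expR (- (t / chi * xi `^ alpha)) * cos (tau * (t / chi * xi `^ alpha)).
Proof.
move=> t0 xi0; have := stable_char_fun stX xi t0; rewrite exponentE//.
rewrite /char_fun /cexpectation => /(congr1 (@complex.Re R)).
rewrite /cexp /= unlock cosN => <-.
congr fine; apply: eq_integral => w _.
by rewrite !mul0r !mul1r subr0 expR0 mul1r add0r.
Qed.

Lemma stable_char_fun_sin t xi : 0 <= t -> 0 < xi ->
  \int[P]_w sin (xi * X t w) =
  - (expR (- (t / chi * xi `^ alpha)) * sin (tau * (t / chi * xi `^ alpha))).
Proof.
move=> t0 xi0; have := stable_char_fun stX xi t0; rewrite exponentE//.
rewrite /char_fun /cexpectation => /(congr1 (@complex.Im R)).
rewrite /cexp /= unlock sinN mulrN => <-.
congr fine; apply: eq_integral => w _.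
by rewrite !mul0r !mul1r subr0 expR0 mul1r add0r.
Qed.

End stable_characteristic.

Section cauchy_kernel.
Context {R : realType}.
Notation mu := (@lebesgue_measure R).
Notation Rp := (`]0%R, +oo[%classic : set R).
Implicit Types (a b c s x y : R).

Lemma cos_lip a b : `|cos a - cos b| <= `|a - b|.
Proof.
wlog ab : a b / a < b.
  move=> h; have [ab|ba|->] := ltgtP a b; first exact: h.
    by rewrite distrC [leRHS]distrC; exact: h.
  by rewrite !subrr.
have [|c _ h] := @MVT _ cos (fun x => - sin x) a b ab _.
  by apply: continuous_subspaceT => x; exact: continuous_cos.
rewrite distrC h normrM normrN distrC.
by rewrite ler_piMl// sin_max.
Qed.

Lemma expRN_lip x : 0 <= x -> 0 <= 1 - expR (- x) <= x.
Proof.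
move=> x0; apply/andP; split.
  by rewrite subr_ge0 -expR0 ler_expR oppr_le0.
have := expR_ge1Dx (- x); lra.
Qed.

(** Interpolation: [min 1 z] is at most [z ^ g] for [g] between zero and one. *)
Lemma min_powR_le (M g y z : R) : 0 <= g <= 1 -> 1 <= M -> 0 <= z ->
  y <= M -> y <= z -> y <= M * z `^ g.
Proof.
move=> /andP[g0 g1] M1 z0 yM yz.
have M0 : 0 <= M by apply: le_trans M1.
have [z1|z1] := leP 1 z.
  apply: (le_trans yM); rewrite ler_peMr//.
  have : 1 `^ g <= z `^ g by apply: ge0_ler_powR => //; rewrite nnegrE.
  by rewrite powR1.
have [ze|zn0] := eqVneq z 0.
  by apply: (le_trans yz); rewrite [leLHS]ze mulr_ge0 ?powR_ge0.
have zp : 0 < z by rewrite lt_neqAle eq_sym zn0.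
apply: (@le_trans _ _ (z `^ g)); last by rewrite ler_peMl// powR_ge0.
by apply: le_trans yz _; apply: ger1_powR => //; rewrite zp ltW.
Qed.

(** The left-hand side compares the oscillating factors in the inversion formulas
    for the smoothed density at [x] and for the density at the origin; the power
    [xi ^ g] of the frequency [xi] on the right-hand side remains integrable
    against the modulus of the characteristic function. *)
Lemma osc_difference_le (s g xi x phi : R) : 0 <= g <= 1 -> 0 <= s -> 0 <= xi ->
  `|expR (- (s * xi)) * cos (xi * x + phi) - cos phi| <=
  (s `^ g + 2 * `|x| `^ g) * xi `^ g.
Proof.
move=> g01 s0 xi0.
have sx0 : 0 <= s * xi by exact: mulr_ge0.
have /andP[e0 e1] := expRN_lip sx0.
have -> : expR (- (s * xi)) * cos (xi * x + phi) - cos phi =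
  - ((1 - expR (- (s * xi))) * cos (xi * x + phi)) + (cos (xi * x + phi) - cos phi) by ring.
apply: (le_trans (ler_normD _ _)).
rewrite [leRHS]mulrDl; apply: lerD.
  rewrite normrN normrM (ger0_norm e0).
  apply: (@le_trans _ _ (1 - expR (- (s * xi)))).
    by rewrite ler_piMr// cos_max.
  rewrite -powRM// -[leRHS]mul1r; apply: min_powR_le => //.
rewrite -mulrA -powRM//; apply: min_powR_le => //.
- by rewrite ler1n.
- by rewrite mulr_ge0.
- apply: (le_trans (ler_normB _ _)).
  by have := cos_max (xi * x + phi); have := cos_max phi; lra.
- apply: (le_trans (cos_lip _ _)).
  by rewrite addrK normrM (ger0_norm xi0) mulrC.
Qed.

Let continuous_cauchy s y x :
  {for x, continuous (fun xi => expR (- (s * xi)) * cos (xi * y))}.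
Proof.
apply: continuousM; first exact: continuous_expRM.
apply: (@continuous_at_comp _ (fun xi => xi * y) cos); last exact: continuous_cos.
by apply: cvgMl; exact: cvg_id.
Qed.

Lemma integrable_cauchy s y : 0 < s ->
  mu.-integrable Rp (EFin \o (fun xi => expR (- (s * xi)) * cos (xi * y))).
Proof.
move=> s0; apply: integrable_Rp_le (integrable_expRM s0).
  by move=> x _; exact: continuous_cauchy.
move=> x _; rewrite normrM (ger0_norm (expR_ge0 _)) ler_piMr ?expR_ge0//.
exact: cos_max.
Qed.

(** The Poisson kernel of the half-plane, obtained from the explicit primitive of
    the damped cosine. *)
Lemma cauchy_kernelE s y : 0 < s ->
  \int[mu]_(xi in Rp) (expR (- (s * xi)) * cos (xi * y)) = s / (s ^+ 2 + y ^+ 2).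
Proof.
move=> s0.
have sy0 : 0 < s ^+ 2 + y ^+ 2 by rewrite ltr_pwDl ?sqr_ge0// exprn_gt0.
pose F xi := (s ^+ 2 + y ^+ 2)^-1 * (expR (- (s * xi)) * (y * sin (xi * y) - s * cos (xi * y))).
have dxy (x : R) : is_derive x 1 (fun xi => xi * y) y.
  by apply: is_derive_eq; rewrite /GRing.scale/=; ring.
have dcos (x : R) : is_derive x 1 (fun xi => cos (xi * y)) (- sin (x * y) * y).
  exact: (@is_derive_comp_eq _ cos (fun xi => xi * y) _ _ _ _ (is_derive_cos _) (dxy x)).
have dsin (x : R) : is_derive x 1 (fun xi => sin (xi * y)) (cos (x * y) * y).
  exact: (@is_derive_comp_eq _ sin (fun xi => xi * y) _ _ _ _ (is_derive_sin _) (dxy x)).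
have dF (x : R) : is_derive x 1 F (expR (- (s * x)) * cos (x * y)).
  have de := is_derive_expRM s x.
  apply: is_derive_eq; rewrite /GRing.scale/=.
  by field; rewrite gt_eqF.
rewrite (Rintegral_FTC2_Rp (F := F) (l0 := F 0) (l := 0)).
- by rewrite /F mulr0 oppr0 expR0 mul0r sin0 cos0; field; rewrite gt_eqF.
- by move=> x _; exact: continuous_cauchy.
- exact: integrable_cauchy.
- by apply: cvg_at_right_filter; exact: is_derive_continuous (dF 0).
- have F_le : \forall x \near +oo%R,
      - ((s ^+ 2 + y ^+ 2)^-1 * (`|y| + s) * expR (- (s * x))) <= F x <=
      (s ^+ 2 + y ^+ 2)^-1 * (`|y| + s) * expR (- (s * x)).
    near=> x; rewrite -ler_norml /F normrM gtr0_norm ?invr_gt0// -mulrA.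
    rewrite ler_wpM2l ?invr_ge0 ?(ltW sy0)// normrM (ger0_norm (expR_ge0 _)) mulrC.
    rewrite ler_wpM2r ?expR_ge0//; apply: (le_trans (ler_normB _ _)).
    rewrite !normrM (gtr0_norm s0); apply: lerD.
      by rewrite ler_piMr// sin_max.
    by rewrite ler_piMr ?(ltW s0)// cos_max.
  have lim0 : (s ^+ 2 + y ^+ 2)^-1 * (`|y| + s) * expR (- (s * x)) @[x --> +oo%R] --> (0 : R).
    by rewrite -(mulr0 ((s ^+ 2 + y ^+ 2)^-1 * (`|y| + s))); apply: cvgMr; exact: cvgy_expRM.
  apply: (squeeze_cvgr F_le) => //.
  by have := cvgN lim0; rewrite oppr0; exact.
Unshelve. all: by end_near. Qed.

End cauchy_kernel.

Section smoothed_density.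
Context d (T : measurableType d) (R : realType) (P : probability T R).
Notation mu := (@lebesgue_measure R).
Notation Rp := (`]0%R, +oo[%classic : set R).
Variables (Y : {RV P >-> R}) (alpha tau c : R).
Hypothesis al1 : 1 <= alpha.
Hypothesis c0 : 0 < c.
Hypothesis Ycos : forall xi, 0 < xi -> \int[P]_w cos (xi * Y w) =
  expR (- (c * xi `^ alpha)) * cos (tau * (c * xi `^ alpha)).
Hypothesis Ysin : forall xi, 0 < xi -> \int[P]_w sin (xi * Y w) =
  - (expR (- (c * xi `^ alpha)) * sin (tau * (c * xi `^ alpha))).

Let integrable_cosY xi : P.-integrable setT (EFin \o (fun w => cos (xi * Y w))).
Proof.
apply: (@le_integrable _ _ _ _ _ _ _ (EFin \o cst 1)) => //.
- apply/measurable_EFinP; apply: measurableT_comp.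
    exact: continuous_measurable_fun (@continuous_cos R).
  exact: measurable_funM.
- by move=> w _; rewrite lee_fin normr1 cos_max.
- exact: finite_measure_integrable_cst.
Qed.

Let integrable_sinY xi : P.-integrable setT (EFin \o (fun w => sin (xi * Y w))).
Proof.
apply: (@le_integrable _ _ _ _ _ _ _ (EFin \o cst 1)) => //.
- apply/measurable_EFinP; apply: measurableT_comp.
    exact: continuous_measurable_fun (@continuous_sin R).
  exact: measurable_funM.
- by move=> w _; rewrite lee_fin normr1 sin_max.
- exact: finite_measure_integrable_cst.
Qed.

(** Fourier inversion for the law of [Y] convolved with a Cauchy law of scale [s]:
    the factor [exp (- s xi)] makes Fubini's theorem applicable. *)
Lemma smoothed_density_fourier s x : 0 < s ->
  \int[P]_w (s / (s ^+ 2 + (x - Y w) ^+ 2)) =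
  \int[mu]_(xi in Rp) (expR (- (c * xi `^ alpha)) *
    (expR (- (s * xi)) * cos (xi * x + tau * (c * xi `^ alpha)))).
Proof.
move=> s0.
pose f (z : T * R) : R := (expR (- (s * z.2)) * cos (z.2 * (x - Y z.1))) * \1_Rp z.2.
have mY1 : measurable_fun setT (fun z : T * R => Y z.1).
  exact: measurableT_comp.
have mf : measurable_fun setT f.
  apply: measurable_funM.
    apply: measurable_funM.
      apply: measurableT_comp => //; apply: measurableT_comp => //.
      exact: measurable_funM.
    apply: measurableT_comp.
      exact: continuous_measurable_fun (@continuous_cos R).
    by apply: measurable_funM => //; exact: measurable_funB.
  by apply: measurableT_comp => //; exact: measurable_indic.
have intf : (P \x mu)%E.-integrable setT (EFin \o f).
  apply/integrable12ltyP; first exact/measurable_EFinP.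
  apply: (@le_lt_trans _ _ (\int[P]_w (\int[mu]_(xi in Rp) (expR (- (s * xi)))%:E))%E).
    apply: ge0_le_integral => //.
    - by move=> w _; apply: integral_ge0 => xi _.
    - apply: (@measurable_fun_fubini_tonelli_F _ _ _ _ _ mu (fun z => `|(f z)%:E|%E)) => //.
      by apply: measurableT_comp => //; exact/measurable_EFinP.
    - move=> w _; rewrite [leRHS]integral_mkcond; apply: ge0_le_integral => //.
      + apply: measurableT_comp => //; apply/measurable_EFinP.
        exact: (measurableT_comp mf (measurable_pair1 w)).
      + apply/(measurable_restrictT _ _).1 => //; apply/measurable_EFinP.
        by apply: measurable_fun_Rp => xi _; exact: continuous_expRM.
      + move=> xi _; rewrite /f /= patchE indicE; case: ifPn => xiR; rewrite ?mulr1 ?mulr0 ?normr0//.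
        rewrite lee_fin normrM (ger0_norm (expR_ge0 _)) ler_piMr ?expR_ge0//.
        exact: cos_max.
  have /integrable_fin_num := integrable_expRM s0.
  move=> /(_ (measurable_itv _)) /fineK <-.
  rewrite integral_cst//; set p := (X in (_ * X < _)%E).
  have -> : p = 1%E by exact: probability_setT.
  by rewrite mule1 ltry.
have E1 w : (\int[mu]_xi (f (w, xi))%:E = (s / (s ^+ 2 + (x - Y w) ^+ 2))%:E)%E.
  rewrite -cauchy_kernelE// /Rintegral fineK; last first.
    apply: integrable_fin_num => //; exact: integrable_cauchy.
  rewrite [RHS]integral_mkcond; apply: eq_integral => xi _.
  by rewrite /f patchE indicE; case: ifPn => xiR; rewrite ?mulr1 ?mulr0.
have E2 xi : (\int[P]_w (f (w, xi))%:E = ((fun xi => (expR (- (c * xi `^ alpha)) *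
    (expR (- (s * xi)) * cos (xi * x + tau * (c * xi `^ alpha))))%:E) \_ Rp) xi)%E.
  rewrite patchE; case: ifPn => xiR; last first.
    by rewrite integral0_eq// => w _; rewrite /f indicE (negbTE xiR) mulr0.
  have xi0 : 0 < xi by move: xiR; rewrite inE/= in_Rp.
  transitivity (\int[P]_w ((expR (- (s * xi)) * cos (xi * x) * cos (xi * Y w)) +
    (expR (- (s * xi)) * sin (xi * x) * sin (xi * Y w)))%:E)%E.
    by apply: eq_integral => w _; rewrite /f indicE xiR mulr1 mulrBr cosB; congr EFin; ring.
  have i1 : P.-integrable setT (EFin \o (fun w => expR (- (s * xi)) * cos (xi * x) * cos (xi * Y w))).
    exact: integrable_EFinZl.
  have i2 : P.-integrable setT (EFin \o (fun w => expR (- (s * xi)) * sin (xi * x) * sin (xi * Y w))).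
    exact: integrable_EFinZl.
  rewrite -[LHS]fineK; last first.
    by apply: integrable_fin_num => //; exact: integrable_EFinD.
  congr EFin; rewrite -[LHS]/(\int[P]_w _) RintegralD// !RintegralZl//.
  by rewrite Ycos// Ysin// cosD; ring.
have := @Fubini _ _ _ _ _ P mu (EFin \o f) intf.
under eq_integral do rewrite /= E1.
under [RHS]eq_integral do rewrite /= E2.
by rewrite -integral_mkcond => /(congr1 fine).
Qed.

End smoothed_density.

Section small_ball.
Context d (T : measurableType d) (R : realType) (P : probability T R).
Notation mu := (@lebesgue_measure R).
Notation Rp := (`]0%R, +oo[%classic : set R).
Implicit Types (a b e m s u x y z : R).
Variables (Y : {RV P >-> R}) (alpha tau c g : R).
Hypothesis al1 : 1 <= alpha.
Hypothesis c0 : 0 < c.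
Hypothesis g0 : 0 <= g.
Hypothesis galpha : 1 + g <= alpha.
Hypothesis g1 : g <= 1.
Hypothesis Ycos : forall xi, 0 < xi -> \int[P]_w cos (xi * Y w) =
  expR (- (c * xi `^ alpha)) * cos (tau * (c * xi `^ alpha)).
Hypothesis Ysin : forall xi, 0 < xi -> \int[P]_w sin (xi * Y w) =
  - (expR (- (c * xi `^ alpha)) * sin (tau * (c * xi `^ alpha))).

(** The density of [Y] at the origin, and a Hoelder constant of the density. *)
Let q := pi^-1 * (c `^ (- alpha^-1) * (alpha^-1 * Gamma alpha^-1 *
    (1 + tau ^+ 2) `^ (- (alpha^-1 / 2)) * cos (alpha^-1 * atan tau))).
Let K := pi^-1 * (alpha^-1 * Gamma ((1 + g) / alpha)) * c `^ (- ((1 + g) / alpha)).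

Let al0 : 0 < alpha. Proof. exact: lt_le_trans al1. Qed.

Let K0 : 0 <= K.
Proof.
rewrite !mulr_ge0 ?powR_ge0 ?invr_ge0 ?pi_ge0 ?(ltW al0)// ltW// Gamma_gt0//.
by rewrite divr_gt0 ?ler_pdivrMr ?mul1r// ltr_wpDr.
Qed.

(** The density of [Y] convolved with a Cauchy law of scale [s]. *)
Let dens (s x : R) := pi^-1 * \int[P]_w (s / (s ^+ 2 + (x - Y w) ^+ 2)).

Let dens_le s x : 0 < s -> `|dens s x - q| <= K * (s `^ g + 2 * `|x| `^ g).
Proof.
move=> s0; rewrite /dens (smoothed_density_fourier Ycos Ysin)//.
rewrite /q -(integral_stretched_cos tau al1 c0) -mulrBr normrM.
rewrite gtr0_norm ?invr_gt0 ?pi_gt0// /K -!mulrA ler_wpM2l ?invr_ge0 ?pi_ge0//.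
have ca (x0 : R) : 0 < x0 -> {for x0, continuous (fun xi => c * xi `^ alpha)}.
  move=> x00; apply: (@continuous_at_comp _ (fun x => x `^ alpha) (fun y => c * y)).
    exact: continuous_powR.
  exact: continuous_scale.
have ce (x0 : R) : 0 < x0 -> {for x0, continuous (fun xi => expR (- (c * xi `^ alpha)))}.
  move=> x00; apply: (@continuous_at_comp _ (fun x => x `^ alpha) (fun y => expR (- (c * y)))).
    exact: continuous_powR.
  exact: continuous_expRM.
have ct (x0 : R) : 0 < x0 -> {for x0, continuous (fun xi => tau * (c * xi `^ alpha))}.
  move=> x00; apply: (@continuous_at_comp _ _ (fun y => tau * y)); first exact: ca.
  exact: continuous_scale.
have ie := @integrable_stretched R alpha c 0 al1 c0 (ltrN10 R).
have {}ie : mu.-integrable Rp (EFin \o (fun x => expR (- (c * x `^ alpha)))).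
  rewrite addr0 in ie; apply: eq_integrable (ie al1) => //.
  by move=> z _; rewrite /= powRr0 mul1r.
have i1 : mu.-integrable Rp (EFin \o (fun xi => expR (- (c * xi `^ alpha)) *
    (expR (- (s * xi)) * cos (xi * x + tau * (c * xi `^ alpha))))).
  apply: integrable_Rp_le ie.
    move=> z z0; apply: continuousM; first exact: ce.
    apply: continuousM; first exact: continuous_expRM.
    apply: (@continuous_at_comp _ (fun xi => xi * x + tau * (c * xi `^ alpha)) cos).
      apply: continuousD; last exact: ct.
      by apply: cvgMl; exact: cvg_id.
    exact: continuous_cos.
  move=> z z0; rewrite normrM (ger0_norm (expR_ge0 _)) ler_piMr ?expR_ge0//.
  rewrite normrM (ger0_norm (expR_ge0 _)) mulr_ile1 ?expR_ge0 ?cos_max//.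
  by rewrite -expR0 ler_expR oppr_le0 mulr_ge0// ltW.
have i2 : mu.-integrable Rp (EFin \o (fun xi => expR (- (c * xi `^ alpha)) *
    cos (tau * (c * xi `^ alpha)))).
  apply: integrable_Rp_le ie.
    move=> z z0; apply: continuousM; first exact: ce.
    by apply: (@continuous_at_comp _ _ cos); [exact: ct|exact: continuous_cos].
  by move=> z z0; rewrite normrM (ger0_norm (expR_ge0 _)) ler_piMr ?expR_ge0 ?cos_max.
have i3 := @integrable_stretched R alpha c g al1 c0.
have gN1 : -1 < g by apply: lt_le_trans g0; exact: ltrN10.
have {}i3 := i3 gN1 galpha.
rewrite -RintegralB//.
apply: (le_trans (le_normr_Rintegral _ _)) => //; first exact: integrable_EFinB.
apply: (@le_trans _ _ (\int[mu]_(xi in Rp) ((s `^ g + 2 * `|x| `^ g) *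
    (xi `^ g * expR (- (c * xi `^ alpha)))))).
  apply: le_Rintegral => //.
  - by apply: (integrable_abse (f := EFin \o _)); exact: integrable_EFinB.
  - exact: integrable_EFinZl.
  - move=> z; rewrite /= in_Rp => z0.
    rewrite -mulrBr normrM (ger0_norm (expR_ge0 _)) [leRHS]mulrA [leRHS]mulrC.
    apply: ler_wpM2l; first exact: expR_ge0.
    by apply: osc_difference_le; [rewrite g0 g1|exact: ltW|exact: ltW].
rewrite RintegralZl// /Rintegral integral_stretched//=.
by rewrite le_eqVlt; apply/orP; left; apply/eqP; ring.
Qed.

Let h (s a b y : R) := pi^-1 * (atan ((b - y) / s) - atan ((a - y) / s)).

Let kernel_ge0 s x y : 0 < s -> 0 <= s / (s ^+ 2 + (x - y) ^+ 2) :> R.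
Proof. by move=> s0; rewrite divr_ge0 ?(ltW s0)// addr_ge0 ?sqr_ge0. Qed.

Let continuous_kernel s y (x : R) : 0 < s ->
  {for x, continuous (fun x : R => pi^-1 * (s / (s ^+ 2 + (x - y) ^+ 2)))}.
Proof.
move=> s0.
have p0 : 0 < s ^+ 2 + (x - y) ^+ 2 by rewrite ltr_pwDl ?sqr_ge0// exprn_gt0.
apply: (@continuousM _ _ (cst pi^-1)); first exact: cst_continuous.
apply: (@continuousM _ _ (cst s)); first exact: cst_continuous.
apply: (@continuousV _ _ (fun x => s ^+ 2 + (x - y) ^+ 2)); first by rewrite gt_eqF.
have dq : is_derive x 1 (fun x => s ^+ 2 + (x - y) ^+ 2) (2 * (x - y)).
  by apply: is_derive_eq; rewrite /GRing.scale/= -mulr_natl; ring.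
exact: is_derive_continuous dq.
Qed.

Let integral_kernel s a b y : 0 < s -> a < b ->
  (\int[mu]_(x in `[a, b]) (pi^-1 * (s / (s ^+ 2 + (x - y) ^+ 2)))%:E = (h s a b y)%:E)%E.
Proof.
move=> s0 ab.
have p0 (x : R) : 0 < s ^+ 2 + (x - y) ^+ 2 by rewrite ltr_pwDl ?sqr_ge0// exprn_gt0.
have dF (x : R) : is_derive x 1 (fun x => pi^-1 * atan ((x - y) / s))
    (pi^-1 * (s / (s ^+ 2 + (x - y) ^+ 2))).
  have d1 : is_derive x 1 (fun x => (x - y) / s) s^-1.
    by apply: is_derive_eq; rewrite /GRing.scale/=; ring.
  have d2 := @is_derive_comp_eq _ atan (fun x => (x - y) / s) x _ _
    (s / (s ^+ 2 + (x - y) ^+ 2)) (is_derive1_atan _) d1.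
  have {}d2 : is_derive x 1 (fun x => atan ((x - y) / s)) (s / (s ^+ 2 + (x - y) ^+ 2)).
    by apply: d2; field; rewrite (gt_eqF s0) (gt_eqF (p0 x)).
  by apply: is_derive_eq; rewrite /GRing.scale/=.
rewrite (@continuous_FTC2 _ _ (fun x => pi^-1 * atan ((x - y) / s)))//.
- by rewrite -EFinB /h mulrBr.
- by apply: continuous_subspaceT => x; exact: continuous_kernel.
- split.
  + by move=> x _; case: (dF x).
  + by apply: cvg_at_right_filter; exact: is_derive_continuous (dF a).
  + by apply: cvg_at_left_filter; exact: is_derive_continuous (dF b).
- by move=> x _; rewrite derive1E; have := dF x => dFx; rewrite derive_val.
Qed.

Let measurable_h s a b : measurable_fun setT (h s a b).
Proof.
have matan : measurable_fun setT (@atan R).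
  by apply: continuous_measurable_fun => x; exact: continuous_atan.
apply: measurable_funM => //; apply: measurable_funB.
  apply: measurableT_comp => //; apply: measurable_funM => //.
  exact: measurable_funB.
apply: measurableT_comp => //; apply: measurable_funM => //.
exact: measurable_funB.
Qed.

Let ker s u := pi^-1 * (s / (s ^+ 2 + u ^+ 2)).

Let measurable_ker s : 0 < s -> measurable_fun setT (fun z : T * R => ker s (z.2 - Y z.1)).
Proof.
move=> s0; apply: (@measurableT_comp _ _ _ _ _ _ (ker s) _ (fun z : T * R => z.2 - Y z.1)).
  apply: continuous_measurable_fun => x.
  have := @continuous_kernel s 0 x s0.
  have -> : (fun x : R => pi^-1 * (s / (s ^+ 2 + (x - 0) ^+ 2))) = ker s.
    by apply/funext => z; rewrite subr0.
  by [].
by apply: measurable_funB => //; exact: measurableT_comp.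
Qed.

Let densE s x : 0 < s -> (\int[P]_w (ker s (x - Y w))%:E = (dens s x)%:E)%E.
Proof.
move=> s0.
have iY : P.-integrable setT (EFin \o (fun w => s / (s ^+ 2 + (x - Y w) ^+ 2))).
  apply: (@le_integrable _ _ _ _ _ _ _ (EFin \o cst (s^-1))) => //.
  + apply/measurable_EFinP.
    have mk := measurableT_comp (measurable_ker s0) (measurable_pair2 x).
    have mk' := measurable_funM (measurable_cst pi) mk.
    apply: eq_measurable_fun mk' => w _.
    by rewrite /= /ker mulrA divff ?mul1r// gt_eqF// pi_gt0.
  + move=> w _; rewrite lee_fin ger0_norm ?kernel_ge0// ger0_norm ?invr_ge0 ?(ltW s0)//.
    rewrite ler_pdivrMr; last by rewrite ltr_pwDl ?sqr_ge0// exprn_gt0.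
    have -> : s^-1 * (s ^+ 2 + (x - Y w) ^+ 2) = s + s^-1 * (x - Y w) ^+ 2.
      by field; rewrite gt_eqF.
    by rewrite lerDl mulr_ge0 ?sqr_ge0// invr_ge0 ltW.
  + exact: finite_measure_integrable_cst.
rewrite /dens -RintegralZl// /Rintegral fineK//.
by apply: integrable_fin_num => //; exact: integrable_EFinZl.
Qed.

Let measurable_dens s : 0 < s -> measurable_fun setT (dens s).
Proof.
move=> s0; apply/measurable_EFinP.
have := @measurable_fun_fubini_tonelli_G _ _ _ _ _ P
  (fun z : T * R => (ker s (z.2 - Y z.1))%:E).
move=> H; have {}H := H _ _.
rewrite (_ : _ \o _ = fubini_G P (fun z : T * R => (ker s (z.2 - Y z.1))%:E)); last first.
  by apply/funext => x; rewrite /fubini_G /= densE.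
apply: H.
  by apply/measurable_EFinP; exact: measurable_ker.
by move=> z; rewrite lee_fin /ker mulr_ge0 ?invr_ge0 ?pi_ge0// -[_ - _]subr0 kernel_ge0.
Qed.

Let integral_dens s a b : 0 < s -> a < b ->
  (\int[P]_w (h s a b (Y w))%:E = \int[mu]_(x in `[a, b]) (dens s x)%:E)%E.
Proof.
move=> s0 ab.
pose f (z : T * R) : R := ker s (z.2 - Y z.1) * \1_(`[a, b]%classic : set R) z.2.
have f0 (z : T * R) : 0 <= f z.
  by rewrite /f mulr_ge0// /ker mulr_ge0 ?invr_ge0 ?pi_ge0// -[_ - _]subr0 kernel_ge0.
have mf : measurable_fun setT f.
  apply: measurable_funM; last by apply: measurableT_comp => //; exact: measurable_indic.
  exact: measurable_ker.
have := @fubini_tonelli _ _ _ _ _ P mu (EFin \o f).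
have mEf : measurable_fun setT (EFin \o f) by exact/measurable_EFinP.
have Ef0 (z : T * R) : (0 <= (EFin \o f) z)%E by rewrite lee_fin.
move=> /(_ mEf Ef0) F.
have E1 w : (\int[mu]_x (EFin \o f) (w, x) = (h s a b (Y w))%:E)%E.
  rewrite -integral_kernel// [RHS]integral_mkcond; apply: eq_integral => x _.
  by rewrite /f /= patchE indicE; case: ifPn; rewrite ?mulr1 ?mulr0.
have E2 x : (\int[P]_w (EFin \o f) (w, x) =
    ((fun x => (dens s x)%:E) \_ (`[a, b]%classic)) x)%E.
  rewrite patchE; case: ifPn => xab; last first.
    by rewrite integral0_eq// => w _; rewrite /f /= indicE (negbTE xab) mulr0.
  rewrite -densE//; apply: eq_integral => w _.
  by rewrite /f /= indicE xab mulr1.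
under [LHS]eq_integral do rewrite -E1.
by rewrite F [RHS]integral_mkcond; apply: eq_integral => x _; exact: E2.
Qed.

Let atan_lb e : 0 < e -> exists2 M : R, 0 < M & forall u, M <= u -> pi / 2 - e <= atan u.
Proof.
move=> e0; have : \forall x \near +oo%R, pi / 2 - e < atan x.
  by apply: cvgr_gt; [exact: cvgy_atan|rewrite ltrBlDr ltrDl].
move=> [M [_ HM]]; exists (Num.max M 0 + 1).
  by rewrite ltr_pwDr// le_max lexx orbT.
move=> u Mu; apply/ltW/HM; apply: lt_le_trans Mu.
by rewrite (le_lt_trans (y := Num.max M 0))// ?le_max ?lexx// ltrDl.
Qed.

Let h_ge0 s a b y : 0 < s -> a <= b -> 0 <= h s a b y.
Proof.
move=> s0 ab; rewrite mulr_ge0 ?invr_ge0 ?pi_ge0// subr_ge0 le_atan//.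
by rewrite ler_pM2r ?invr_gt0// lerB.
Qed.

Let h_le1 s a b y : h s a b y <= 1.
Proof.
rewrite /h ler_pdivrMl ?pi_gt0// mulr1.
by have := atan_ltpi2 ((b - y) / s); have := atan_gtNpi2 ((a - y) / s); lra.
Qed.

Let h_inside s a b e y M : 0 < s -> 0 < e -> s * M <= e ->
  (forall u, M <= u -> pi / 2 - (pi / 2) * e <= atan u) ->
  a + e <= y <= b - e -> 1 - e <= h s a b y.
Proof.
move=> s0 e0 sM HM /andP[ay yb].
have h1 := HM ((b - y) / s); have h2 := HM ((y - a) / s).
have eay : (a - y) / s = - ((y - a) / s) by ring.
rewrite /h eay atanN ler_pdivlMl ?pi_gt0//.
have {}h1 : pi / 2 - pi / 2 * e <= atan ((b - y) / s).
  by apply: h1; rewrite ler_pdivlMr// mulrC; lra.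
have {}h2 : pi / 2 - pi / 2 * e <= atan ((y - a) / s).
  by apply: h2; rewrite ler_pdivlMr// mulrC; lra.
lra.
Qed.

Let h_outside s a b e y M : 0 < s -> 0 < e -> s * M <= e -> a <= b ->
  (forall u, M <= u -> pi / 2 - (pi / 2) * e <= atan u) ->
  (y <= a - e) || (b + e <= y) -> h s a b y <= e.
Proof.
move=> s0 e0 sM ab HM out.
rewrite /h ler_pdivrMl ?pi_gt0//.
have e1 := atan_ltpi2 ((b - y) / s); have e2 := atan_gtNpi2 ((a - y) / s).
case/orP: out => out.
  have : pi / 2 - pi / 2 * e <= atan ((a - y) / s).
    by apply: HM; rewrite ler_pdivlMr// mulrC; lra.
  have p0 := @pi_gt0 R; have : 0 < pi * e by rewrite mulr_gt0.
  lra.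
have : pi / 2 - pi / 2 * e <= atan ((y - b) / s).
  by apply: HM; rewrite ler_pdivlMr// mulrC; lra.
have -> : (y - b) / s = - ((b - y) / s) by ring.
rewrite atanN.
have p0 := @pi_gt0 R; have : 0 < pi * e by rewrite mulr_gt0.
lra.
Qed.

Let E s m := K * (s `^ g + 2 * m `^ g).

Let dens_ge0 s x : 0 < s -> 0 <= dens s x.
Proof.
move=> s0; rewrite /dens mulr_ge0 ?invr_ge0 ?pi_ge0//.
by apply: Rintegral_ge0 => w _; exact: kernel_ge0.
Qed.

Let smoothed_interval s a b m : 0 < s -> a < b -> `|a| <= m -> `|b| <= m ->
  (((b - a) * (q - E s m))%:E <= \int[P]_w (h s a b (Y w))%:E <=
   ((b - a) * (q + E s m))%:E)%E.
Proof.
move=> s0 ab am bm; rewrite integral_dens//.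
have d_bnd x : (`[a, b]%classic : set R) x -> q - E s m <= dens s x <= q + E s m.
  rewrite /= in_itv/= => /andP[ax xb].
  have xm : `|x| <= m.
    by rewrite ler_norml; move: am bm; rewrite !ler_norml => /andP[? ?] /andP[? ?]; lra.
  have := dens_le x s0; rewrite ler_norml => /andP[d1 d2].
  have : K * (s `^ g + 2 * `|x| `^ g) <= E s m.
    rewrite /E ler_wpM2l ?K0// lerD2l ler_wpM2l// ge0_ler_powR// nnegrE//.
    exact: le_trans xm.
  lra.
have md : measurable_fun (`[a, b]%classic : set R) (fun x => (dens s x)%:E).
  by apply/measurable_EFinP; apply: measurable_funTS; exact: measurable_dens.
have ic r : (\int[mu]_(x in `[a, b]) (r%:E : \bar R) = ((b - a) * r)%:E)%E.
  by rewrite integral_cst//= lebesgue_measure_itv/= lte_fin ab -EFinB -EFinM mulrC.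
apply/andP; split.
  have [qE|qE] := leP 0 (q - E s m).
    rewrite -ic; apply: ge0_le_integral => //.
    by move=> x xab; rewrite lee_fin; have /andP[] := d_bnd x xab.
  apply: (@le_trans _ _ 0%E).
    by rewrite lee_fin mulr_ge0_le0 ?subr_ge0 ?ltW.
  by apply: integral_ge0 => x _; rewrite lee_fin dens_ge0.
rewrite -ic; apply: ge0_le_integral => //.
  by move=> x _; rewrite lee_fin dens_ge0.
by move=> x xab; rewrite lee_fin; have /andP[] := d_bnd x xab.
Qed.

Let p a b := fine (P (Y @^-1` `[a, b]%classic)).

Let mYab a b : measurable (Y @^-1` `[a, b]%classic).
Proof. by rewrite -[X in measurable X]setTI; exact: measurable_funPT. Qed.

Let pE a b : ((p a b)%:E = \int[P]_w (\1_(`[a, b]%classic : set R) (Y w))%:E)%E.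
Proof.
rewrite /p fineK ?fin_num_measure//.
by rewrite -[X in P X](setIT _) -integral_indic.
Qed.

Let p_le s a b e M : 0 < s -> a <= b -> 0 < e <= 1 -> s * M <= e ->
  (forall u, M <= u -> pi / 2 - (pi / 2) * e <= atan u) ->
  (((1 - e) * p a b)%:E <= \int[P]_w (h s (a - e) (b + e) (Y w))%:E)%E.
Proof.
move=> s0 ab /andP[e0 e1] sM HM; rewrite EFinM pE.
rewrite -ge0_integralZl//; last 2 first.
- by apply/measurable_EFinP; apply: measurableT_comp => //; exact: measurable_indic.
- by rewrite lee_fin subr_ge0.
apply: ge0_le_integral => //.
- by move=> w _; rewrite -EFinM lee_fin mulr_ge0// subr_ge0.
- apply/measurable_EFinP; apply: measurable_funM => //.
  by apply: measurableT_comp => //; exact: measurable_indic.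
- by apply/measurable_EFinP; exact: measurableT_comp.
- move=> w _; rewrite -EFinM lee_fin indicE.
  have [|_] := boolP (Y w \in _).
    rewrite mulr1 inE/= in_itv/= => yab; apply: (h_inside s0 e0 sM HM).
    by rewrite subrK addrK.
  by rewrite mulr0 h_ge0//; lra.
Qed.

Let p_ge s a b e M : 0 < s -> a + e <= b - e -> 0 < e -> s * M <= e ->
  (forall u, M <= u -> pi / 2 - (pi / 2) * e <= atan u) ->
  (\int[P]_w (h s (a + e) (b - e) (Y w))%:E <= (p a b + e)%:E)%E.
Proof.
move=> s0 ab e0 sM HM; rewrite EFinD pE.
have -> : e%:E = (\int[P]_w (cst e%:E w))%E.
  rewrite integral_cst//; set r := (X in (_ * X)%E).
  by have -> : r = 1%E by [exact: probability_setT]; rewrite mule1.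
rewrite -ge0_integralD//; last 2 first.
- by apply/measurable_EFinP; apply: measurableT_comp => //; exact: measurable_indic.
- by move=> w _; rewrite lee_fin ltW.
apply: ge0_le_integral => //.
- by move=> w _; rewrite lee_fin h_ge0.
- by apply/measurable_EFinP; exact: measurableT_comp.
- apply/measurable_EFinP; apply: measurable_funD => //.
  by apply: measurableT_comp => //; exact: measurable_indic.
- move=> w _; rewrite /= -EFinD lee_fin indicE.
  have [_|] := boolP (Y w \in _).
    by rewrite (le_trans (h_le1 _ _ _ _))// lerDl ltW.
  rewrite notin_setE/= in_itv/= => /negP; rewrite negb_and -!ltNge => yab.
  rewrite add0r; apply: (h_outside s0 e0 sM ab HM).
  by rewrite addrK subrK; case/orP: yab => /ltW ->; rewrite ?orbT.
Qed.

(** The smoothed density is uniformly close to [q] near the origin, and the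
    smoothed indicator of an interval is squeezed between indicators of slightly
    smaller and larger intervals; letting the smoothing tend to zero compares the
    probability of a short interval with its length times [q]. The exponent [g]
    quantifies the continuity of the density at the origin. *)
Lemma interval_probability a b m : a < b -> `|a| <= m -> `|b| <= m -> 0 < m ->
  (b - a) * (q - 5 * (K * m `^ g)) <= p a b <= (b - a) * (q + 5 * (K * m `^ g)).
Proof.
move=> ab am bm m0.
have E_le s m' : 0 < s <= m -> 0 <= m' <= 2 * m -> E s m' <= 5 * (K * m `^ g).
  move=> /andP[s0 sm] /andP[m'0 m'm].
  have h1 : s `^ g <= m `^ g by apply: ge0_ler_powR => //; rewrite nnegrE ltW.
  have h2 : m' `^ g <= 2 * m `^ g.
    apply: (@le_trans _ _ ((2 * m) `^ g)).
      by apply: ge0_ler_powR => //; rewrite nnegrE mulr_ge0// ltW.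
    rewrite powRM ?(ltW m0)// ler_wpM2r ?powR_ge0// -[leRHS]powRr1//.
    by rewrite ler_powR ?ler1n.
  rewrite /E mulrCA ler_wpM2l ?K0//; lra.
set Q := 5 * (K * m `^ g).
(* a single small parameter bounds the enlargement of the interval, the mass
   that the kernel leaves outside, and hence, through [M], the scale *)
have [M M0 HM] : exists2 M : R -> R, forall e, 0 < e -> 0 < M e &
    forall e, 0 < e -> forall u, M e <= u -> pi / 2 - (pi / 2) * e <= atan u.
  have /choice[M HM] : forall e, exists M, 0 < e -> 0 < M /\
      forall u, M <= u -> pi / 2 - (pi / 2) * e <= atan u.
    move=> e; have [e0|e0] := ltP 0 e; last by exists 0.
    have [M M0 HM] := @atan_lb (pi / 2 * e) (mulr_gt0 (divr_gt0 (@pi_gt0 R) (ltr0n _ 2)) e0).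
    by exists M.
  by exists M => e e0; have [] := HM e e0.
pose s e := Num.min m (e / M e).
have s0 e : 0 < e -> 0 < s e.
  by move=> e0; rewrite lt_min m0/= divr_gt0// M0.
have sm e : s e <= m by rewrite ge_min lexx.
have sM e : 0 < e -> s e * M e <= e.
  by move=> e0; rewrite -ler_pdivlMr ?M0// ge_min lexx orbT.
have up e : 0 < e <= 1 -> e <= m -> (1 - e) * p a b <= (b - a + 2 * e) * (q + Q).
  move=> /[dup] e01 /andP[e0 e1] em.
  have h1 := p_le (s0 _ e0) (ltW ab) e01 (sM _ e0) (HM _ e0).
  have am' : `|a - e| <= 2 * m.
    by apply: (le_trans (ler_normB _ _)); rewrite (gtr0_norm e0); lra.
  have bm' : `|b + e| <= 2 * m.
    by apply: (le_trans (ler_normD _ _)); rewrite (gtr0_norm e0); lra.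
  have ab' : a - e < b + e by lra.
  have /andP[_ h2] := smoothed_interval (s0 _ e0) ab' am' bm'.
  have := le_trans h1 h2; rewrite lee_fin => h3; apply: (le_trans h3).
  have -> : b + e - (a - e) = b - a + 2 * e by ring.
  rewrite ler_wpM2l; [by []|lra|].
  by rewrite lerD2l E_le// ?s0// ?sm// lexx mulr_ge0// ltW.
have lo e : 0 < e <= 1 -> e <= m -> 2 * e < b - a ->
    (b - a - 2 * e) * (q - Q) <= p a b + e.
  move=> /andP[e0 e1] em eab.
  have ab' : a + e < b - e by lra.
  have h1 := p_ge (s0 _ e0) (ltW ab') e0 (sM _ e0) (HM _ e0).
  have am' : `|a + e| <= 2 * m.
    by apply: (le_trans (ler_normD _ _)); rewrite (gtr0_norm e0); lra.
  have bm' : `|b - e| <= 2 * m.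
    by apply: (le_trans (ler_normB _ _)); rewrite (gtr0_norm e0); lra.
  have /andP[h2 _] := smoothed_interval (s0 _ e0) ab' am' bm'.
  have := le_trans h2 h1; rewrite lee_fin => h3; apply: le_trans h3.
  have -> : b - e - (a + e) = b - a - 2 * e by ring.
  rewrite ler_wpM2l; [by []|lra|].
  by rewrite lerB// E_le// ?s0// ?sm// lexx mulr_ge0// ltW.
have p01 : 0 <= p a b <= 1.
  by rewrite /p fine_ge0//= -lee_fin fineK ?fin_num_measure// probability_le1.
apply/andP; split; apply/ler_addgt0Pr => e e0.
- pose N := 2 * `|q - Q| + 1.
  have N0 : 0 < N by rewrite ltr_pwDr// mulr_ge0.
  pose e' := Num.min (Num.min 1 m) (Num.min ((b - a) / 3) (e / N)).
  have e'0 : 0 < e' by rewrite !lt_min ltr01 m0 !divr_gt0// subr_gt0.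
  have [e'1 e'm e'ab e'N] : [/\ e' <= 1, e' <= m, e' <= (b - a) / 3 & e' <= e / N].
    by rewrite !ge_min !lexx ?orbT.
  have e'ab2 : 2 * e' < b - a by lra.
  have h1 : 0 < e' <= 1 by rewrite e'0.
  have h2 := lo e' h1 e'm e'ab2.
  have h3 : e' * (q - Q) <= e' * `|q - Q| by rewrite ler_wpM2l ?ler_norm ?ltW.
  have h4 : e' * N <= e by rewrite -ler_pdivlMr.
  rewrite /N in h4; lra.
- pose N := 2 * `|q + Q| + 1.
  have N0 : 0 < N by rewrite ltr_pwDr// mulr_ge0.
  pose e' := Num.min (Num.min 1 m) (e / N).
  have e'0 : 0 < e' by rewrite !lt_min ltr01 m0 !divr_gt0.
  have [e'1 e'm e'N] : [/\ e' <= 1, e' <= m & e' <= e / N].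
    by rewrite !ge_min !lexx ?orbT.
  have h1 : 0 < e' <= 1 by rewrite e'0.
  have h2 := up e' h1 e'm.
  have h3 : e' * (q + Q) <= e' * `|q + Q| by rewrite ler_wpM2l ?ler_norm ?ltW.
  have h4 : e' * N <= e by rewrite -ler_pdivlMr.
  have h5 : e' * p a b <= e' by rewrite ler_piMr ?(ltW e'0)//; case/andP: p01.
  rewrite /N in h4; lra.
Qed.

End small_ball.

(** * Renewal inequalities *)

Section renewal.
Context {R : realType}.
Implicit Types (U b w : nat -> R) (N k : nat).

Definition renewal_sum b U N : R := \sum_(i < N) b i * U (N - i.+1)%N.

Lemma renewal_sumE b w U N : U 0%N = 1 -> (forall k, U k.+1 = U k + w k) ->
  \sum_(k < N) (b k + renewal_sum b w k) = renewal_sum b U N.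
Proof.
move=> U0 US; elim: N => [|N IH]; first by rewrite /renewal_sum !big_ord0.
rewrite big_ord_recr/= IH /renewal_sum [RHS]big_ord_recr/= subnn U0 mulr1.
transitivity (\sum_(i < N) b i * U (N - i.+1)%N + \sum_(i < N) b i * w (N - i.+1)%N + b N).
  by rewrite -addrA [b N + _]addrC.
rewrite -big_split/=; congr (_ + _); apply: eq_bigr => i _.
by rewrite subSS -mulrDr -US -subSn.
Qed.

(** With [x = exp (- la h)], the discounted sequence [U N * x ^ N] is bounded by
    the geometric series of the discounted total weight [rho] of the kernel [b].
    Here [w] is the sequence of increments of [U]. *)
Lemma renewal_exp_le b w U (x rho : R) : 0 < x <= 1 -> rho < 1 ->
  U 0%N = 1 -> (forall k, U k.+1 = U k + w k) ->
  (forall k, 0 <= b k) -> (forall k, w k <= b k + renewal_sum b w k) ->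
  (forall N, \sum_(i < N) b i * x ^+ i.+1 <= rho) ->
  forall N, U N * x ^+ N <= (1 - rho)^-1.
Proof.
move=> /andP[x0 x1] rho1 U0 US b0 wb brho.
have UN N : U N <= 1 + renewal_sum b U N.
  rewrite -(renewal_sumE b N U0 US).
  elim: N => [|N IH]; first by rewrite U0 big_ord0 addr0.
  by rewrite US big_ord_recr/= addrA lerD.
move=> N; elim/ltn_ind: N => N IH.
have xN : 0 < x ^+ N by rewrite exprn_gt0.
have rho0 : 0 <= rho by have := brho 0%N; rewrite big_ord0.
have -> : (1 - rho)^-1 = 1 + (1 - rho)^-1 * rho by field; rewrite gt_eqF// subr_gt0.
apply: (le_trans (ler_wpM2r (ltW xN) (UN N))); rewrite mulrDl mul1r.
apply: lerD; first by rewrite exprn_ile1 ?(ltW x0).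
apply: (@le_trans _ _ ((1 - rho)^-1 * \sum_(i < N) b i * x ^+ i.+1)); last first.
  by rewrite ler_wpM2l// invr_ge0 subr_ge0 ltW.
rewrite mulr_suml mulr_sumr; apply: ler_sum => i _.
have -> : b i * U (N - i.+1)%N * x ^+ N =
    (b i * x ^+ i.+1) * (U (N - i.+1)%N * x ^+ (N - i.+1)).
  have -> : x ^+ N = x ^+ i.+1 * x ^+ (N - i.+1) by rewrite -exprD subnKC.
  ring.
rewrite mulrC ler_wpM2r ?mulr_ge0 ?exprn_ge0 ?(ltW x0)//.
by apply: IH; rewrite ltn_subrL/= (leq_ltn_trans _ (ltn_ord i)).
Qed.

(** If the discounted kernel already has total weight one over [K] steps, then the
    discounted sequence never falls below its least value over the first [K]
    steps, which is at least [x ^ K]. *)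
Lemma renewal_exp_ge b w U (x : R) K : 0 < x <= 1 ->
  U 0%N = 1 -> (forall k, U k.+1 = U k + w k) -> (forall k, 0 <= w k) ->
  (forall k, 0 <= b k) -> (forall k, b k + renewal_sum b w k <= w k) ->
  1 <= \sum_(i < K) b i * x ^+ i.+1 ->
  forall N, x ^+ K <= U N * x ^+ N.
Proof.
move=> /andP[x0 x1] U0 US w0 b0 wb bK.
have U1 N : 1 <= U N.
  by elim: N => [|N IH]; rewrite ?U0// US (le_trans IH)// lerDl.
have UN N : 1 + renewal_sum b U N <= U N.
  rewrite -(renewal_sumE b N U0 US).
  elim: N => [|N IH]; first by rewrite U0 big_ord0 addr0.
  by rewrite US big_ord_recr/= addrA lerD.
move=> N; elim/ltn_ind: N => N IH.
have [NK|KN] := ltnP N K.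
  apply: (@le_trans _ _ (x ^+ N)); last first.
    by rewrite ler_peMl// exprn_ge0// ltW.
  by apply: ler_wiXn2l; rewrite ?(ltW x0)// ltnW.
apply: (@le_trans _ _ (renewal_sum b U N * x ^+ N)); last first.
  rewrite ler_wpM2r ?exprn_ge0 ?(ltW x0)//.
  by apply: le_trans (UN N); rewrite lerDr.
apply: (@le_trans _ _ ((\sum_(i < K) b i * x ^+ i.+1) * x ^+ K)).
  by rewrite ler_peMl// exprn_ge0// ltW.
apply: (@le_trans _ _ ((\sum_(i < N) b i * x ^+ i.+1) * x ^+ K)).
  rewrite ler_wpM2r ?exprn_ge0 ?(ltW x0)//.
  rewrite (big_ord_widen N (fun i => b i * x ^+ i.+1))//.
  rewrite big_mkcond/=; apply: ler_sum => i _; case: ifP => // _.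
  by rewrite mulr_ge0 ?exprn_ge0 ?(ltW x0).
rewrite /renewal_sum mulr_suml [leRHS]mulr_suml; apply: ler_sum => i _.
have -> : b i * U (N - i.+1)%N * x ^+ N =
    (b i * x ^+ i.+1) * (U (N - i.+1)%N * x ^+ (N - i.+1)).
  have -> : x ^+ N = x ^+ i.+1 * x ^+ (N - i.+1) by rewrite -exprD subnKC.
  ring.
rewrite ler_wpM2l ?mulr_ge0 ?exprn_ge0 ?(ltW x0)//.
by apply: IH; rewrite ltn_subrL/= (leq_ltn_trans _ (ltn_ord i)).
Qed.

End renewal.

(** * Independence *)

Section independence.
Context d d1 d2 (T : measurableType d) (T1 : measurableType d1)
  (T2 : measurableType d2) (R : realType) (P : probability T R).

(** The joint law of independent variables is the product of their laws, so that
    Tonelli's theorem applies. The variables may take values in any measurable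
    spaces, in particular in [T] itself with a smaller sigma-algebra. *)
Lemma independent_fubini (U : {mfun T >-> T1}) (V : {mfun T >-> T2})
    (F : T1 * T2 -> \bar R) :
  (forall A B, measurable A -> measurable B ->
    P (U @^-1` A `&` V @^-1` B) = (P (U @^-1` A) * P (V @^-1` B))%E) ->
  measurable_fun setT F -> (forall z, 0 <= F z)%E ->
  (\int[P]_w F (U w, V w) = \int[P]_w \int[P]_v F (U w, V v))%E.
Proof.
move=> indep mF F0.
have mUV : measurable_fun setT (fun w => (U w, V w)).
  exact: measurable_fun_pair.
pose m' : {measure set (T1 * T2) -> \bar R} := pushforward P (fun w => (U w, V w)).
have E := @product_measure_unique _ _ _ _ _ (distribution P U) (distribution P V) (m' mUV).
transitivity (\int[m' mUV]_z F z)%E.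
  by rewrite ge0_integral_pushforward.
transitivity (\int[(distribution P U \x distribution P V)%E]_z F z)%E.
  by apply: eq_measure_integral => A mA _; apply/esym/E.
rewrite fubini_tonelli1// /fubini_F ge0_integral_distribution//; last 2 first.
- exact: measurable_fun_fubini_tonelli_F.
- by move=> y; exact: integral_ge0.
apply: eq_integral => w _ /=; rewrite ge0_integral_distribution//.
exact: measurableT_comp mF (measurable_pair1 _).
Qed.

End independence.

Section independence_generators.
Context d (T : measurableType d) (R : realType) (P : probability T R).

(** Dynkin's lemma: the events independent of [E] form a lambda-system. *)
Lemma independent_generated (C : set (set T)) (E : set T) : setI_closed C ->
  C `<=` measurable -> measurable E ->
  (forall A, C A -> P (A `&` E) = (P A * P E)%E) ->
  forall A, <<s C >> A -> P (A `&` E) = (P A * P E)%E.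
Proof.
move=> CI Cm mE CE A sA.
have sm B : <<s C >> B -> measurable B.
  by apply: smallest_sub => //; exact: sigma_algebra_measurable.
apply: (@dynkin_induction _ (g_sigma_algebraType C) C
  (fun A => P (A `&` E) = (P A * P E)%E)) => //.
- by rewrite setTI probability_setT mul1e.
- move=> S mS PS; have {}mS : d.-measurable S by exact: sm.
  rewrite setIC -setDE measureD//; last first.
    by rewrite (le_lt_trans (probability_le1 P mE))// ltry.
  rewrite [X in (_ - X)%E = _](_ : _ = P S * P E)%E; last by rewrite setIC; exact: PS.
  by rewrite probability_setC// muleBl ?mul1e//; exact: fin_num_measure.
- move=> F mF tF PF; have {}mF n : d.-measurable (F n) by apply: sm; exact: mF.
  rewrite setI_bigcupl measure_bigcup//; last 2 first.
  + by move=> n _; exact: measurableI.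
  + by apply: trivIset_setIr.
  rewrite measure_bigcup//.
  rewrite -(fineK (fin_num_measure P _ mE)) muleC -nneseriesZl//.
  apply: eq_eseriesr => n _.
  rewrite fineK ?fin_num_measure// muleC; exact: PF.
Qed.

End independence_generators.

(** * Visits of a random walk to a small interval *)

Section walk.
Context d (T : measurableType d) (R : realType) (P : probability T R).
Variables (X : R -> {RV P >-> R}) (h eps c : R).
Hypothesis indX : independent_increments X.
Hypothesis statX : stationary_increments X.
Hypothesis h0 : 0 < h.
Hypothesis eps0 : 0 <= eps.
Hypothesis c0 : 0 <= c.
Implicit Types (i j k : nat) (w : T).

Let J : set R := `[- eps, eps]%classic.
Let mJ : measurable J. Proof. exact: measurable_itv. Qed.

(** [S] is the walk, [hit k] the weight of a visit at step [k], and [G k] the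
    product of the gains up to step [k]. Expanding [G] according to the last
    visit that is counted gives the terms [V j], the index [j = 0] standing
    for no visit. *)
Let step i w := X (i.+1%:R * h) w - X (i%:R * h) w.
Let S k w := X (k%:R * h) w - X 0 w.
Let hit k w := c * \1_J (S k w).
Let G k w := \prod_(j < k) (1 + hit j.+1 w).
Let V j w := if j is j'.+1 then G j' w * hit j w else 1.
Let inc j k w := X (k.+1%:R * h) w - X (j%:R * h) w.

Let SE k w : S k w = \sum_(i < k) step i w.
Proof.
rewrite -(big_mkord xpredT (fun i => step i w)) /step.
by rewrite (@telescope_sumr _ 0 k (fun i => X (i%:R * h) w))// mul0r.
Qed.

Let GE k w : G k w = \sum_(j < k.+1) V j w.
Proof.
elim: k => [|k IH]; first by rewrite /G big_ord0 big_ord_recr big_ord0 /= add0r.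
rewrite big_ord_recr/= -IH /V /G big_ord_recr/= mulrDr mulr1.
by [].
Qed.

(** Cylinder events of the first [j] steps: they generate the past at step [j]
    and are stable under intersection. *)
Let past j : set (set T) := [set A | exists B : nat -> set R,
  (forall i, measurable (B i)) /\ A = \bigcap_(i in `I_j) [set w | B i (step i w)]].

Let mstep i : measurable_fun setT (step i).
Proof. exact: measurable_funB. Qed.

Let minc j k : measurable_fun setT (inc j k).
Proof. exact: measurable_funB. Qed.

Let past_measurable j : past j `<=` measurable.
Proof.
move=> A [B [mB ->]]; apply: fin_bigcap_measurable; first exact: finite_II.
by move=> i _; rewrite -[X in measurable X]setTI; exact: mstep.
Qed.

Let past_setI j : setI_closed (past j).
Proof.
move=> A A' [B [mB ->]] [B' [mB' ->]].
exists (fun i => B i `&` B' i); split; first by move=> i; exact: measurableI.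
by rewrite -bigcapI.
Qed.

Let past_indep j k A B : (j <= k)%N -> <<s past j >> A -> measurable B ->
  P (A `&` inc j k @^-1` B) = (P A * P (inc j k @^-1` B))%E.
Proof.
move=> jk sA mB; apply: (independent_generated (@past_setI j)) sA => //.
- by rewrite -[X in d.-measurable X]setTI; exact: minc.
move=> {}A [D [mD ->]].
(* the times [0, h, ..., j h], then a single increment up to time [(k + 1) h] *)
pose t i := if (i <= j)%N then i%:R * h else k.+1%:R * h.
pose D' i := if (i < j)%N then D i else B.
have t0 : 0 <= t 0%N by rewrite /t leq0n mul0r.
have tS i : t i <= t i.+1.
  rewrite /t; case: (leqP i j) => ij; case: (ltnP i j) => ij' //.
  - by rewrite ler_pM2r// ler_nat.
  - by rewrite ler_pM2r// ler_nat (leq_trans ij)// leqW.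
  - by move: ij; rewrite ltnNge (ltnW ij').
have mD' i : measurable (D' i) by rewrite /D'; case: ifP.
have E1 := indX j.+1 t0 tS mD'.
have t1 : 0 <= (fun i => i%:R * h) 0%N by rewrite mul0r.
have t1S i : (fun i => i%:R * h) i <= (fun i => i%:R * h) i.+1.
  by rewrite ler_pM2r// ler_nat.
have E2 := indX j t1 t1S mD.
have -> : \bigcap_(i in `I_j) [set w | D i (step i w)] `&` inc j k @^-1` B =
    \bigcap_(i in `I_j.+1) [set w | D' i (X (t i.+1) w - X (t i) w)].
  apply/seteqP; split=> w.
    move=> [Dw Bw] i /=; rewrite ltnS leq_eqVlt => /predU1P[->|ij].
      by rewrite /D' ltnn /t ltnn leqnn.
    by rewrite /D' ij /t (ltnW ij) ij; exact: Dw.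
  move=> Dw; split.
    move=> i /= ij; have := Dw i; rewrite /= ltnW// => /(_ isT).
    by rewrite /D' ij /t (ltnW ij) ij.
  by have := Dw j; rewrite /= ltnS leqnn /D' ltnn /t ltnn leqnn; exact.
rewrite E1 big_ord_recr/= E2; congr (_ * _)%E.
  apply: eq_bigr => i _; congr (P _).
  by rewrite /D' /t (ltn_ord i) (ltnW (ltn_ord i)).
by rewrite /D' ltnn /t ltnn leqnn.
Qed.

Let pastT j := g_sigma_algebraType (past j).

Let step_past i j : (i < j)%N -> measurable_fun (setT : set (pastT j)) (step i).
Proof.
move=> ij _ B mB; rewrite setTI; apply: sub_sigma_algebra.
exists (fun i' => if i' == i then B else setT); split.
  by move=> i'; case: ifP.
apply/seteqP; split=> w.
  by move=> Bw i' /= _; case: eqP => // ->.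
by move=> /(_ i ij); rewrite /= eqxx.
Qed.

Let S_past i j : (i <= j)%N -> measurable_fun (setT : set (pastT j)) (S i).
Proof.
move=> ij; rewrite (_ : S i = fun w => \sum_(i' < i) step i' w); last first.
  by apply/funext => w; exact: SE.
apply: measurable_sum => i'; apply: step_past.
exact: leq_trans (ltn_ord i') ij.
Qed.

Let hit_past i j : (i <= j)%N -> measurable_fun (setT : set (pastT j)) (hit i).
Proof.
move=> ij; apply: measurable_funM => //.
by apply: measurableT_comp; [exact: measurable_indic|exact: S_past].
Qed.

Let V_past j : measurable_fun (setT : set (pastT j)) (V j).
Proof.
case: j => [|j]; first exact: measurable_cst.
apply: (@measurable_funM _ (pastT j.+1) R setT (G j) (hit j.+1)); last exact: hit_past.
apply: (@measurable_prod _ (pastT j.+1) R setT) => i _.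
apply: measurable_funD => //; apply: hit_past.
by rewrite ltnS ltnW// ltn_ord.
Qed.

Let hit_ge0 i w : 0 <= hit i w. Proof. by rewrite mulr_ge0. Qed.

Let hit_le i w : hit i w <= c.
Proof. by rewrite ler_piMr// indicE; case: (_ \in _). Qed.

Let G_ge0 i w : 0 <= G i w.
Proof. by apply: prodr_ge0 => j _; rewrite addr_ge0. Qed.

Let G_le i w : G i w <= (1 + c) ^+ i.
Proof.
have -> : (1 + c) ^+ i = \prod_(j < i) (1 + c) by rewrite prodr_const card_ord.
by apply: ler_prod => j _; rewrite addr_ge0//= lerD2l.
Qed.

Let V_ge0 j w : 0 <= V j w.
Proof. by case: j => [|j] //=; rewrite mulr_ge0. Qed.

Let V_hit j w : V j w != 0 -> `|S j w| <= eps.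
Proof.
case: j => [|j] /=; first by rewrite /S mul0r subrr normr0.
rewrite mulf_eq0 negb_or => /andP[_]; rewrite /hit indicE.
case: (boolP (_ \in _)); last by rewrite mulr0 eqxx.
by rewrite inE /J/= in_itv/= ler_norml.
Qed.

Let mS k : measurable_fun setT (S k).
Proof. exact: measurable_funB. Qed.

Let mhit k : measurable_fun setT (hit k).
Proof.
by apply: measurable_funM => //; apply: measurableT_comp.
Qed.

Let mG k : measurable_fun setT (G k).
Proof.
apply: (@measurable_prod _ T R setT) => i _.
exact: (@measurable_funD _ T R setT (cst 1) (hit i.+1)).
Qed.

Let mV k : measurable_fun setT (V k).
Proof.
case: k => [|k]; first exact: measurable_cst.
exact: (@measurable_funM _ T R setT (G k) (hit k.+1)).
Qed.

Let V_le j w : V j w <= (1 + c) ^+ j.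
Proof.
case: j => [|j] //=; rewrite exprSr; apply: ler_pM => //.
by rewrite (le_trans (hit_le _ _))// lerDr.
Qed.

Let integrable_bdd (f : T -> R) M : measurable_fun setT f ->
  (forall w, 0 <= f w <= M) -> P.-integrable setT (EFin \o f).
Proof.
move=> mf fM; apply: measurable_bounded_integrable => //.
  by rewrite -ge0_fin_numE// fin_num_measure.
exists M; split; first exact: num_real.
move=> y My w _ /=; have /andP[f0 f1] := fM w.
by rewrite ger0_norm// (le_trans f1)// ltW.
Qed.

Let iG k : P.-integrable setT (EFin \o G k).
Proof. by apply: (@integrable_bdd _ ((1 + c) ^+ k)) => // w; rewrite G_ge0 G_le. Qed.

Let iV k : P.-integrable setT (EFin \o V k).
Proof. by apply: (@integrable_bdd _ ((1 + c) ^+ k)) => // w; rewrite V_ge0 V_le. Qed.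

Let iVhit j k : P.-integrable setT (EFin \o (fun w => V j w * hit k w)).
Proof.
apply: (@integrable_bdd _ ((1 + c) ^+ j * c)).
  exact: (@measurable_funM _ T R setT (V j) (hit k)).
by move=> w; rewrite mulr_ge0//= ler_pM.
Qed.

(** The weighted probability of a visit [i + 1] steps after being at [y]. *)
Let reach i y := c * fine (P [set w | J (y + (X (i.+1%:R * h) w - X 0 w))]).

Let reachE i j (y : R) :
  (\int[P]_v (c * \1_J (y + inc j (j + i) v))%:E = (reach i y)%:E)%E.
Proof.
have mJy : measurable ((fun z => y + z) @^-1` J).
  by rewrite -[X in measurable X]setTI; apply: measurable_funD.
transitivity (\int[P]_v (c%:E * (\1_(inc j (j + i) @^-1` ((fun z => y + z) @^-1` J)) v)%:E))%E.
  by apply: eq_integral => v _; rewrite -EFinM; congr (_ * _)%:E; rewrite !indicE.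
rewrite ge0_integralZl_EFin//; last first.
  apply/measurable_EFinP; apply: measurable_indic.
  by rewrite -[X in d.-measurable X]setTI; exact: minc.
rewrite integral_indic//; last first.
  by rewrite -[X in d.-measurable X]setTI; exact: minc.
rewrite setIT /reach EFinM; congr (_ * _)%E.
rewrite fineK; last first.
  apply: fin_num_measure; rewrite -[X in d.-measurable X]setTI.
  by apply: (measurable_funB (_ : measurable_fun setT (X (i.+1%:R * h))) _ measurableT mJy).
have := statX (mulr_ge0 (ler0n R j) (ltW h0)) (mulr_ge0 (ler0n R i.+1) (ltW h0)) mJy.
by rewrite -mulrDl -natrD addnS.
Qed.

(** The increment after step [j] is independent of the past, so that the past
    enters the probability of a later visit only through the last position, which
    lies in the target interval when [V j] is positive. *)
Let visit_after j i :
  (\int[P]_w (V j w * hit (j + i).+1 w)%:E =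
   \int[P]_w ((V j w)%:E * (reach i (S j w))%:E))%E.
Proof.
have jk : (j <= j + i)%N by rewrite leq_addr.
have mid : measurable_fun setT (fun w => w : pastT j).
  move=> _ A mA; rewrite setTI.
  by apply: smallest_sub mA; [exact: sigma_algebra_measurable|exact: past_measurable].
(* the whole past is treated as one variable: the identity into the coarser
   sigma-algebra *)
pose U := mfun_Sub (mem_set mid).
pose I := mfun_Sub (mem_set (@minc j (j + i))).
have E := @independent_fubini _ _ _ T (pastT j) _ R P U I
  (fun z => ((V j z.1) * (c * \1_J (S j z.1 + z.2)))%:E).
have {}E := E _ _ _.
rewrite (_ : (\int[P]_w (V j w * hit (j + i).+1 w)%:E =
    \int[P]_w (V j w * (c * \1_J (S j w + inc j (j + i) w)))%:E)%E); last first.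
  apply: eq_integral => w _; congr (_ * _)%:E; rewrite /hit /S /inc.
  by congr (_ * \1_J _); ring.
rewrite [LHS]E; last 3 first.
- by move=> A B mA mB; exact: past_indep.
- apply/measurable_EFinP; apply: measurable_funM.
    exact: measurableT_comp (@V_past j) _.
  apply: measurable_funM => //; apply: measurableT_comp.
    exact: measurable_indic.
  apply: measurable_funD => //.
  by apply: measurableT_comp (@S_past j j (leqnn j)) _.
- by move=> z; rewrite lee_fin mulr_ge0// mulr_ge0.
apply: eq_integral => w _ /=.
under eq_integral do rewrite EFinM.
rewrite ge0_integralZl_EFin//; last 2 first.
- by move=> v _; rewrite lee_fin mulr_ge0.
- apply/measurable_EFinP; apply: measurable_funM => //; apply: measurableT_comp => //.
  exact: (@measurable_funD _ T R setT (cst (S j w)) (inc j (j + i))).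
by rewrite reachE.
Qed.

Variables bl bu : nat -> R.
Hypothesis bl0 : forall i, 0 <= bl i.
Hypothesis bP : forall i y, `|y| <= eps -> bl i <= reach i y <= bu i.

Let U k := \int[P]_w G k w.
Let v k := \int[P]_w V k w.

Let visit_bounds j i :
  bl i * v j <= \int[P]_w (V j w * hit (j + i).+1 w) <= bu i * v j.
Proof.
rewrite /v -!RintegralZl//.
have E : (\int[P]_w (V j w * hit (j + i).+1 w))%R =
    fine (\int[P]_w ((V j w)%:E * (reach i (S j w))%:E))%E.
  by rewrite -visit_after.
have bV (b : R) : P.-integrable setT (EFin \o (fun w => b * V j w)).
  rewrite [X in _.-integrable _ X](_ : _ = fun w => (b%:E * (EFin \o V j) w)%E); last by [].
  exact: (integrableZl measurableT b (iV j)).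
have fV (b : R) : (\int[P]_w (b * V j w)%:E)%E \is a fin_num.
  exact: (integrable_fin_num measurableT (bV b)).
have bu0 : 0 <= bu i.
  have z0 : `|0 : R| <= eps by rewrite normr0.
  by have /andP[h1 h2] := bP i z0; rewrite (le_trans (bl0 i))// (le_trans h1).
have vle w : bl i * V j w <= V j w * reach i (S j w) <= bu i * V j w.
  have [->|V0] := eqVneq (V j w) 0; first by rewrite !mulr0 mul0r lexx.
  have /andP[b1 b2] := bP i (V_hit V0).
  by rewrite mulrC ler_wpM2l//= [leRHS]mulrC ler_wpM2l.
have fm : (\int[P]_w ((V j w)%:E * (reach i (S j w))%:E))%E \is a fin_num.
  rewrite -visit_after; exact: (integrable_fin_num measurableT (iVhit j (j + i).+1)).
rewrite E /Rintegral -!lee_fin !fineK//.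
have mr : measurable_fun setT (fun w => ((V j w)%:E * (reach i (S j w))%:E)%E).
  apply: emeasurable_funM; first exact/measurable_EFinP.
  pose F (z : R * T) := (c * \1_J (z.1 + inc j (j + i) z.2))%:E.
  have mF : measurable_fun setT F.
    apply/measurable_EFinP; apply: measurable_funM => //; apply: measurableT_comp => //.
    by apply: measurable_funD => //; apply: measurableT_comp (@minc j (j + i)) _.
  rewrite (_ : (fun w => _) = (fubini_F P F) \o S j); last first.
    by apply/funext => w; rewrite /= -(reachE i j).
  apply: measurableT_comp => //; apply: measurable_fun_fubini_tonelli_F => //.
  by move=> z; rewrite lee_fin mulr_ge0.
apply/andP; split; apply: ge0_le_integral => //.
- by move=> w _; rewrite lee_fin mulr_ge0.
- apply/measurable_EFinP.
  exact: (@measurable_funM _ T R setT (cst (bl i)) (V j)).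
- by move=> w _; rewrite lee_fin; have /andP[] := vle w.
- by move=> w _; have /andP[h1 h2] := vle w; rewrite -EFinM lee_fin (le_trans _ h1)// mulr_ge0.
- apply/measurable_EFinP.
  exact: (@measurable_funM _ T R setT (cst (bu i)) (V j)).
- by move=> w _; rewrite lee_fin; have /andP[] := vle w.
Qed.

Let w k := v k.+1.

Let U0 : U 0%N = 1.
Proof.
rewrite /U /G; under eq_Rintegral do rewrite big_ord0.
by rewrite Rintegral_cst//; have /= -> := probability_setT P; rewrite mulr1.
Qed.

Let v0 : v 0%N = 1.
Proof. by rewrite /v /V Rintegral_cst//; have /= -> := probability_setT P; rewrite mulr1. Qed.

Let US k : U k.+1 = U k + w k.
Proof.
rewrite /U /w /v -(RintegralD measurableT (iG k) (iV k.+1)).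
apply: eq_Rintegral => x _.
by rewrite /V {1}/G big_ord_recr/= mulrDr mulr1.
Qed.

Let wE k : w k = \sum_(j < k.+1) \int[P]_x (V j x * hit k.+1 x).
Proof.
have -> : w k = \int[P]_x \sum_(j < k.+1) (V j x * hit k.+1 x).
  by apply: eq_Rintegral => x _; rewrite -mulr_suml -GE.
move: k.+1 => m; suff : forall n, \int[P]_x \sum_(j < n) (V j x * hit m x) =
    \sum_(j < n) \int[P]_x (V j x * hit m x) by exact.
elim=> [|n IH].
  under eq_Rintegral do rewrite big_ord0.
  by rewrite Rintegral_cst// mul0r big_ord0.
have iS : P.-integrable setT (EFin \o (fun x => \sum_(j < n) V j x * hit m x)).
  rewrite [X in _.-integrable _ X](_ : _ =
    fun x => (\sum_(j < n) (V j x * hit m x)%:E)%E); last first.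
    by apply/funext => x; rewrite /= sumEFin.
  by apply: integrable_sum => // j _; exact: iVhit.
rewrite big_ord_recr/= -IH -(RintegralD measurableT iS (iVhit n m)).
by apply: eq_Rintegral => x _; rewrite big_ord_recr.
Qed.

(** Reverses the order of summation, the term [v 0 = 1] accounting for the
    first visit. *)
Let renewal_rev (b : nat -> R) k :
  \sum_(j < k.+1) b (k - j)%N * v j = b k + renewal_sum b w k.
Proof.
rewrite big_ord_recl/= subn0 v0 mulr1; congr (_ + _).
rewrite /renewal_sum (reindex_inj rev_ord_inj)/=; apply: eq_bigr => i _.
rewrite /bump/= add1n /w subnS; congr (b _ * _).
by rewrite -subnS subnSK// subKn// ltnW.
Qed.

Let w_le k : w k <= bu k + renewal_sum bu w k.
Proof.
rewrite wE -renewal_rev; apply: ler_sum => j _.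
have /andP[_] := visit_bounds j (k - j).
by rewrite subnKC// -ltnS.
Qed.

Let w_ge k : bl k + renewal_sum bl w k <= w k.
Proof.
rewrite wE -renewal_rev; apply: ler_sum => j _.
have /andP[+ _] := visit_bounds j (k - j).
by rewrite subnKC// -ltnS.
Qed.

(** The increments of the mean gain are [w k = E (G k hit (k + 1))]; splitting [G
    k] according to the last counted visit and conditioning on it turns uniform
    bounds for [reach] into renewal inequalities. *)
Lemma walk_exp_le (x rho : R) : 0 < x <= 1 -> rho < 1 ->
  (forall N, \sum_(i < N) bu i * x ^+ i.+1 <= rho) ->
  forall N, \int[P]_w (\prod_(j < N) (1 + c * \1_J (X (j.+1%:R * h) w - X 0 w)))
    * x ^+ N <= (1 - rho)^-1.
Proof.
move=> x01 rho1 brho N; apply: (@renewal_exp_le _ bu w U x rho x01 rho1 U0 US _ w_le brho) => // k.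
have z0 : `|0 : R| <= eps by rewrite normr0.
by have /andP[h1 h2] := bP k z0; rewrite (le_trans (bl0 k))// (le_trans h1).
Qed.

Lemma walk_exp_ge (x : R) K : 0 < x <= 1 ->
  1 <= \sum_(i < K) bl i * x ^+ i.+1 ->
  forall N, x ^+ K <=
    \int[P]_w (\prod_(j < N) (1 + c * \1_J (X (j.+1%:R * h) w - X 0 w))) * x ^+ N.
Proof.
move=> x01 bK N; apply: (@renewal_exp_ge _ bl w U x K x01 U0 US _ bl0 w_ge bK) => k.
by apply: Rintegral_ge0 => y _; exact: V_ge0.
Qed.

End walk.

(** * Riemann sums of the Gamma integral *)

Section riemann.
Context {R : realType}.
Variable f : R -> R.
Notation mu := (@lebesgue_measure R).
Let Rp : set R := `]0, +oo[%classic.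
Hypothesis f0 : forall x, 0 < x -> 0 <= f x.
Hypothesis fdec : forall x y, 0 < x -> x <= y -> f y <= f x.
Hypothesis cf : forall x, 0 < x -> {for x, continuous f}.
Implicit Types (x y eta a b : R) (N K n : nat).

Let mf (A : set R) : A `<=` Rp -> measurable_fun A (EFin \o f).
Proof.
move=> AR; apply/measurable_EFinP; apply: measurable_funS (measurable_fun_Rp cf) => //.
Qed.

Let subRp a b : 0 <= a -> `]a, b]%classic `<=` Rp.
Proof.
by move=> a0 x /=; rewrite /Rp/= !in_itv/= andbT => /andP[/(le_lt_trans a0)].
Qed.

Let cell a b : 0 < b - a -> (mu `]a, b]%classic = (b - a)%:E)%E.
Proof. by rewrite subr_gt0 => ab; rewrite lebesgue_measure_itv/= lte_fin ab. Qed.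

Let cell_le a b : 0 <= a -> a < b ->
  ((((b - a) * f b)%:E <= \int[mu]_(x in `]a, b]) (f x)%:E))%E.
Proof.
move=> a0 ab.
rewrite mulrC EFinM -(@cell a b) ?subr_gt0// -integral_cst//.
apply: ge0_le_integral => //.
- by move=> x _; rewrite lee_fin f0// (le_lt_trans a0).
- exact: mf (subRp a0).
- move=> x; rewrite /= in_itv/= => /andP[ax xb]; rewrite lee_fin fdec//.
  exact: le_lt_trans ax.
Qed.

Let cell_ge a b : 0 < a -> a < b ->
  ((\int[mu]_(x in `]a, b]) (f x)%:E <= ((b - a) * f a)%:E))%E.
Proof.
move=> a0 ab.
rewrite mulrC EFinM -(@cell a b) ?subr_gt0// -integral_cst//.
apply: ge0_le_integral => //.
- move=> x; rewrite /= in_itv/= => /andP[ax xb]; rewrite lee_fin f0//.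
  exact: lt_trans ax.
- exact: mf (subRp (ltW a0)).
- move=> x; rewrite /= in_itv/= => /andP[ax xb]; rewrite lee_fin fdec//.
  exact: ltW.
Qed.

Let cells eta m N : 0 < eta ->
  (\int[mu]_(x in `](eta * m%:R)%R, (eta * (m + N)%:R)%R]) (f x)%:E =
   \sum_(i < N) \int[mu]_(x in `](eta * (m + i)%:R)%R, (eta * (m + i).+1%:R)%R]) (f x)%:E)%E.
Proof.
move=> eta0; elim: N => [|N IH].
  by rewrite addn0 set_itvoc0// big_ord0 integral_set0.
rewrite big_ord_recr/= -IH -ge0_integral_setU//.
- rewrite addnS (@itv_bndbnd_setU _ _ _ (BRight (eta * (m + N)%:R)))//.
    by rewrite bnd_simp ler_pM2l// ler_nat leq_addr.
  by rewrite bnd_simp ler_pM2l// ler_nat leqnSn.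
- apply: mf; rewrite subUset; split; apply: subRp; rewrite mulr_ge0// ltW//.
- move=> x [] /=; rewrite in_itv/= => /andP[+ _] => /le_lt_trans xm; rewrite lee_fin f0//;
    by apply: xm; rewrite mulr_ge0// ltW.
- apply/disj_set2P/seteqP; split=> // x [] /=; rewrite !in_itv/=.
  by move=> /andP[_ x1] /andP[x2 _]; move: (lt_le_trans x2 x1); rewrite ltxx.
Qed.

Lemma riemann_sum_le eta N : 0 < eta ->
  ((\sum_(i < N) eta * f (eta * i.+1%:R))%:E <= \int[mu]_(x in Rp) (f x)%:E)%E.
Proof.
move=> eta0.
apply: (@le_trans _ _ (\int[mu]_(x in `](eta * 0%:R)%R, (eta * (0 + N)%:R)%R]) (f x)%:E)%E).
  rewrite cells// -sumEFin; apply: lee_sum => i _; rewrite add0n.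
  have := @cell_le (eta * i%:R) (eta * i.+1%:R); rewrite -mulrBr -natrB// subSnn mulr1.
  by apply; [rewrite mulr_ge0// ltW|rewrite ltr_pM2l// ltr_nat].
apply: ge0_subset_integral => //.
- exact: measurable_itv.
- exact: mf.
- by move=> x; rewrite /Rp/= in_itv/= andbT lee_fin; exact: f0.
- by apply: subRp; rewrite mulr0.
Qed.

Lemma riemann_sum_ge eta N : 0 < eta ->
  (\int[mu]_(x in `]eta, (eta * N.+1%:R)%R]) (f x)%:E <=
   (\sum_(i < N) eta * f (eta * i.+1%:R))%:E)%E.
Proof.
move=> eta0; have := @cells eta 1 N eta0; rewrite mulr1 add1n => ->.
rewrite -sumEFin; apply: lee_sum => i _; rewrite add1n.
have := @cell_ge (eta * i.+1%:R) (eta * i.+2%:R); rewrite -mulrBr -natrB// subSnn mulr1.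
by apply; rewrite ?ltr_pM2l ?ltr_nat// mulr_gt0.
Qed.

(** Monotonicity alone controls the Riemann sums, although the integrand may be
    singular at the origin: they lie below the integral, and above the integral
    from the first mesh point on. The thresholds do not depend on the mesh and the
    number of terms separately. *)
Lemma riemann_sum_near (l kappa : R) : (\int[mu]_(x in Rp) (f x)%:E = l%:E)%E ->
  0 < kappa -> exists eta0 s0 : R, [/\ 0 < eta0, 0 < s0 &
    forall eta N, 0 < eta <= eta0 -> s0 <= eta * N.+1%:R ->
      l - kappa <= \sum_(i < N) eta * f (eta * i.+1%:R)].
Proof.
move=> fl k0.
pose F n : set R := `]n.+1%:R^-1, n.+1%:R]%classic.
have Fn n : F n `<=` Rp by apply: subRp; rewrite invr_ge0.
have UF : \bigcup_i F i = Rp.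
  apply/seteqP; split=> [x [n _]|x]; first exact: Fn.
  rewrite /Rp/= in_itv/= andbT => x0.
  exists (Num.Def.archi_bound (Num.max x x^-1)) => //=.
  have := archi_boundP (_ : 0 <= Num.max x x^-1).
  rewrite le_max (ltW x0)/= => /(_ isT); rewrite gt_max => /andP[h1 h2].
  set n := Num.Def.archi_bound _ in h1 h2 *.
  rewrite /F/= in_itv/= (le_trans (ltW h1)) ?ler_nat// andbT.
  rewrite -[ltRHS]invrK ltf_pV2 ?posrE ?invr_gt0//.
  by rewrite (lt_le_trans h2)// ler_nat.
have cvgF : (\int[mu]_(x in F i) (f x)%:E)%E @[i --> \oo] --> l%:E.
  rewrite -fl -UF; apply: ge0_nondecreasing_set_cvg_integral.
  - move=> n m nm; apply/subsetPset => x; rewrite /F/= !in_itv/= => /andP[h1 h2].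
    rewrite (le_lt_trans _ h1) ?(le_trans h2) ?ler_nat//.
    by rewrite lef_pV2 ?posrE// ler_nat.
  - by move=> n; exact: measurable_itv.
  - by move=> n; exact: mf.
  - by move=> n x /Fn; rewrite /Rp/= in_itv/= andbT lee_fin; exact: f0.
have : \forall n \near \oo, ((l - kappa)%:E < \int[mu]_(x in F n) (f x)%:E)%E.
  apply: (cvgF [set y | ((l - kappa)%:E < y)%E]).
  by apply: open_nbhs_nbhs; split; [exact: open_ereal_gt_ereal|rewrite /= lte_fin ltrBlDr ltrDl].
case=> n _ /(_ n (leqnn n)) Fl.
exists n.+1%:R^-1, n.+1%:R; split; rewrite ?invr_gt0// => eta N /andP[eta0 etan] sN.
rewrite -lee_fin; apply: (le_trans (ltW Fl)).
apply: le_trans (riemann_sum_ge N eta0).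
apply: ge0_subset_integral => //.
- exact: measurable_itv.
- by apply: mf; apply: subRp (ltW eta0).
- by move=> x /(@subRp eta _ (ltW eta0)); rewrite /Rp/= in_itv/= andbT lee_fin; exact: f0.
- move=> x; rewrite /F/= !in_itv/= => /andP[h1 h2].
  by rewrite (le_lt_trans etan)// (le_trans h2).
Qed.

End riemann.

Section gamma_riemann.
Context {R : realType}.
Implicit Types (a x eta : R).

(** Riemann sum of mesh [eta] for the integral defining [Gamma (1 - a)]. *)
Definition gamma_sum a eta N : R :=
  \sum_(i < N) eta * ((eta * i.+1%:R) `^ (- a) * expR (- (eta * i.+1%:R))).

Let kernel0 a x : 0 < x -> 0 <= x `^ (- a) * expR (- x).
Proof. by rewrite mulr_ge0 ?powR_ge0 ?expR_ge0. Qed.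

Let kernel_dec a x y : 0 < a -> 0 < x -> x <= y ->
  y `^ (- a) * expR (- y) <= x `^ (- a) * expR (- x).
Proof.
move=> a0 x0 xy; have y0 := lt_le_trans x0 xy.
rewrite ler_pM ?powR_ge0 ?expR_ge0//; last by rewrite ler_expR lerN2.
rewrite !powRN lef_pV2 ?posrE ?powR_gt0//.
by apply: ge0_ler_powR => //; rewrite ?nnegrE ltW.
Qed.

Let kernel_cont a x : 0 < x ->
  {for x, continuous (fun u : R => u `^ (- a) * expR (- u))}.
Proof.
move=> x0; exact: continuous_gamma_kernel.
Qed.

Let kernel_int a : 0 < a < 1 ->
  (\int[lebesgue_measure]_(x in `]0%R, +oo[) (x `^ (- a) * expR (- x))%:E = (Gamma (1 - a))%:E)%E.
Proof.
move=> a01; rewrite GammaE; last by lra.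
by rewrite (_ : 1 - a - 1 = - a)//; ring.
Qed.

Lemma gamma_sum_le a eta N : 0 < a < 1 -> 0 < eta -> gamma_sum a eta N <= Gamma (1 - a).
Proof.
move=> a01 eta0; rewrite -lee_fin -(kernel_int a01).
by apply: riemann_sum_le => // [x x0|x y|x]; [exact: kernel0|apply: kernel_dec; lra|exact: kernel_cont].
Qed.

Lemma gamma_sum_near a kappa : 0 < a < 1 -> 0 < kappa ->
  exists eta0 s0 : R, [/\ 0 < eta0, 0 < s0 &
    forall eta N, 0 < eta <= eta0 -> s0 <= eta * N.+1%:R ->
      Gamma (1 - a) - kappa <= gamma_sum a eta N].
Proof.
move=> a01; apply: riemann_sum_near (kernel_int a01) => [x x0|x y|x].
- exact: kernel0.
- by apply: kernel_dec; lra.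
- exact: kernel_cont.
Qed.

(** A mesh [h] and a discount rate [la] only enter through their product. *)
Lemma gamma_sum_scale a la h N : 0 < la -> 0 < h ->
  \sum_(i < N) h * ((i.+1%:R * h) `^ (- a) * expR (- (la * h)) ^+ i.+1) =
  la `^ (a - 1) * gamma_sum a (la * h) N.
Proof.
move=> la0 h0; rewrite mulr_sumr; apply: eq_bigr => i _.
rewrite -expRM_natl mulrN.
have -> : la * h * i.+1%:R = la * (i.+1%:R * h) by ring.
have -> : i.+1%:R * (la * h) = la * (i.+1%:R * h) by ring.
rewrite [(la * _) `^ _]powRM ?(ltW la0) ?mulr_ge0 ?(ltW h0)//.
rewrite powRD; last by rewrite (gt_eqF la0) implybT.
rewrite powR_inv1 ?(ltW la0)//.
have -> : la `^ (- a) = (la `^ a)^-1 by rewrite powRN.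
field; rewrite (gt_eqF la0)/= gt_eqF// powR_gt0//.
Qed.

End gamma_riemann.

(** * Exponential moments of discretized occupation times *)

Section visits.
Context d (T : measurableType d) (R : realType) (P : probability T R).

Lemma probability_ae_eq (A B : set T) : measurable A -> measurable B ->
  {ae P, forall w, A w <-> B w} -> P A = P B.
Proof.
move=> mA mB AB.
have E (C : set T) : measurable C -> P C = (\int[P]_w (\1_C w)%:E)%E.
  by move=> mC; rewrite integral_indic// setIT.
rewrite !E//.
apply: ae_eq_integral => //; try by apply/measurable_EFinP; exact: measurable_indic.
case: AB => N [mN N0 AN]; exists N; split=> // w /= Nw; apply: AN => /= ABw.
apply: Nw => _; congr (_%:E); rewrite !indicE; congr (nat_of_bool _)%:R.
by apply/idP/idP; rewrite !inE => /ABw.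
Qed.

Variables (alpha nu chi : R) (X : R -> {RV P >-> R}).
Hypothesis alpha12 : 1 < alpha <= 2.
Hypothesis chi0 : 0 < chi.
Hypothesis stX : stable_levy_process alpha nu chi X.
Implicit Types (h eps la s y : R).

Let a := alpha^-1.
Let gam := (alpha - 1) / 2.
Let a' := (1 + gam) / alpha.
Let tau := nu * tan (pi * alpha / 2).
(** The density of [X 1] at the origin. *)
Definition stable_density0 : R :=
  pi^-1 * (chi `^ a * (a * Gamma a * (1 + tau ^+ 2) `^ (- (a / 2)) *
    cos (a * atan tau))).
Let q := stable_density0.
(** Up to a numerical factor, a Hoelder constant of the density of [X 1] at the
    origin; it multiplies an error term that vanishes with the size of the target
    interval. *)
Definition density_osc : R := 5 * (pi^-1 * (a * Gamma a') * chi `^ a').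

Let alpha1 : 1 < alpha. Proof. by case/andP: alpha12. Qed.
Let alpha2 : alpha <= 2. Proof. by case/andP: alpha12. Qed.
Let alpha0 : 0 < alpha. Proof. by apply: lt_trans alpha1. Qed.
Let a01 : 0 < a < 1.
Proof. by rewrite /a invr_gt0 alpha0 invf_lt1//. Qed.
Let a'01 : 0 < a' < 1.
Proof.
rewrite /a' divr_gt0 ?alpha0//=; last by rewrite /gam; have := alpha1; lra.
by rewrite ltr_pdivrMr// mul1r /gam; have := alpha1; lra.
Qed.

(** The argument of the cosine has absolute value below [pi / (2 alpha)], hence
    below [pi / 2]. *)
Lemma stable_density0_gt0 : 0 < q.
Proof.
rewrite /q /stable_density0 !mulr_gt0 ?powR_gt0 ?invr_gt0 ?pi_gt0 ?Gamma_gt0//.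
- by have /andP[-> /ltW->] := a01.
- by rewrite ltr_pwDl// sqr_ge0.
apply: cos_gt0_pihalf.
have h1 := atan_ltpi2 tau; have h2 := atan_gtNpi2 tau.
have /andP[a0 a1] := a01; have p0 := @pi_gt0 R.
apply/andP; split.
  apply: (lt_le_trans (_ : _ < a * (- (pi / 2)))); last by rewrite ler_pM2l// ltW.
  by rewrite mulrN ltrN2 gtr_pMl// divr_gt0.
by apply: (lt_trans (_ : _ < a * (pi / 2))); rewrite ?ltr_pM2l// gtr_pMl// divr_gt0.
Qed.

Lemma A1E : A1 alpha nu chi = Gamma (1 - a) * q.
Proof.
rewrite /A1 !div1r -/a -/tau /q /stable_density0 powRN.
rewrite (_ : (2 * alpha)^-1 = a / 2); last by rewrite invfM mulrC.
have p0 := @pi_gt0 R.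
have t0 : 0 < (1 + tau ^+ 2) `^ (a / 2) by rewrite powR_gt0// ltr_pwDl// sqr_ge0.
have [pi0 al0 tt0] : [/\ pi != 0 :> R, alpha != 0 & (1 + tau ^+ 2) `^ (a / 2) != 0].
  by rewrite !lt0r_neq0.
have E (p al t Ga Gb ch co : R) : p != 0 -> al != 0 -> t != 0 ->
    Gb * Ga * ch * co / (p * al * t) = Gb * (p^-1 * (ch * (al^-1 * Ga * t^-1 * co))).
  by move=> p0' al0' t0'; field; rewrite t0' al0' p0'.
exact: E.
Qed.

Let scaleE s (b : R) : 0 < s -> (s / chi) `^ (- b) = s `^ (- b) * chi `^ b.
Proof.
move=> s0; rewrite powRM ?(ltW s0) ?invr_ge0 ?(ltW chi0)//; congr (_ * _).
by rewrite -powR_inv1 ?(ltW chi0)// -powRrM mulrNN mul1r.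
Qed.

(** The marginal at time [s] satisfies the hypotheses of [interval_probability]
    with scale [s / chi], whence the decay [s ^ (- 1 / alpha)]. The Hoelder
    exponent [(alpha - 1) / 2] keeps the decay exponent of the error below one, so
    that the error remains summable near the origin. *)
Lemma visit_probability s eps y : 0 < s -> 0 < eps -> `|y| <= eps ->
  `|fine (P [set w | `[- eps, eps]%classic (y + (X s w - X 0 w))])
     - 2 * eps * (q * s `^ (- a))| <=
  2 * eps * (density_osc * (2 * eps) `^ gam * s `^ (- a')).
Proof.
move=> s0 e0 ye.
have mXs : measurable_fun setT (fun w => y + (X s w - X 0 w)).
  by apply: measurable_funD => //; exact: measurable_funB.
have -> : P [set w | `[- eps, eps]%classic (y + (X s w - X 0 w))] =
    P (X s @^-1` `[- eps - y, eps - y]%classic).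
  apply: probability_ae_eq.
  - by rewrite -[X in d.-measurable X]setTI; apply: mXs.
  - exact: measurable_funPTI.
  - apply: filterS (levy_start (stable_levy stX)) => w X0.
    by rewrite /= X0 subr0 !in_itv/= [y + _]addrC -lerBrDr lerBlDr.
have [al1' al2'] := (alpha1, alpha2).
have g0 : 0 <= gam by rewrite /gam; lra.
have galpha : 1 + gam <= alpha by rewrite /gam; lra.
have g1 : gam <= 1 by rewrite /gam; lra.
have al1 : 1 <= alpha by lra.
have c0 : 0 < s / chi by rewrite divr_gt0.
have yl := ler_norm y; have yl' := ler_norm (- y); rewrite normrN in yl'.
have := @interval_probability _ _ _ P (X s) alpha tau (s / chi) gam al1 c0 g0 galpha g1
  (fun xi => stable_char_fun_cos stX (ltW s0))
  (fun xi => stable_char_fun_sin stX (ltW s0)) (- eps - y) (eps - y) (2 * eps).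
have -> : eps - y - (- eps - y) = 2 * eps by ring.
rewrite !scaleE// -/a' -/a => /(_ _ _ _ _)/andP[].
- lra.
- by rewrite ler_norml; lra.
- by rewrite ler_norml; lra.
- lra.
rewrite /= => h1 h2; rewrite ler_distl; apply/andP; split.
  apply: le_trans h1; rewrite le_eqVlt; apply/orP; left; apply/eqP.
  by rewrite /q /stable_density0 /density_osc -/a; ring.
apply: (le_trans h2); rewrite le_eqVlt; apply/orP; left; apply/eqP.
by rewrite /q /stable_density0 /density_osc -/a; ring.
Qed.

Section mesh.
Variables (h eps c la : R).
Hypotheses (h0 : 0 < h) (eps0 : 0 < eps) (c0 : 0 <= c) (la0 : 0 < la).

Let dlt := density_osc * (2 * eps) `^ gam.
Let sq i := q * (i.+1%:R * h) `^ (- a).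
Let sd i := dlt * (i.+1%:R * h) `^ (- a').
Let bu i := c * (2 * eps * (sq i + sd i)).
(** The lower bound may be negative for small times, and the renewal
    inequality needs nonnegative weights. *)
Let bl i := Num.max 0 (c * (2 * eps * (sq i - sd i))).
Let x := expR (- (la * h)).

Let dlt0 : 0 <= dlt.
Proof.
rewrite /dlt /density_osc !mulr_ge0 ?powR_ge0 ?invr_ge0 ?pi_ge0//.
  exact/ltW/alpha0.
by apply/ltW/Gamma_gt0; have /andP[-> /ltW->] := a'01.
Qed.

Let x01 : 0 < x <= 1.
Proof. by rewrite expR_gt0 -expR0 ler_expR oppr_le0 mulr_ge0 ?(ltW h0) ?(ltW la0). Qed.

Let bl0 i : 0 <= bl i. Proof. by rewrite /bl le_max lexx. Qed.

Let bP i y : `|y| <= eps -> bl i <=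
  c * fine (P [set w | `[- eps, eps]%classic (y + (X (i.+1%:R * h) w - X 0 w))]) <= bu i.
Proof.
move=> ye; have s0 : 0 < i.+1%:R * h by rewrite mulr_gt0.
have := visit_probability s0 eps0 ye; rewrite ler_distl => /andP[p1 p2].
rewrite /bl ge_max mulr_ge0 ?fine_ge0//=; apply/andP; split.
  apply: ler_wpM2l => //; apply: le_trans p1.
  by rewrite -mulrBr lexx.
by apply: ler_wpM2l => //; apply: (le_trans p2); rewrite -mulrDr lexx.
Qed.

Let xi01 (i : nat) : 0 <= x ^+ i.
Proof. by rewrite exprn_ge0// ltW// expR_gt0. Qed.

Let summand (r : R) i : c * (2 * eps * (sq i + r * sd i)) * x ^+ i.+1 =
  c * (2 * eps) / h * (q * (h * ((i.+1%:R * h) `^ (- a) * x ^+ i.+1))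
     + r * (dlt * (h * ((i.+1%:R * h) `^ (- a') * x ^+ i.+1)))).
Proof. by rewrite /sq /sd; field; rewrite gt_eqF. Qed.

Let summandE (r : R) N : \sum_(i < N) c * (2 * eps * (sq i + r * sd i)) * x ^+ i.+1 =
  c * (2 * eps) / h * (q * (la `^ (a - 1) * gamma_sum a (la * h) N)
    + r * (dlt * (la `^ (a' - 1) * gamma_sum a' (la * h) N))).
Proof.
rewrite -!gamma_sum_scale// !mulr_sumr -big_split/= mulr_sumr.
by apply: eq_bigr => i _; rewrite summand.
Qed.

(** The discounted weights of the walk sum up to Riemann sums of Gamma integrals,
    so that the growth rate is controlled by the condition that the corresponding
    Gamma integrals stay below one. *)
Lemma discrete_exp_le (rho : R) : rho < 1 ->
  c * (2 * eps) / h * (q * (la `^ (a - 1) * Gamma (1 - a))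
    + density_osc * (2 * eps) `^ gam * (la `^ (a' - 1) * Gamma (1 - a'))) <= rho ->
  forall N, \int[P]_w (\prod_(j < N)
    (1 + c * \1_(`[- eps, eps]%classic : set R) (X (j.+1%:R * h) w - X 0 w)))
    <= (1 - rho)^-1 * expR (la * (h * N%:R)).
Proof.
move=> rho1 crho N.
have := @walk_exp_le _ _ _ P X h eps c (levy_independent (stable_levy stX))
  (levy_stationary (stable_levy stX)) h0 (ltW eps0) c0 bl bu bl0 bP x rho x01 rho1.
move=> /(_ _ N); set I := Rintegral _ _ _ => E.
have {}E : I * x ^+ N <= (1 - rho)^-1.
  apply: E => M; apply: le_trans crho.
  have := summandE 1 M; under eq_bigr do rewrite mul1r.
  rewrite mul1r => ->; rewrite -/dlt.
  apply: ler_wpM2l; first by rewrite !mulr_ge0// ?invr_ge0 ltW.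
  apply: lerD; apply: ler_wpM2l.
  - exact/ltW/stable_density0_gt0.
  - by rewrite ler_wpM2l ?powR_ge0// gamma_sum_le// mulr_gt0.
  - exact: dlt0.
  - by rewrite ler_wpM2l ?powR_ge0// gamma_sum_le// mulr_gt0.
have -> : expR (la * (h * N%:R)) = (x ^+ N)^-1.
  by rewrite /x -expRM_natl -expRN; congr expR; ring.
by rewrite ler_pdivlMr// exprn_gt0// expR_gt0.
Qed.

Lemma discrete_exp_ge K :
  1 <= c * (2 * eps) / h * (q * (la `^ (a - 1) * gamma_sum a (la * h) K)
    - density_osc * (2 * eps) `^ gam * (la `^ (a' - 1) * Gamma (1 - a'))) ->
  forall N, expR (la * (h * N%:R) - la * (h * K%:R)) <= \int[P]_w (\prod_(j < N)
    (1 + c * \1_(`[- eps, eps]%classic : set R) (X (j.+1%:R * h) w - X 0 w))).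
Proof.
move=> crho N.
have := @walk_exp_ge _ _ _ P X h eps c (levy_independent (stable_levy stX))
  (levy_stationary (stable_levy stX)) h0 (ltW eps0) c0 bl bu bl0 bP x K x01.
move=> /(_ _ N); set I := Rintegral _ _ _ => E.
have {}E : x ^+ K <= I * x ^+ N.
  apply: E; apply: (le_trans crho).
  apply: (@le_trans _ _ (\sum_(i < K) c * (2 * eps * (sq i + -1 * sd i)) * x ^+ i.+1)).
    rewrite summandE mulN1r -/dlt.
    apply: ler_wpM2l; first by rewrite !mulr_ge0// ?invr_ge0 ltW.
    rewrite lerD2l lerN2; apply: ler_wpM2l => //.
    by rewrite ler_wpM2l ?powR_ge0// gamma_sum_le// mulr_gt0.
  apply: ler_sum => i _; rewrite ler_wpM2r//.
  by rewrite /bl le_max mulN1r lexx orbT.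
have -> : expR (la * (h * N%:R) - la * (h * K%:R)) = x ^+ K / x ^+ N.
  by rewrite /x -!expRM_natl -expRN -expRD; congr expR; ring.
by rewrite ler_pdivrMr// exprn_gt0// expR_gt0.
Qed.

End mesh.
End visits.

(** * Local time as a limit of Riemann sums *)

Section riemann_right.
Context {R : realType}.
Notation mu := (@lebesgue_measure R).
Implicit Types (phi x : R -> R) (h s t : R) (k m : nat).

(** The step function that takes on each cell the value at its right end point:
    right continuity suffices for its convergence. *)
Definition right_step phi h m s : R :=
  \sum_(k < m) phi (k.+1%:R * h) * \1_(`[k%:R * h, k.+1%:R * h[%classic : set R) s.

Lemma right_stepE phi h m s : 0 < h -> 0 <= s < m%:R * h ->
  exists r, [/\ s < r <= s + h & right_step phi h m s = phi r].
Proof.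
move=> h0 /andP[s0 sm].
have k1 : (Num.trunc (s / h))%:R * h <= s.
  by rewrite -ler_pdivlMr// truncn_le divr_ge0// ltW.
have k2 : s < (Num.trunc (s / h)).+1%:R * h.
  by rewrite -ltr_pdivrMr// truncnS_gt.
set k := Num.trunc (s / h) in k1 k2.
have km : (k < m)%N by rewrite -(ltr_nat R) -(ltr_pM2r h0) (le_lt_trans k1).
exists (k.+1%:R * h); split.
  by rewrite k2/= -natr1 mulrDl mul1r lerD2r.
rewrite /right_step (bigD1 (Ordinal km))//= big1 ?addr0.
  by rewrite indicE mem_set ?mulr1//= in_itv/= k1.
move=> i ik; rewrite indicE memNset ?mulr0//= in_itv/= => /andP[i1 i2].
have ki : (k < i.+1)%N by rewrite -(ltr_nat R) -(ltr_pM2r h0) (le_lt_trans k1).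
have ik' : (i < k.+1)%N by rewrite -(ltr_nat R) -(ltr_pM2r h0) (le_lt_trans i1).
move/eqP: ik; apply; apply/val_inj => /=; apply/eqP.
by rewrite eqn_leq -ltnS ik'/= -ltnS ki.
Qed.

Lemma measurable_right_step phi h m (D : set R) : measurable_fun D (right_step phi h m).
Proof.
by apply: measurable_sum => k; apply: measurable_funM.
Qed.

Lemma cvg_right_step phi t s (l : R) : 0 <= s < t -> phi u @[u --> s^'+] --> l ->
  right_step phi (t / m.+1%:R) m.+1 s @[m --> \oo] --> l.
Proof.
move=> /andP[s0 st] phil; have t0 := le_lt_trans s0 st.
apply/cvgrPdist_lt => e e0.
have /cvgrPdist_lt/(_ _ e0) := phil.
case=> dl /= dl0 dlP.
have : t / m.+1%:R @[m --> \oo] --> 0.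
  rewrite -(mulr0 t); apply: cvgMr.
  exact: cvg_harmonic.
move=> /cvgrPdist_lt/(_ _ dl0); apply: filterS => m.
rewrite sub0r normrN ger0_norm ?divr_ge0 ?(ltW t0)// => tm.
have [||r [/andP[sr rs] ->]] := @right_stepE phi (t / m.+1%:R) m.+1 s.
- by rewrite divr_gt0.
- by rewrite s0 mulrC divfK.
apply: dlP => //=; rewrite distrC gtr0_norm ?subr_gt0//.
by rewrite ltrBlDl (le_lt_trans rs)// ltrD2l.
Qed.

Section path.
Variable x : R -> R.
Hypothesis xr : forall s, 0 <= s -> x u @[u --> s^'+] --> x s.

Let mx0 t : measurable_fun `[0, t[%classic x.
Proof.
apply: (@measurable_fun_cvg _ _ _ _ (fun m => right_step x (t / m.+1%:R) m.+1)).
  by move=> m; exact: measurable_right_step.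
move=> s; rewrite /= in_itv/= => st; apply: cvg_right_step => //.
by apply: xr; case/andP: st.
Qed.

Lemma right_continuous_measurable t : measurable_fun `[0, t]%classic x.
Proof.
apply: (@measurable_funS _ _ _ _ `[0, t + 1[%classic `[0, t]%classic x);
  [exact: measurable_itv| |exact: mx0].
move=> s; rewrite /= !in_itv/= => /andP[-> /le_lt_trans]; apply.
by rewrite ltrDl.
Qed.

(** By right continuity the indicator of the interval is recovered from the right
    end points of the cells at every time at which the path avoids the two
    boundary points; these times have full measure, and dominated convergence
    applies. *)
Lemma occupation_riemann t eps : 0 < t -> 0 < eps ->
  mu [set s | 0 <= s <= t /\ [set y | `|y| = eps] (x s)] = 0%E ->
  (t / m.+1%:R * \sum_(k < m.+1) \1_(`[- eps, eps]%classic : set R)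
     (x (k.+1%:R * (t / m.+1%:R))))%:E @[m --> \oo] -->
  mu [set s | 0 <= s <= t /\ (`[- eps, eps]%classic : set R) (x s)].
Proof.
move=> t0 e0 mu0; pose J : set R := `[- eps, eps]%classic.
pose D : set R := `[0, t]%classic.
pose D' : set R := `[0, t[%classic.
have mJ : measurable J by exact: measurable_itv.
have mxD := @right_continuous_measurable t.
have mA (B : set R) : measurable B -> measurable [set s | 0 <= s <= t /\ B (x s)].
  move=> mB; have := mxD (measurable_itv _) B mB.
  by congr measurable; apply/seteqP; split=> s /=; rewrite in_itv.
have mxD' : measurable_fun D' (\1_J \o x : R -> R).
  by apply: measurableT_comp => //; exact: mx0.
pose phi := \1_J \o x : R -> R.
have phi0 s : 0 <= phi s by rewrite /phi/=.
have phi1 s : phi s <= 1 by rewrite /phi/= indicE; case: (_ \in _).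
have h0 m : 0 < t / m.+1%:R by rewrite divr_gt0.
have cvg_step s : D' s -> `|x s| != eps ->
    right_step phi (t / m.+1%:R) m.+1 s @[m --> \oo] --> phi s.
  rewrite /D'/= in_itv/= => Ds xe.
  apply: cvg_right_step => //.
  apply: (@cvg_trans _ ((fun=> phi s) @ s^'+)); last exact: cvg_cst.
  apply: near_eq_cvg.
  have := xr (proj1 (andP Ds)).
  move=> /cvgrPdist_lt/(_ `| `|x s| - eps |).
  rewrite normr_gt0 subr_eq0 => /(_ xe); apply: filterS => u xu.
  rewrite /phi/= /J !indicE; congr (nat_of_bool _)%:R.
  apply/idP/idP; rewrite !inE/= !in_itv/= -!ler_norml => xJ.
    rewrite leNgt; apply/negP => xJ'; move: xu; apply/negP; rewrite -leNgt.
    have := ler_dist_dist (x s) (x u); move: xe xJ xJ'.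
    move: `|x s| `|x u| `|x s - x u| => p q z pe pe' qe.
    have {}pe : p < eps by rewrite lt_neqAle pe.
    by rewrite ltr0_norm ?ltr0_norm; lra.
  rewrite leNgt; apply/negP => xJ'; move: xu; apply/negP; rewrite -leNgt.
  have := ler_dist_dist (x s) (x u); move: xJ xJ'.
  move: `|x s| `|x u| `|x s - x u| => p q z pe qe.
  by rewrite gtr0_norm ?gtr0_norm; lra.
have step_le m s : 0 <= right_step phi (t / m.+1%:R) m.+1 s.
  by apply: sumr_ge0 => k _; rewrite mulr_ge0.
have step_int m : (\int[mu]_(s in D') (right_step phi (t / m.+1%:R) m.+1 s)%:E =
    (t / m.+1%:R * \sum_(k < m.+1) \1_J (x (k.+1%:R * (t / m.+1%:R))))%:E)%E.
  under eq_integral do rewrite /right_step -sumEFin.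
  rewrite ge0_integral_sum//; last 3 first.
  - exact: measurable_itv.
  - by move=> k; apply/measurable_EFinP; apply: measurable_funM.
  - by move=> k s _; rewrite lee_fin mulr_ge0.
  rewrite mulr_sumr -sumEFin; apply: eq_bigr => k _.
  under eq_integral do rewrite EFinM.
  rewrite ge0_integralZl_EFin//; last 2 first.
  - exact: measurable_itv.
  - by apply/measurable_EFinP.
  rewrite integral_indic//; last exact: measurable_itv.
  rewrite [RHS]EFinM [RHS]muleC; congr (_ * _)%E.
  rewrite setIidl; last first.
    move=> s; rewrite /D'/= !in_itv/= => /andP[k1 k2]; apply/andP; split.
      by apply: le_trans k1; rewrite mulr_ge0// ltW.
    apply: (lt_le_trans k2); rewrite mulrCA ger_pMr//.
    by rewrite ler_pdivrMr// mul1r ler_nat.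
  transitivity (mu (`[k%:R * (t / m.+1%:R), k.+1%:R * (t / m.+1%:R)[%classic : set R)); first by [].
  rewrite lebesgue_measure_itv/= lte_fin ltr_pM2r// ltr_nat leqnn.
  by rewrite -EFinD -mulrBl -natrB// subSnn mul1r.
have mB : measurable [set s | 0 <= s <= t /\ [set y | `|y| = eps] (x s)].
  apply: mA; rewrite (_ : [set y | _] = [set eps] `|` [set - eps]).
    exact: measurableU.
  apply/seteqP; split=> y /=.
    by move/eqP; rewrite eqr_norml => /andP[/orP[]/eqP -> _]; [left|right].
  by move=> [] ->; rewrite ?normrN gtr0_norm.
have ae_step : {ae mu, forall s, D' s ->
    (EFin \o right_step phi (t / m.+1%:R) m.+1) s @[m --> \oo] --> (EFin \o phi) s}.
  exists [set s | 0 <= s <= t /\ [set y | `|y| = eps] (x s)]; split => //.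
  move=> s /= /not_implyP[Ds nc].
  have := Ds; rewrite /D'/= in_itv/= => /andP[s0 st].
  split; first by rewrite s0 ltW.
  apply: contrapT => /eqP xe; apply: nc; apply: cvg_EFin; first by near=> m0.
  exact: cvg_step.
have ione : mu.-integrable D' (cst 1%E).
  apply/integrableP; split=> //; under eq_integral do rewrite abse1.
  rewrite integral_cst//=; last exact: measurable_itv.
  by rewrite mul1e lebesgue_measure_itv/=; case: ifP => _; rewrite -?EFinD ltry.
have dom : {ae mu, forall s m, D' s ->
    (`|(EFin \o right_step phi (t / m.+1%:R) m.+1) s| <= cst 1 s)%E}.
  apply: aeW => s m; rewrite /D'/= in_itv/= => /andP[s0 st].
  rewrite lee_fin ger0_norm//.
  have [||r [_ ->]] // := @right_stepE phi (t / m.+1%:R) m.+1 s.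
  by rewrite s0 mulrC divfK.
have mD' : measurable D' by exact: measurable_itv.
have mphi : measurable_fun D' (EFin \o phi) by exact/measurable_EFinP.
have mst m : measurable_fun D' (EFin \o right_step phi (t / m.+1%:R) m.+1).
  by apply/measurable_EFinP; exact: measurable_right_step.
have [_ _] := @dominated_convergence _ _ _ mu D' mD'
  (fun m => EFin \o right_step phi (t / m.+1%:R) m.+1) (EFin \o phi) (cst 1%E)
  mst mphi ae_step ione dom.
have -> : (\int[mu]_(s in D') (EFin \o phi) s)%E =
    mu [set s | 0 <= s <= t /\ J (x s)].
  rewrite /D' integral_itv_bndo_bndc; last exact/measurable_EFinP.
  rewrite (_ : mu _ = mu ([set s | 0 <= s <= t /\ J (x s)] `&` D)); last first.
    by congr (mu _); rewrite setIidl// => s /= [+ _]; rewrite /D/= in_itv.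
  rewrite -integral_indic//; [|exact: measurable_itv|exact: mA].
  apply: eq_integral => s; rewrite inE/= in_itv/= => st.
  rewrite /phi/= !indicE; congr (nat_of_bool _)%:R%:E.
  by apply/idP/idP; rewrite !inE/=; [move=> ?; split|case].
apply: cvg_trans; apply: near_eq_cvg; near=> m; exact: step_int.
Unshelve. all: by end_near.
Qed.

End path.
End riemann_right.

Section double_limit.
Context d (T : measurableType d) (R : realType) (P : probability T R).
Variables (A : nat -> nat -> T -> R) (L : T -> R).
Hypothesis mA : forall n m, measurable_fun setT (A n m).
Hypothesis mL : measurable_fun setT L.
Hypothesis cvgA : {ae P, forall w, exists2 B : nat -> R,
  (forall n, A n m w @[m --> \oo] --> B n) & B n @[n --> \oo] --> L w}.
Implicit Types (phi : R -> R) (K C M theta : R).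

(** Dominated convergence, twice. The inner limit is only known to exist almost
    surely and is replaced by an upper limit, which is measurable. *)
Lemma double_limit_bounded phi K : continuous phi -> (forall x, 0 <= phi x <= K) ->
  exists2 e : nat -> \bar R,
    (forall n, \int[P]_w (phi (A n m w))%:E @[m --> \oo] --> e n)%E &
    (e n @[n --> \oo] --> \int[P]_w (phi (L w))%:E)%E.
Proof.
move=> cphi phiK.
have mphi : measurable_fun setT phi by exact: continuous_measurable_fun.
pose F n w := limn_esup (fun m => (phi (A n m w))%:E).
have mphiA n m : measurable_fun setT (fun w => (phi (A n m w))%:E).
  by apply/measurable_EFinP; exact: measurableT_comp.
have mF n : measurable_fun setT (F n).
  exact: (measurable_fun_limn_esup (fun m => mphiA n m)).
have FE : {ae P, forall w, exists2 B : nat -> R,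
    (forall n, (phi (A n m w))%:E @[m --> \oo] --> F n w /\ F n w = (phi (B n))%:E) &
    phi (B n) @[n --> \oo] --> phi (L w)}.
  apply: filterS cvgA => w [B AB BL]; exists B.
    move=> n; have c1 : (phi (A n m w))%:E @[m --> \oo] --> (phi (B n))%:E.
      apply: cvg_EFin; first by near=> m0.
      exact: (cvg_comp _ _ (AB n) (cphi (B n))).
    suff -> : F n w = (phi (B n))%:E by [].
    by rewrite /F (cvg_limn_einf_sup c1).2.
  exact: (cvg_comp _ _ BL (cphi (L w))).
have iK : P.-integrable setT (cst K%:E).
  apply/integrableP; split; first exact: measurable_cst.
  rewrite integral_cst//=; have /= -> := probability_setT P.
  by rewrite mule1 ltry.
exists (fun n => \int[P]_w F n w)%E.
  move=> n.
  have cAn : {ae P, forall w, setT w -> (phi (A n m w))%:E @[m --> \oo] --> F n w}.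
    by apply: filterS FE => w [B /(_ n)[]].
  have bAn : {ae P, forall w m, setT w -> (`|(phi (A n m w))%:E| <= cst K%:E w)%E}.
    apply: aeW => w m _; rewrite lee_fin.
    by have /andP[h1 h2] := phiK (A n m w); rewrite ger0_norm.
  by have [_ _] := @dominated_convergence _ _ _ P setT measurableT
    (fun m w => (phi (A n m w))%:E) (F n) (cst K%:E) (mphiA n) (mF n) cAn iK bAn.
have mphiL : measurable_fun setT (fun w => (phi (L w))%:E).
  by apply/measurable_EFinP; exact: measurableT_comp.
have cF : {ae P, forall w, setT w -> F n w @[n --> \oo] --> (phi (L w))%:E}.
  apply: filterS FE => w [B FB BL] _.
  rewrite (_ : F ^~ w = fun n => (phi (B n))%:E); last by apply/funext => n; rewrite (FB n).2.
  by apply: cvg_EFin => //; near=> m0.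
have bF : {ae P, forall w n, setT w -> (`|F n w| <= cst K%:E w)%E}.
  apply: filterS FE => w [B FB BL] n _.
  by rewrite (FB n).2 lee_fin; have /andP[h1 h2] := phiK (B n); rewrite ger0_norm.
by have [_ _] := @dominated_convergence _ _ _ P setT measurableT
    F (fun w => (phi (L w))%:E) (cst K%:E) mF mphiL cF iK bF.
Unshelve. all: by end_near.
Qed.

Lemma double_limit_le phi K (C : \bar R) : continuous phi -> (forall x, 0 <= phi x <= K) ->
  (\forall n \near \oo, \forall m \near \oo, \int[P]_w (phi (A n m w))%:E <= C)%E ->
  (\int[P]_w (phi (L w))%:E <= C)%E.
Proof.
move=> cphi phiK AC; have [e Ae eL] := double_limit_bounded cphi phiK.
apply: (cvge_le _ eL) => //; apply: filterS AC => n AC.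
exact: (cvge_le AC (Ae n)).
Qed.

Lemma double_limit_ge phi K (C : \bar R) : continuous phi -> (forall x, 0 <= phi x <= K) ->
  (\forall n \near \oo, \forall m \near \oo, C <= \int[P]_w (phi (A n m w))%:E)%E ->
  (C <= \int[P]_w (phi (L w))%:E)%E.
Proof.
move=> cphi phiK AC; have [e Ae eL] := double_limit_bounded cphi phiK.
apply: (cvge_ge _ eL) => //; apply: filterS AC => n AC.
exact: (cvge_ge AC (Ae n)).
Qed.

Let trunc_exp theta M x := expR (theta * Num.min x M).

Let trunc_exp_cont theta M : continuous (trunc_exp theta M).
Proof.
move=> x; apply: (@continuous_comp _ _ _ (fun x => theta * Num.min x M) expR).
  apply: cvgMr; apply: (@continuous_min _ R id (cst M) x) => //.
  exact: cvg_cst.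
exact: continuous_expR.
Qed.

Let trunc_exp_bound theta M x : 0 <= theta -> 0 <= trunc_exp theta M x <= expR (theta * M).
Proof.
by move=> th0; rewrite expR_ge0/= ler_expR ler_wpM2l// ge_min lexx orbT.
Qed.

(** The exponential is unbounded, but its truncations increase to it. *)
Lemma exp_double_limit_le theta C : 0 <= theta ->
  (\forall n \near \oo, \forall m \near \oo,
    \int[P]_w (expR (theta * A n m w))%:E <= C%:E)%E ->
  (\int[P]_w (expR (theta * L w))%:E <= C%:E)%E.
Proof.
move=> th0 AC.
have LM (M : nat) : (\int[P]_w (trunc_exp theta M%:R (L w))%:E <= C%:E)%E.
  apply: (double_limit_le (@trunc_exp_cont theta M%:R)
    (fun x => trunc_exp_bound M%:R x th0)).
  apply: filterS AC => n; apply: filterS => m; apply: le_trans.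
  apply: ge0_le_integral => //.
  - by move=> w _; rewrite lee_fin expR_ge0.
  - apply/measurable_EFinP; apply: measurableT_comp (mA n m).
    exact: continuous_measurable_fun (@trunc_exp_cont theta M%:R).
  - by apply/measurable_EFinP; apply: measurableT_comp => //; exact: measurable_funM.
  - by move=> w _; rewrite lee_fin ler_expR ler_wpM2l// ge_min lexx.
have mt M : measurable_fun setT (fun w => (trunc_exp theta M (L w))%:E).
  apply/measurable_EFinP; apply: measurableT_comp mL.
  exact: continuous_measurable_fun (@trunc_exp_cont theta M).
have t0 (M : nat) w : setT w -> (0 <= (trunc_exp theta M%:R (L w))%:E)%E.
  by move=> _; rewrite lee_fin expR_ge0.
have tmono w : setT w -> {homo (fun M : nat => (trunc_exp theta M%:R (L w))%:E) :
    n m / (n <= m)%N >-> (n <= m)%E}.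
  move=> _ n m nm; rewrite lee_fin ler_expR ler_wpM2l// le_min !ge_min lexx/=.
  by rewrite ler_nat nm orbT.
have := @cvg_monotone_convergence _ _ _ P setT measurableT
  (fun (M : nat) w => (trunc_exp theta M%:R (L w))%:E) (fun M : nat => mt M%:R) t0 tmono.
rewrite (_ : (\int[P]_w _)%E = (\int[P]_w (expR (theta * L w))%:E)%E).
  by apply: (cvge_le); apply: nearW.
apply: eq_integral => w _; apply/cvg_lim => //.
apply: cvg_near_cst; near=> M; congr (expR (theta * _))%:E.
apply/min_idPl; near: M; exact: nbhs_infty_ger.
Unshelve. all: by end_near.
Qed.

(** A lower bound survives the limit when the exponential moments of twice the
    order are bounded, because then the truncation at level [M] loses at most [C
    exp (- theta M)], uniformly. *)
Lemma exp_double_limit_ge theta c C : 0 < theta ->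
  (\forall n \near \oo, \forall m \near \oo,
    c%:E <= \int[P]_w (expR (theta * A n m w))%:E)%E ->
  (\forall n \near \oo, \forall m \near \oo,
    \int[P]_w (expR (2 * theta * A n m w))%:E <= C%:E)%E ->
  (c%:E <= \int[P]_w (expR (theta * L w))%:E)%E.
Proof.
move=> th0 cA AC.
have mexp (f : T -> R) th : measurable_fun setT f ->
    measurable_fun setT (fun w => (expR (th * f w))%:E).
  by move=> mf; apply/measurable_EFinP; apply: measurableT_comp => //; exact: measurable_funM.
have mtr (f : T -> R) M : measurable_fun setT f ->
    measurable_fun setT (fun w => (trunc_exp theta M (f w))%:E).
  move=> mf; apply/measurable_EFinP; apply: measurableT_comp mf.
  exact: continuous_measurable_fun (@trunc_exp_cont theta M).
have trunc_bound M :
    ((c - expR (- (theta * M)) * C)%:E <= \int[P]_w (trunc_exp theta M (L w))%:E)%E.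
  apply: (double_limit_ge (@trunc_exp_cont theta M)
    (fun x => trunc_exp_bound M x (ltW th0))).
  apply: filterS2 cA AC => n; apply: filterS2 => m cA AC.
  rewrite EFinB leeBlDr//; apply: (le_trans cA).
  apply: (@le_trans _ _ (\int[P]_w ((trunc_exp theta M (A n m w))%:E +
      (expR (- (theta * M)))%:E * (expR (2 * theta * A n m w))%:E))%E).
    apply: ge0_le_integral => //.
    - exact: mexp.
    - apply: emeasurable_funD; first exact: mtr.
      by apply: emeasurable_funM => //; exact: mexp.
    - move=> w _; rewrite -EFinM -EFinD lee_fin /trunc_exp -expRD.
      case: (leP (A n m w) M) => AM; first by rewrite lerDl expR_ge0.
      rewrite -[leLHS]add0r lerD ?expR_ge0// ler_expR.
      have : theta * M <= theta * A n m w by rewrite ler_wpM2l// ltW.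
      lra.
  rewrite ge0_integralD//; last 3 first.
  - by move=> w _; rewrite lee_fin expR_ge0.
  - exact: mtr.
  - by apply: emeasurable_funM => //; exact: mexp.
  rewrite ge0_integralZl_EFin ?expR_ge0//; last exact: mexp.
  by rewrite leeD2l// EFinM lee_wpmul2l// lee_fin expR_ge0.
have LM M : (\int[P]_w (trunc_exp theta M (L w))%:E <= \int[P]_w (expR (theta * L w))%:E)%E.
  apply: ge0_le_integral => //.
  - by move=> w _; rewrite lee_fin expR_ge0.
  - exact: mtr.
  - exact: mexp.
  - by move=> w _; rewrite lee_fin ler_expR ler_wpM2l ?(ltW th0)// ge_min lexx.
apply/lee_addgt0Pr => e e0; pose D := `|C| + 1.
have D0 : 0 < D by rewrite ltr_wpDl.
have := le_trans (trunc_bound (- ln (e / D) / theta)) (LM _).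
rewrite [theta * _]mulrC divfK ?gt_eqF// opprK lnK ?posrE ?divr_gt0//.
rewrite EFinB leeBlDr// => /le_trans; apply; rewrite leeD2l// lee_fin.
rewrite -mulrA ger_pMr// mulrC ler_pdivrMr// mul1r.
by rewrite /D (le_trans (ler_norm _))// lerDl.
Qed.

End double_limit.

Section local_time_path.
Context {R : realType}.
Notation mu := (@lebesgue_measure R).
Variables (x : R -> R) (l : R -> R -> R).
Hypothesis xr : forall s, 0 <= s -> x u @[u --> s^'+] --> x s.
Hypothesis density : forall (t : R) (A : set R), 0 <= t -> measurable A ->
  mu [set s | 0 <= s <= t /\ A (x s)] = (\int[mu]_(y in A) (l y t)%:E)%E.
Hypothesis lcont : {within [set p : R * R | 0 <= p.2],
  continuous (fun p : R * R => l p.1 p.2)}.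
Implicit Types (t eps : R) (n m : nat).

Let l_space t : 0 <= t -> continuous (l ^~ t).
Proof.
move=> t0 y; have /subspace_continuousP/(_ (y, t)) := lcont.
move=> /(_ t0) lc; apply: cvg_trans lc.
move=> B /= [[U V] [/= yU tV] UV].
apply: filterS yU => z Uz; apply: (UV (z, t)) => //=.
by split=> //=; exact: nbhs_singleton tV.
Qed.

(** The local time is continuous in space, so that its averages over shrinking
    intervals around the origin converge to its value there. *)
Lemma occupation_average t : 0 < t ->
  (2 * n.+1%:R^-1)^-1 * fine (mu [set s | 0 <= s <= t /\
    (`[- n.+1%:R^-1, n.+1%:R^-1]%classic : set R) (x s)]) @[n --> \oo] --> l 0 t.
Proof.
move=> t0; apply/cvgrPdist_le => e e0.
have lc0 : l u t @[u --> (0 : R)] --> l 0 t by apply: (l_space (ltW t0)).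
move/cvgrPdist_le: lc0 => /(_ e e0)[dl /= dl0 dlP].
have : @GRing.inv R n.+1%:R @[n --> \oo] --> 0 by exact: cvg_harmonic.
move=> /cvgrPdist_lt/(_ dl dl0); apply: filterS => n.
set eps := _^-1; have eps0 : 0 < eps by rewrite invr_gt0.
rewrite sub0r normrN gtr0_norm// => epsd.
pose J : set R := `[- eps, eps]%classic.
have mJ : measurable J by exact: measurable_itv.
rewrite [mu _](density (ltW t0) mJ).
have muJ : mu J = (2 * eps)%:E.
  rewrite /J lebesgue_measure_itv/= lte_fin gtrN// -EFinD; congr (_%:E); ring.
have iJ (c : R) : mu.-integrable J (EFin \o cst c).
  apply: continuous_compact_integrable; first exact: segment_compact.
  by apply: continuous_subspaceT => z; exact: cvg_cst.
have il : mu.-integrable J (EFin \o l ^~ t).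
  apply: continuous_compact_integrable; first exact: segment_compact.
  by apply: continuous_subspaceT => z; apply: l_space (ltW t0) z.
have lJ y : J y -> `|l 0 t - l y t| <= e.
  rewrite /J/= in_itv/= -ler_norml => ye; apply: dlP => /=.
  by rewrite sub0r normrN (le_lt_trans ye).
have E (c : R) : \int[mu]_(y in J) c = c * (2 * eps).
  by rewrite Rintegral_cst// [X in fine X]muJ.
have h1 : (l 0 t - e) * (2 * eps) <= \int[mu]_(y in J) l y t.
  rewrite -E; apply: (@le_Rintegral _ _ _ mu J (cst (l 0 t - e)) (l ^~ t)) => //.
  move=> y Jy /=.
  by have := lJ y Jy; rewrite ler_distlC; lra.
have h2 : \int[mu]_(y in J) l y t <= (l 0 t + e) * (2 * eps).
  rewrite -E; apply: (@le_Rintegral _ _ _ mu J (l ^~ t) (cst (l 0 t + e))) => //.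
  move=> y Jy /=.
  by have := lJ y Jy; rewrite ler_distlC; lra.
rewrite -/(Rintegral mu J (l ^~ t)).
move: h1 h2; set I := Rintegral _ _ _ => h1 h2.
have e2 : 0 < 2 * eps by rewrite mulr_gt0.
rewrite -(@ler_pM2r _ (2 * eps))// -{2}[2 * eps]gtr0_norm// -normrM mulrBl.
rewrite [_^-1 * I]mulrC divfK ?gt_eqF//.
by rewrite ler_norml; lra.
Qed.

(** The occupation measure has a density, hence spends no time at the end points
    of an interval, and [occupation_riemann] applies. *)
Lemma path_local_time t : 0 < t -> exists2 B : nat -> R,
  (forall n, (2 * n.+1%:R^-1)^-1 * (t / m.+1%:R * \sum_(k < m.+1)
      \1_(`[- n.+1%:R^-1, n.+1%:R^-1]%classic : set R) (x (k.+1%:R * (t / m.+1%:R))))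
     @[m --> \oo] --> B n) &
  B n @[n --> \oo] --> l 0 t.
Proof.
move=> t0; eexists; last exact: occupation_average.
move=> n; apply: cvgMr.
have e0 : 0 < n.+1%:R^-1 :> R by rewrite invr_gt0.
set O := mu _; have fO : O \is a fin_num.
  have Ot : (O <= mu (`[0%R, t]%classic : set R))%E.
    by apply: le_outer_measure => s /= [st _]; rewrite in_itv.
  have O0 : (0 <= O)%E by exact: measure_ge0.
  rewrite ge0_fin_numE//; move: Ot; rewrite lebesgue_measure_itv/= lte_fin t0 -EFinD.
  by move=> /le_lt_trans; apply; rewrite ltry.
suff : (t / m.+1%:R * \sum_(k < m.+1)
      \1_(`[- n.+1%:R^-1, n.+1%:R^-1]%classic : set R)
        (x (k.+1%:R * (t / m.+1%:R))))%:E @[m --> \oo] --> O.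
  by rewrite -(fineK fO) => /fine_cvgP[_].
apply: occupation_riemann => //.
set e := n.+1%:R^-1.
have -> : [set y | `|y| = e] = [set e] `|` [set - e].
  apply/seteqP; split=> y /=.
    by move/eqP; rewrite eqr_norml => /andP[/orP[]/eqP -> _]; [left|right].
  by move=> [] ->; rewrite ?normrN gtr0_norm.
have mS : measurable ([set e] `|` [set - e] : set R) by exact: measurableU.
rewrite density ?(ltW t0)//; apply: null_set_integral => //.
  apply/measurable_EFinP/measurable_funTS.
  exact: continuous_measurable_fun (l_space (ltW t0)).
apply/eqP; rewrite eq_le measure_ge0 andbT.
apply: (le_trans (measureU2 _ _ _)) => //.
have /= -> := lebesgue_measure_set1 e; have /= -> := lebesgue_measure_set1 (- e).
by rewrite adde0.
Qed.

End local_time_path.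

Section local_time_limit.
Context d (T : measurableType d) (R : realType) (P : probability T R).
Variables (X : R -> {RV P >-> R}) (L : R -> R -> {RV P >-> R}).
Hypothesis lX : levy_process X.
Hypothesis lL : local_time X L.

(** The Riemann sum with [m + 1] cells for the time spent in [[- eps, eps]] up to
    time [t], divided by [2 eps], with [eps = 1 / (n + 1)]. Subtracting [X 0]
    makes it a function of the increments. *)
Definition occupation_sum (t : R) (n m : nat) (w : T) : R :=
  (2 * n.+1%:R^-1)^-1 * (t / m.+1%:R * \sum_(k < m.+1)
    \1_(`[- n.+1%:R^-1, n.+1%:R^-1]%classic : set R)
      (X (k.+1%:R * (t / m.+1%:R)) w - X 0 w)).

Lemma occupation_sum_cvg t : 0 < t -> {ae P, forall w, exists2 B : nat -> R,
  (forall n, occupation_sum t n m w @[m --> \oo] --> B n) &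
  B n @[n --> \oo] --> L 0 t w}.
Proof.
move=> t0; have := levy_start lX; have := levy_cadlag lX.
have := local_time_density lL; have := local_time_continuous lL.
move=> Lc Ld Xr X0; apply: filterS2 (filterI Lc Ld) (filterI Xr X0) => w.
move=> {Lc Ld Xr X0}[Lc Ld] [[Xr _] X0].
have [B h1 h2] := path_local_time Xr Ld Lc t0.
exists B => // n; rewrite /occupation_sum X0.
by under eq_fun do (under eq_bigr do rewrite subr0); exact: h1.
Qed.

Lemma occupation_sum_ge0 t n m w : 0 <= t -> 0 <= occupation_sum t n m w.
Proof.
move=> t0; rewrite /occupation_sum mulr_ge0 ?invr_ge0 ?mulr_ge0 ?invr_ge0//.
by apply: sumr_ge0.
Qed.

Lemma measurable_occupation_sum t n m : measurable_fun setT (occupation_sum t n m).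
Proof.
apply: measurable_funM => //; apply: measurable_funM => //.
apply: measurable_sum => k; apply: measurableT_comp => //.
exact: measurable_funB.
Qed.

End local_time_limit.

(** * Exponential moments of the local time *)

Section local_time_exp.
Context d (T : measurableType d) (R : realType) (P : probability T R).
Variables (alpha nu chi : R) (X : R -> {RV P >-> R}) (L : R -> R -> {RV P >-> R}).
Hypothesis alpha12 : 1 < alpha <= 2.
Hypothesis chi0 : 0 < chi.
Hypothesis stX : stable_levy_process alpha nu chi X.
Hypothesis lL : local_time X L.
Implicit Types (t theta la rho eps h kappa : R) (n m : nat).

Let a := alpha^-1.
Let gam := (alpha - 1) / 2.
Let a' := (1 + gam) / alpha.
Let q := stable_density0 alpha nu chi.
Let osc n := density_osc alpha chi * (2 * n.+1%:R^-1) `^ gam.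
Let rest la := la `^ (a' - 1) * Gamma (1 - a').

Let a01 : 0 < a < 1.
Proof. by case/andP: alpha12 => h1 h2; rewrite /a invr_gt0 invf_lt1 ?h1//; lra. Qed.

Let a'01 : 0 < a' < 1.
Proof.
case/andP: alpha12 => h1 h2; have h0 : 0 < alpha by lra.
rewrite /a' divr_gt0//=; last by rewrite /gam; lra.
by rewrite ltr_pdivrMr// mul1r /gam; lra.
Qed.

Let osc_cvg0 : osc n @[n --> \oo] --> 0.
Proof.
have gam0 : 0 < gam by rewrite /gam; case/andP: alpha12; lra.
rewrite -(mulr0 (density_osc alpha chi)); apply: cvgMr.
have h0 : 2 * n.+1%:R^-1 @[n --> \oo] --> (0 : R).
  by rewrite -(mulr0 2); apply: cvgMr; exact: cvg_harmonic.
apply: (@cvg_comp _ _ _ (fun n => 2 * n.+1%:R^-1) (fun x : R => x `^ gam) _ (0^'+)); last first.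
  exact: powR_cvg0.
move=> B [e /= e0 eB].
move/cvgrPdist_lt: h0 => /(_ e e0).
apply: filterS => n hn; exact: eB.
Qed.

(** The exponential of a multiple of an indicator is affine in the indicator;
    this is its slope. *)
Let gain theta eps h := expR (theta * h / (2 * eps)) - 1.

Let gain_bounds theta eps h : 0 < theta -> 0 < eps -> 0 < h ->
  theta <= gain theta eps h * (2 * eps) / h <= theta * expR (theta * h / (2 * eps)).
Proof.
move=> th0 e0 h0; rewrite /gain; set u := theta * h / (2 * eps).
have u0 : 0 < u by rewrite divr_gt0 ?mulr_gt0.
have E : (expR u - 1) * (2 * eps) / h = theta * ((expR u - 1) / u).
  by rewrite /u; field; rewrite !gt_eqF.
apply/andP; split.
  rewrite [leRHS]E ler_pMr// ler_pdivlMr// mul1r.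
  by have := expR_ge1Dx u; move: (expR u) => E'; lra.
rewrite [leLHS]E ler_pM2l// ler_pdivrMr//.
have := expR_ge1Dx (- u); rewrite expRN.
have := expR_gt0 u; move: (expR u) => E' E0.
by rewrite -(ler_pM2l E0) divff ?gt_eqF//; lra.
Qed.

Let occupation_expE theta t n m w :
  expR (theta * occupation_sum X t n m w) =
  \prod_(j < m.+1) (1 + gain theta n.+1%:R^-1 (t / m.+1%:R) *
    \1_(`[- n.+1%:R^-1, n.+1%:R^-1]%classic : set R)
      (X (j.+1%:R * (t / m.+1%:R)) w - X 0 w)).
Proof.
rewrite /occupation_sum !mulr_sumr expR_sum; apply: eq_bigr => k _.
rewrite indicE; case: (_ \in _); rewrite ?mulr0 ?expR0 ?addr0// !mulr1 /gain.
by rewrite addrC subrK; congr expR; ring.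
Qed.

Let measurable_exp theta t n m :
  measurable_fun setT (fun w => expR (theta * occupation_sum X t n m w)).
Proof.
apply: measurableT_comp => //; apply: measurable_funM => //.
exact: measurable_occupation_sum.
Qed.

Let integrable_exp theta t n m : 0 < theta -> 0 < t ->
  P.-integrable setT (EFin \o (fun w => expR (theta * occupation_sum X t n m w))).
Proof.
move=> th0 t0; apply: measurable_bounded_integrable => //.
  by rewrite -ge0_fin_numE// fin_num_measure.
exists (expR (theta * ((2 * n.+1%:R^-1)^-1 * (t / m.+1%:R * m.+1%:R)))).
split; first exact: num_real.
move=> y My w _ /=; rewrite ger0_norm ?expR_ge0//; apply: le_trans (ltW My).
rewrite ler_expR !ler_wpM2l ?(ltW th0) ?invr_ge0 ?divr_ge0 ?(ltW t0)//.
rewrite -[leRHS]mulr1 -[m.+1 in leRHS]card_ord -sum1_card natr_sum mulr_suml.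
by apply: ler_sum => k _; rewrite mul1r indicE; case: (_ \in _).
Qed.

Let mesh_cvg0 (u t : R) : u * (t / m.+1%:R) @[m --> \oo] --> 0.
Proof.
rewrite -(mulr0 u); apply: cvgMr; rewrite -(mulr0 t); apply: cvgMr.
exact: cvg_harmonic.
Qed.

(** The gain per visit is equivalent to [theta h / (2 eps)] when the mesh tends to
    zero, and the Hoelder error vanishes with [eps]; both errors are absorbed by
    the strict inequality. *)
Lemma occupation_exp_le theta t la rho : 0 < theta -> 0 < t -> 0 < la -> rho < 1 ->
  theta * (q * (la `^ (a - 1) * Gamma (1 - a))) < rho ->
  (\forall n \near \oo, \forall m \near \oo,
    \int[P]_w (expR (theta * occupation_sum X t n m w))%:E <=
      ((1 - rho)^-1 * expR (la * t))%:E)%E.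
Proof.
move=> th0 t0 la0 rho1 main.
have : theta * (q * (la `^ (a - 1) * Gamma (1 - a)) + osc n * rest la) @[n --> \oo] -->
    theta * (q * (la `^ (a - 1) * Gamma (1 - a)) + 0 * rest la).
  by apply: cvgMr; apply: cvgD; [exact: cvg_cst|by apply: cvgM => //; exact: cvg_cst].
rewrite mul0r addr0 => /cvgr_lt/(_ rho main).
apply: filterS => n Qn; pose eps : R := n.+1%:R^-1.
have eps0 : 0 < eps by rewrite invr_gt0.
set Q := _ + _ in Qn.
have : theta * Q * expR (theta / (2 * eps) * (t / m.+1%:R)) @[m --> \oo] --> theta * Q * expR 0.
  apply: cvgMr; apply: (cvg_comp _ _ (mesh_cvg0 _ _)); exact: continuous_expR.
rewrite expR0 mulr1 => /cvgr_lt/(_ rho Qn).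
apply: filterS => m Qm; pose h := t / m.+1%:R.
have h0 : 0 < h by rewrite divr_gt0.
have /andP[g1 g2] := gain_bounds th0 eps0 h0.
have g0 : 0 <= gain theta eps h.
  by rewrite /gain subr_ge0 -expR0 ler_expR !mulr_ge0 ?invr_ge0 ?mulr_ge0 ?ltW.
have Q0 : 0 <= Q.
  rewrite /Q addr_ge0// mulr_ge0//.
  - exact/ltW/stable_density0_gt0.
  - by rewrite mulr_ge0 ?powR_ge0// ltW// Gamma_gt0//; have := a01; lra.
  - rewrite /osc mulr_ge0 ?powR_ge0// /density_osc !mulr_ge0 ?powR_ge0 ?invr_ge0 ?pi_ge0//.
      by case/andP: alpha12; lra.
    by rewrite ltW// Gamma_gt0//; have := a'01; rewrite /a' /gam; lra.
  - by rewrite /rest mulr_ge0 ?powR_ge0// ltW// Gamma_gt0//; have := a'01; lra.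
have := @discrete_exp_le _ _ _ P alpha nu chi X alpha12 chi0 stX h eps (gain theta eps h) la
  h0 eps0 g0 la0 rho rho1.
move=> /(_ _ m.+1); rewrite -/a -/gam -/a' -/(rest la) -/q -/(osc n) -/Q.
have -> : h * m.+1%:R = t by rewrite /h divfK.
under eq_Rintegral do rewrite -occupation_expE.
move=> D; rewrite -(fineK (integrable_fin_num _ (integrable_exp n m th0 t0)))//.
rewrite lee_fin; apply: D; apply: le_trans (ltW Qm).
rewrite [leRHS]mulrAC; apply: ler_wpM2r => //.
by apply: (le_trans g2); rewrite mulrAC.
Qed.

(** The number [K] of steps over which the discounted weights must reach one is
    chosen so that [la h K] is about [s0]: the constant [exp (- s0)] that is lost
    does not depend on the mesh, nor on [t] and [theta]. *)
Lemma occupation_exp_ge theta t la eta0 s0 kappa : 0 < theta -> 0 < t -> 0 < la ->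
  0 < eta0 -> 0 < s0 ->
  (forall eta N, 0 < eta <= eta0 -> s0 <= eta * N.+1%:R ->
      Gamma (1 - a) - kappa <= gamma_sum a eta N) ->
  1 < theta * (q * (la `^ (a - 1) * (Gamma (1 - a) - kappa))) ->
  (\forall n \near \oo, \forall m \near \oo,
    (expR (la * t - s0))%:E <=
    \int[P]_w (expR (theta * occupation_sum X t n m w))%:E)%E.
Proof.
move=> th0 t0 la0 eta00 s00 gsum main.
have : theta * (q * (la `^ (a - 1) * (Gamma (1 - a) - kappa)) - osc n * rest la) @[n --> \oo] -->
    theta * (q * (la `^ (a - 1) * (Gamma (1 - a) - kappa)) - 0 * rest la).
  by apply: cvgMr; apply: cvgB; [exact: cvg_cst|by apply: cvgM => //; exact: cvg_cst].
rewrite mul0r subr0 => /cvgr_gt/(_ 1 main).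
apply: filterS => n Qn; pose eps : R := n.+1%:R^-1.
have eps0 : 0 < eps by rewrite invr_gt0.
have := mesh_cvg0 la t.
move=> /cvgr_lt/(_ eta0 eta00).
apply: filterS => m lam; pose h := t / m.+1%:R.
have h0 : 0 < h by rewrite divr_gt0.
have /andP[g1 g2] := gain_bounds th0 eps0 h0.
have g0 : 0 <= gain theta eps h.
  by rewrite /gain subr_ge0 -expR0 ler_expR !mulr_ge0 ?invr_ge0 ?mulr_ge0 ?ltW.
have lah0 : 0 < la * h by rewrite mulr_gt0.
pose K := Num.trunc (s0 / (la * h)).
have K1 : la * h * K%:R <= s0.
  by rewrite mulrC -ler_pdivlMr// truncn_le divr_ge0// ltW.
have K2 : s0 <= la * h * K.+1%:R.
  by rewrite mulrC -ler_pdivrMr// ltW// truncnS_gt.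
have q0 : 0 < q := stable_density0_gt0 nu alpha12 chi0.
have sK := gsum (la * h) K _ K2.
have := @discrete_exp_ge _ _ _ P alpha nu chi X alpha12 chi0 stX h eps (gain theta eps h) la
  h0 eps0 g0 la0 K.
move=> /(_ _ m.+1); rewrite -/a -/gam -/a' -/(rest la) -/q -/(osc n).
have -> : h * m.+1%:R = t by rewrite /h divfK.
under eq_Rintegral do rewrite -occupation_expE.
move=> D; rewrite -(fineK (integrable_fin_num _ (integrable_exp n m th0 t0)))//.
rewrite lee_fin; apply: le_trans (D _).
  by rewrite ler_expR lerD2l lerN2 mulrA.
apply: (le_trans (ltW Qn)).
have Qle : q * (la `^ (a - 1) * (Gamma (1 - a) - kappa)) - osc n * rest la <=
   q * (la `^ (a - 1) * gamma_sum a (la * h) K) - osc n * rest la.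
  rewrite lerD2r ler_pM2l// ler_wpM2l ?powR_ge0// sK//.
  by rewrite lah0 ltW.
apply: (@le_trans _ _ (theta * (q * (la `^ (a - 1) * gamma_sum a (la * h) K) - osc n * rest la))).
  by rewrite ler_pM2l.
apply: ler_wpM2r => //; apply: le_trans Qle.
by rewrite -(ler_pM2l th0) mulr0 ltW// (lt_trans _ Qn).
Qed.

End local_time_exp.

Section local_time_moments.
Context d (T : measurableType d) (R : realType) (P : probability T R).
Variables (alpha nu chi : R) (X : R -> {RV P >-> R}) (L : R -> R -> {RV P >-> R}).
Hypothesis alpha12 : 1 < alpha <= 2.
Hypothesis chi0 : 0 < chi.
Hypothesis stX : stable_levy_process alpha nu chi X.
Hypothesis lL : local_time X L.
Implicit Types (t theta la rho eps h kappa delta : R) (n m : nat).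

Let a := alpha^-1.
Let q := stable_density0 alpha nu chi.
Let b := alpha / (alpha - 1).

Lemma A1_gt0 : 0 < A1 alpha nu chi.
Proof.
rewrite A1E// mulr_gt0 ?stable_density0_gt0// Gamma_gt0//.
case/andP: alpha12 => h1 h2; have : 0 < alpha^-1 < 1.
  by rewrite invr_gt0 invf_lt1//; lra.
lra.
Qed.

Let main_term theta la : theta * (q * (la `^ (a - 1) * Gamma (1 - a))) =
  theta * A1 alpha nu chi * la `^ (a - 1).
Proof. by rewrite A1E// -/q -/a; ring. Qed.

(** The rate [x ^ b] is the root of [x * la ^ (a - 1) = 1]. *)
Let rateK (x : R) : 0 < x -> (x `^ b) `^ (a - 1) = x^-1.
Proof.
move=> x0; rewrite -powRrM (_ : b * (a - 1) = -1) ?powR_inv1 ?(ltW x0)//.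
rewrite /b /a; case/andP: alpha12 => h1 h2; field.
by apply/andP; split; rewrite gt_eqF; lra.
Qed.

Let occupation_exp_rate delta theta t : 0 < delta -> 0 < theta -> 0 < t ->
  (\forall n \near \oo, \forall m \near \oo,
    \int[P]_w (expR (theta * occupation_sum X t n m w))%:E <=
    (((1 - (1 + delta / 2)^-1)^-1) *
      expR (t * ((1 + delta) * (theta * A1 alpha nu chi)) `^ b))%:E)%E.
Proof.
move=> d0 th0 t0; rewrite [t * _]mulrC.
have d1 : 0 < 1 + delta by lra.
have x0 : 0 < theta * A1 alpha nu chi by rewrite mulr_gt0// A1_gt0.
have la0 : 0 < (1 + delta) * (theta * A1 alpha nu chi) by rewrite mulr_gt0.
apply: (occupation_exp_le alpha12 chi0 stX th0 t0).
- by rewrite powR_gt0.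
- by rewrite invf_lt1; lra.
rewrite -/a -/q main_term rateK//; move: x0.
move: (theta * _) => x x0; rewrite invfM mulrC divfK ?gt_eqF//.
by rewrite ltf_pV2 ?posrE; lra.
Qed.

(** The constant does not depend on [theta] and [t]. This uniformity replaces the
    self-similarity of the local time when [theta] grows with [t]. *)
Lemma local_time_exp_le delta : 0 < delta -> exists2 C, 0 < C &
  forall theta t, 0 < theta -> 0 < t ->
  (\int[P]_w (expR (theta * L 0 t w))%:E <=
    (C * expR (t * ((1 + delta) * (theta * A1 alpha nu chi)) `^ b))%:E)%E.
Proof.
move=> d0; exists ((1 - (1 + delta / 2)^-1)^-1).
  by rewrite invr_gt0 subr_gt0 invf_lt1; lra.
move=> theta t th0 t0.
apply: (exp_double_limit_le (A := occupation_sum X t)).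
- by move=> n m; exact: measurable_occupation_sum.
- by [].
- exact: (occupation_sum_cvg (stable_levy stX) lL t0).
- exact: ltW.
- exact: occupation_exp_rate.
Qed.

(** The lower bound passes to the limit thanks to the upper bound at [2 * theta]. *)
Lemma local_time_exp_ge delta : 0 < delta < 1 -> exists2 c, 0 < c &
  forall theta t, 0 < theta -> 0 < t ->
  ((c * expR (t * ((1 - delta) * (theta * A1 alpha nu chi)) `^ b))%:E <=
    \int[P]_w (expR (theta * L 0 t w))%:E)%E.
Proof.
move=> /andP[d0 d1].
have a01 : 0 < a < 1.
  by case/andP: alpha12 => h1 h2; rewrite /a invr_gt0 invf_lt1 ?h1//; lra.
have G0 : 0 < Gamma (1 - a) by rewrite Gamma_gt0//; lra.
have k0 : 0 < delta / 2 * Gamma (1 - a) by rewrite !mulr_gt0.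
have [eta0 [s0 [eta00 s00 gsum]]] := gamma_sum_near a01 k0.
exists (expR (- s0)); first exact: expR_gt0.
move=> theta t th0 t0; set la := (_ * _) `^ b.
have tA0 : 0 < (1 - delta) * (theta * A1 alpha nu chi).
  by rewrite mulr_gt0 ?subr_gt0// mulr_gt0// A1_gt0.
have la0 : 0 < la by rewrite powR_gt0.
have -> : expR (- s0) * expR (t * la) = expR (la * t - s0).
  by rewrite -expRD; congr expR; ring.
have main : 1 < theta * (q * (la `^ (a - 1) * (Gamma (1 - a) - delta / 2 * Gamma (1 - a)))).
  have -> : theta * (q * (la `^ (a - 1) * (Gamma (1 - a) - delta / 2 * Gamma (1 - a)))) =
      theta * (q * (la `^ (a - 1) * Gamma (1 - a))) * (1 - delta / 2) by ring.
  rewrite main_term /la rateK//.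
  have : 0 < theta * A1 alpha nu chi by rewrite mulr_gt0// A1_gt0.
  move: (theta * _) => x x0; rewrite invfM [x * _]mulrC divfK ?gt_eqF//.
  by rewrite mulrC ltr_pdivlMr ?mul1r; lra.
apply: (exp_double_limit_ge (A := occupation_sum X t)).
- by move=> n m; exact: measurable_occupation_sum.
- by [].
- exact: (occupation_sum_cvg (stable_levy stX) lL t0).
- exact: th0.
- exact: (occupation_exp_ge alpha12 chi0 stX th0 t0 la0 eta00 s00 gsum main).
- by apply: (occupation_exp_rate (delta := 1)) => //; rewrite mulr_gt0.
Qed.

End local_time_moments.

(** * Gaussian marginals of fractional Brownian motion *)

Section normal_moments.
Context {R : realType}.
Notation mu := (@lebesgue_measure R).
Variables (m s : R).
Hypothesis s0 : s != 0.
Implicit Types (x : R) (f F : R -> R).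

Let E x : R := expR (- (x - m) ^+ 2 / (s ^+ 2 *+ 2)).

Let pdfE x : normal_pdf m s x = normal_peak s * E x.
Proof. by rewrite normal_pdfE. Qed.

Let s20 : 0 < s ^+ 2. Proof. by rewrite exprn_even_gt0. Qed.

(** The quadratic factor costs half of the exponent, which leaves a normal
    density of twice the variance. *)
Let E_le x : (x - m) ^+ 2 * E x <=
  4 * s ^+ 2 * expR (- (x - m) ^+ 2 / ((Num.sqrt 2 * s) ^+ 2 *+ 2)).
Proof.
rewrite /E exprMn sqr_sqrtr//; set u := (x - m) ^+ 2 / (4 * s ^+ 2).
have s2n : s ^+ 2 != 0 by rewrite gt_eqF.
have -> : - (x - m) ^+ 2 / (s ^+ 2 *+ 2) = - u - u by rewrite /u; field.
have -> : - (x - m) ^+ 2 / (2 * s ^+ 2 *+ 2) = - u by rewrite /u; field.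
have -> : (x - m) ^+ 2 = 4 * s ^+ 2 * u by rewrite /u; field.
rewrite expRD (_ : 4 * s ^+ 2 * u * (expR (- u) * expR (- u)) =
  4 * s ^+ 2 * (u * expR (- u) * expR (- u))); last by ring.
rewrite ler_pM2l; last by rewrite mulr_gt0.
rewrite ler_piMl ?expR_ge0//.
rewrite expRN ler_pdivrMr ?expR_gt0// mul1r.
by apply: le_trans (expR_ge1Dx u); rewrite lerDr.
Qed.

Let mE : measurable_fun setT E.
Proof. exact: measurable_normal_fun. Qed.

Lemma integrable_normal_sqr :
  mu.-integrable setT (EFin \o (fun x => (x - m) ^+ 2 * normal_pdf m s x)).
Proof.
have s'0 : Num.sqrt 2 * s != 0 by rewrite mulf_neq0// gt_eqF// sqrtr_gt0.
pose C := 4 * s ^+ 2 * normal_peak s / normal_peak (Num.sqrt 2 * s).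
have iC : mu.-integrable setT (fun x => (C%:E * (normal_pdf m (Num.sqrt 2 * s) x)%:E)%E).
  by apply: integrableZl => //; exact: integrable_normal_pdf.
apply: le_integrable iC => //.
  apply/measurable_EFinP; apply: measurable_funM; last exact: measurable_normal_pdf.
  by apply: measurable_funX; exact: measurable_funB.
move=> x _ /=; rewrite lee_fin ger0_norm; last first.
  by rewrite mulr_ge0 ?sqr_ge0 ?normal_pdf_ge0.
apply: le_trans (ler_norm _); rewrite pdfE normal_pdfE//= /C.
rewrite mulrA [leRHS]mulrA divfK ?gt_eqF ?normal_peak_gt0//.
rewrite mulrAC [leRHS]mulrAC ler_pM2r ?normal_peak_gt0//; exact: E_le.
Qed.

Lemma integrable_normal_id :
  mu.-integrable setT (EFin \o (fun x => (x - m) * normal_pdf m s x)).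
Proof.
have := integrableD measurableT (@integrable_normal_pdf R m s) integrable_normal_sqr.
apply: le_integrable => //.
  apply/measurable_EFinP; apply: measurable_funM; last exact: measurable_normal_pdf.
  exact: measurable_funB.
move=> x _ /=; rewrite lee_fin.
apply: le_trans (ler_norm _); rewrite normrM [X in _ * X]ger0_norm ?normal_pdf_ge0//.
rewrite -[X in _ <= X + _]mul1r -mulrDl ler_wpM2r ?normal_pdf_ge0//.
rewrite -[X in _ <= 1 + X]ger0_norm ?sqr_ge0// normrX.
by have := sqr_ge0 (`|x - m| - 1); move: `|x - m| => y; nra.
Qed.

Let dE x : is_derive x 1 E (- ((x - m) / s ^+ 2) * E x).
Proof.
have h : is_derive x 1 (fun x => - (x - m) ^+ 2 / (s ^+ 2 *+ 2)) (- ((x - m) / s ^+ 2)).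
  by apply: is_derive_eq; rewrite /GRing.scale/=; field.
by apply: (is_derive_comp_eq (f := expR) (is_derive_expR _) h); rewrite mulrC.
Qed.

(** The fundamental theorem of calculus on growing intervals centred at [m]; only
    the difference of the end point values has to vanish. *)
Let FTC_line f F : continuous f -> mu.-integrable setT (EFin \o f) ->
  (forall x, is_derive x 1 F (f x)) ->
  F (m + n.+1%:R) - F (m - n.+1%:R) @[n --> \oo] --> 0 ->
  \int[mu]_x f x = 0.
Proof.
move=> cf intf dF F0.
pose I n : set R := [set` `[m - n.+1%:R, m + n.+1%:R]].
have mI n : measurable (I n) by exact: measurable_itv.
have lt2 n : m - n.+1%:R < m + n.+1%:R by rewrite ltrD2l gtrN.
have FTC n : (\int[mu]_(x in I n) (f x)%:E = (F (m + n.+1%:R) - F (m - n.+1%:R))%:E)%E.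
  rewrite EFinB; apply: continuous_FTC2 => //.
  - exact: continuous_subspaceT.
  - split.
    + by move=> x _; have [] := dF x.
    + by apply: cvg_at_right_filter; exact: is_derive_continuous (dF _).
    + by apply: cvg_at_left_filter; exact: is_derive_continuous (dF _).
  - by move=> x xI; rewrite derive1E; have h := dF x; rewrite derive_val.
have mf : measurable_fun setT (EFin \o f).
  by apply/measurable_EFinP; exact: continuous_measurable_fun.
have cvg1 : (\int[mu]_(x in I n) (f x)%:E @[n --> \oo] --> \int[mu]_x (f x)%:E)%E.
  have mfI n : measurable_fun setT ((EFin \o f) \_ (I n)).
    by apply/(measurable_restrictT _ (mI n)); apply: measurable_funS mf.
  have cfI : {ae mu, forall x, setT x -> ((EFin \o f) \_ (I n)) x @[n --> \oo] --> (EFin \o f) x}.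
    apply: aeW => x _; apply: cvg_near_cst; near=> n.
    rewrite patchE ifT// inE /I/= in_itv/= -ler_distl.
    rewrite (@le_trans _ _ n%:R)// ?ler_nat ?leqW//.
    by near: n; exact: nbhs_infty_ger.
  have bfI : {ae mu, forall x n, setT x ->
      (`|((EFin \o f) \_ (I n)) x| <= (abse \o (EFin \o f)) x)%E}.
    by apply: aeW => x n _; rewrite patchE; case: ifPn => _ //=; rewrite normr0 lee_fin.
  have [_ _] := @dominated_convergence _ _ R mu setT measurableT
    (fun n => (EFin \o f) \_ (I n)) (EFin \o f) (abse \o (EFin \o f)) mfI mf cfI
    (integrable_abse intf) bfI.
  apply: cvg_trans; apply: near_eq_cvg; near=> n.
  by rewrite [RHS]integral_mkcond.
have cvg2 : (\int[mu]_(x in I n) (f x)%:E @[n --> \oo] --> 0%:E)%E.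
  rewrite (_ : (fun n => _) = EFin \o (fun n => F (m + n.+1%:R) - F (m - n.+1%:R))).
    by apply: cvg_EFin => //; near=> n.
  by apply/funext => n; rewrite FTC.
by rewrite /Rintegral (cvg_unique _ cvg1 cvg2).
Unshelve. all: by end_near.
Qed.

Let cE : continuous E.
Proof. by move=> x; exact: is_derive_continuous (dE x). Qed.

Lemma normal_mean : \int[mu]_x ((x - m) * normal_pdf m s x) = 0.
Proof.
apply: (@FTC_line _ (fun x => - s ^+ 2 * normal_peak s * E x)).
- move=> x; apply: cvgM; last exact: continuous_normal_pdf.
  by apply: cvgB => //; exact: cvg_cst.
- exact: integrable_normal_id.
- move=> x; have := dE x => dEx; apply: is_derive_eq.
  by rewrite /GRing.scale/= pdfE; field.
rewrite (_ : (fun n => _) = cst 0); first exact: cvg_cst.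
apply/funext => n; rewrite /E.
have -> : (m + n.+1%:R - m) ^+ 2 = (m - n.+1%:R - m) ^+ 2 by ring.
by rewrite subrr.
Qed.

Lemma normal_variance : \int[mu]_x ((x - m) ^+ 2 * normal_pdf m s x) = s ^+ 2.
Proof.
have i1 := integrable_normal_sqr.
have i2 : mu.-integrable setT (EFin \o (fun x => s ^+ 2 * normal_pdf m s x)).
  exact: (integrableZl measurableT (s ^+ 2) (@integrable_normal_pdf R m s)).
suff : \int[mu]_x ((x - m) ^+ 2 * normal_pdf m s x - s ^+ 2 * normal_pdf m s x) = 0.
  rewrite RintegralB// RintegralZl//; last exact: integrable_normal_pdf.
  by rewrite [X in _ * X]/Rintegral integral_normal_pdf mulr1 => /eqP; rewrite subr_eq0 => /eqP.
apply: (@FTC_line _ (fun x => - s ^+ 2 * normal_peak s * ((x - m) * E x))).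
- move=> x; apply: cvgB; (apply: cvgM; last exact: continuous_normal_pdf).
    by apply: (@continuous_comp _ _ _ (fun x => x - m) (fun x => x ^+ 2));
      [apply: cvgB => //; exact: cvg_cst|exact: exprn_continuous].
  exact: cvg_cst.
- exact: (integrableB measurableT i1 i2).
- move=> x; have := dE x => dEx; apply: is_derive_eq.
  by rewrite /GRing.scale/= pdfE; field.
pose K := 2 * s ^+ 2 * normal_peak s.
have K0 : 0 < K by rewrite /K mulr_gt0 ?normal_peak_gt0// mulr_gt0.
have lim : - (K * (2 * s ^+ 2)) * n.+1%:R^-1 @[n --> \oo] --> (0 : R).
  by rewrite -(mulr0 (- (K * (2 * s ^+ 2)))); apply: cvgMr; exact: cvg_harmonic.
apply: (squeeze_cvgr _ lim (cvg_cst 0)).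
apply: nearW => n; set N : R := n.+1%:R; have N0 : 0 < N by [].
pose e := expR (- (N ^+ 2 / (2 * s ^+ 2))).
have e0 : 0 < e := expR_gt0 _.
have EN1 : E (m + N) = e by rewrite /E /e; congr expR; field.
have EN2 : E (m - N) = e by rewrite /E /e; congr expR; field.
rewrite EN1 EN2.
have -> : - s ^+ 2 * normal_peak s * ((m + N - m) * e) -
    - s ^+ 2 * normal_peak s * ((m - N - m) * e) = - (K * (N * e)) by rewrite /K; ring.
have ye : N * e <= 2 * s ^+ 2 * N^-1.
  have := expR_ge1Dx (N ^+ 2 / (2 * s ^+ 2)).
  rewrite -(ler_pM2r e0) /e -expRD subrr expR0 mulrDl mul1r => h.
  have {}h : N ^+ 2 / (2 * s ^+ 2) * e <= 1 by move: h; rewrite -/e; lra.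
  rewrite ler_pdivlMr// -/e.
  have -> : N * e * N = N ^+ 2 / (2 * s ^+ 2) * e * (2 * s ^+ 2) by field; rewrite s0.
  by rewrite ler_piMl// ltW// mulr_gt0.
apply/andP; split; first by rewrite mulNr lerN2 -[leRHS]mulrA (ler_wpM2l (ltW K0)).
rewrite oppr_le0.
by apply: mulr_ge0; [exact: ltW|apply: mulr_ge0; exact: ltW].
Qed.

End normal_moments.

Section normal_law.
Context d (T : measurableType d) (R : realType) (P : probability T R).
Notation mu := (@lebesgue_measure R).
Variable Y : {RV P >-> R}.
Implicit Types (m s a delta : R) (f : R -> R).

(** The normal probability is defined by its density, and the change of variables
    goes through its Radon-Nikodym derivative. *)
Lemma normal_expectation m s f : s != 0 ->
  (forall B : set R, measurable B -> P (Y @^-1` B) = normal_prob m s B) ->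
  measurable_fun setT f -> P.-integrable setT (EFin \o (f \o Y)) ->
  (\int[P]_w (f (Y w))%:E = \int[mu]_x (f x * normal_pdf m s x)%:E)%E.
Proof.
move=> s0 law mf iF.
have mY0 : measurable_fun setT Y by [].
have mY : @measurable_fun _ _ T (measurableTypeR R) setT Y := mY0.
pose Y' : {RV P >-> measurableTypeR R} :=
  @mfun_Sub _ _ T (measurableTypeR R) Y (mem_set mY).
have mEf : measurable_fun (setT : set (measurableTypeR R)) (EFin \o f).
  exact/measurable_EFinP.
have eqint (g : R -> \bar R) :
    (\int[normal_prob m s]_x g x = \int[distribution P Y']_x g x)%E.
  have -> // := @eq_measure_integral _ (measurableTypeR R) R setT (distribution P Y')
    (normal_prob m s) g.
  by move=> B mB _; have /= <- := law B mB.
have iN : (normal_prob m s).-integrable setT (EFin \o f).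
  apply/integrableP; split=> //; rewrite eqint.
  rewrite ge0_integral_distribution//; last exact: measurableT_comp.
  by have /integrableP[] := iF.
transitivity (\int[normal_prob m s]_x (EFin \o f) x)%E.
  by rewrite eqint integral_distribution.
have dom := @normal_prob_dominates R m s.
rewrite -(Radon_Nikodym_change_of_variables dom measurableT iN).
apply: ae_eq_integral => //.
- by apply: emeasurable_funM => //; exact: (measurable_int mu (Radon_Nikodym_integrable dom)).
- by apply/measurable_EFinP; apply: measurable_funM => //; exact: measurable_normal_pdf.
have : ae_eq mu setT (fun x => (normal_pdf m s x)%:E)
    (Radon_Nikodym (charge_of_finite_measure (normal_prob m s)) mu).
  apply: integral_ae_eq => //.
  - exact: integrable_normal_pdf.
  - by move=> B _ mB; rewrite -Radon_Nikodym_integral.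
by apply: filterS => x /= h Tx; rewrite -h// EFinM.
Qed.

(** The parameters of the law are identified by comparing the first two moments
    with those of the normal density; a positive second moment together with a
    zero mean excludes the degenerate law. *)
Lemma centered_gaussian_law (v : R) : 0 < v -> gaussian_rv P Y ->
  ('E_P[Y] = 0)%E -> ('E_P[(fun w => Y w * Y w)%R] = v%:E)%E ->
  exists s : R, [/\ s != 0, s ^+ 2 = v &
    forall B : set R, measurable B -> P (Y @^-1` B) = normal_prob 0 s B].
Proof.
move=> v0 [m [s law]]; rewrite unlock => EY EY2.
have mY : measurable_fun setT Y by [].
have iY2 : P.-integrable setT (EFin \o (fun w => Y w * Y w)).
  apply/integrableP; split.
    by apply/measurable_EFinP; exact: measurable_funM.
  rewrite (_ : (\int[P]_w _ = v%:E)%E) ?ltry// -EY2; apply: eq_integral => w _ /=.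
  by rewrite ger0_norm// -expr2 sqr_ge0.
have i1 (c : R) : P.-integrable setT (EFin \o (fun=> c : R)).
  exact: finite_measure_integrable_cst.
have iY : P.-integrable setT (EFin \o Y).
  have := integrableD measurableT (i1 1) iY2.
  apply: le_integrable => //; first exact/measurable_EFinP.
  move=> w _; rewrite /= lee_fin; apply: le_trans (ler_norm _).
  have := sqr_ge0 (`|Y w| - 1); rewrite -expr2.
  rewrite -[Y w ^+ 2]ger0_norm ?sqr_ge0// normrX; move: `|Y w| => y; nra.
have EYR : \int[P]_w Y w = 0 by rewrite /Rintegral EY.
have iYm : P.-integrable setT (EFin \o (fun w => Y w - m)).
  exact: (integrableB measurableT iY (i1 m)).
have EYm : \int[P]_w (Y w - m) = - m.
  rewrite RintegralB// EYR Rintegral_cst//; have /= -> := probability_setT P.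
  by rewrite mulr1 sub0r.
have [s0|s0] := eqVneq s 0; last first.
  have law' B : measurable B -> P (Y @^-1` B) = normal_prob m s B.
    by move=> /law; rewrite (negbTE s0).
  have m0 : m = 0.
    have := @normal_expectation m s (fun y => y - m) s0 law' _ iYm.
    move=> /(_ _)/(congr1 fine); rewrite -[LHS]/(\int[P]_w (Y w - m)) EYm.
    rewrite -[RHS]/(\int[mu]_x ((x - m) * normal_pdf m s x)) normal_mean//.
    by move=> h; apply/eqP; rewrite -oppr_eq0; apply/eqP/h; exact: measurable_funB.
  exists s; split=> //; last by rewrite -m0.
  have mf : measurable_fun setT (fun y : R => (y - 0) * (y - 0)).
    by apply: measurable_funM; exact: measurable_funB.
  have := @normal_expectation 0 s (fun y => (y - 0) * (y - 0)) s0 _ mf.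
  rewrite -m0 => /(_ law'); rewrite m0 => h.
  have h2 : P.-integrable setT (EFin \o ((fun y => (y - 0) * (y - 0)) \o Y)).
    by apply: eq_integrable iY2 => // w _ /=; rewrite subr0.
  have := h h2 => /(congr1 fine).
  rewrite -[RHS]/(\int[mu]_x ((x - 0) * (x - 0) * normal_pdf 0 s x)).
  under eq_Rintegral do rewrite -expr2.
  rewrite normal_variance// => <-.
  by under eq_integral do rewrite subr0; rewrite EY2.
have mf2 : measurable_fun setT (fun y : R => ((y - m) ^+ 2)%:E).
  by apply/measurable_EFinP; apply: measurable_funX; exact: measurable_funB.
have Ym : (\int[P]_w ((Y w - m) ^+ 2)%:E = 0)%E.
  rewrite -(ge0_integral_distribution Y (f := fun y => ((y - m) ^+ 2)%:E)).
  - have -> // := @eq_measure_integral _ _ R setT (dirac m) (distribution P Y)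
        (fun y : R => ((y - m) ^+ 2)%:E).
      by rewrite integral_dirac// diracT mul1e subrr expr0n.
    by move=> B mB _; have /= := law B mB; rewrite s0 eqxx.
  - exact: mf2.
  - by move=> y; rewrite lee_fin sqr_ge0.
have : 0 < (\int[P]_w (Y w * Y w)).
  by rewrite /Rintegral EY2.
have -> : \int[P]_w (Y w * Y w) = \int[P]_w ((Y w - m) ^+ 2 + (2 * m * (Y w - m) + m ^+ 2)).
  by apply: eq_Rintegral => w _; ring.
have iYm2 : P.-integrable setT (EFin \o (fun w => (Y w - m) ^+ 2)).
  apply/integrableP; split.
    by apply/measurable_EFinP; apply: measurable_funX; exact: measurable_funB.
  rewrite (_ : (\int[P]_w _ = 0)%E) ?ltry// -[RHS]Ym; apply: eq_integral => w _ /=.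
  by rewrite ger0_norm// sqr_ge0.
have iYm3 : P.-integrable setT (EFin \o (fun w => 2 * m * (Y w - m))).
  exact: (integrableZl measurableT (2 * m) iYm).
have iYm4 : P.-integrable setT (EFin \o (fun w => 2 * m * (Y w - m) + m ^+ 2)).
  exact: (integrableD measurableT iYm3 (i1 _)).
rewrite (RintegralD measurableT iYm2 iYm4) (RintegralD measurableT iYm3 (i1 _)).
rewrite (RintegralZl _ measurableT iYm) EYm (Rintegral_cst P measurableT) /Rintegral Ym.
have /= -> := probability_setT P; rewrite /= mulr1 add0r => h.
by have := sqr_ge0 m; lra.
Qed.

End normal_law.

Section normal_tails.
Context {R : realType}.
Notation mu := (@lebesgue_measure R).
Implicit Types (a b c M s delta : R).

Lemma measurable_norm_ge a : measurable [set x : R | a <= `|x|].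
Proof.
have mn : measurable_fun setT (fun x : R => `|x|) by exact: measurableT_comp.
have := mn measurableT `[a, +oo[%classic (measurable_itv _).
congr measurable; apply/seteqP; split=> x /=; rewrite in_itv/= andbT.
  by case.
by split.
Qed.

(** On the tail event a fraction [1 - delta] of the exponent is bounded by its
    value at [a]; the remaining fraction is the density of a wider normal law, of
    total mass one. *)
Lemma normal_prob_tail a delta s : s != 0 -> 0 <= a -> 0 < delta < 1 ->
  (normal_prob 0 s [set x | (a <= `|x|)%R] <=
    ((Num.sqrt delta)^-1 * expR (- ((1 - delta) * a ^+ 2 / (2 * s ^+ 2))))%:E)%E.
Proof.
move=> s0 a0 /andP[d0 d1].
have sd0 : 0 < Num.sqrt delta by rewrite sqrtr_gt0.
have s20 : 0 < s ^+ 2 by rewrite exprn_even_gt0.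
set s' := s / Num.sqrt delta.
have s'0 : s' != 0 by rewrite mulf_neq0// invr_neq0// gt_eqF.
have s'2 : s' ^+ 2 = s ^+ 2 / delta by rewrite /s' exprMn exprVn sqr_sqrtr// ltW.
set K := _^-1 * _.
have peak : normal_peak s = (Num.sqrt delta)^-1 * normal_peak s'.
  rewrite /normal_peak s'2 -invfM; congr (_^-1).
  rewrite -sqrtrM ?(ltW d0)//; congr Num.sqrt.
  by field; rewrite gt_eqF.
have K0 : 0 <= K by rewrite mulr_ge0 ?invr_ge0 ?expR_ge0// ltW.
have pdf_le x : a <= `|x| -> normal_pdf 0 s x <= K * normal_pdf 0 s' x.
  move=> ax; rewrite !normal_pdfE// /K peak /normal_fun !subr0 s'2.
  rewrite [leRHS]mulrACA ler_wpM2l ?mulr_ge0 ?invr_ge0 ?normal_peak_ge0 ?(ltW sd0)//.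
  rewrite -expRD ler_expR.
  have xa : a ^+ 2 <= x ^+ 2.
    by rewrite -[x ^+ 2]ger0_norm ?sqr_ge0// normrX lerXn2r ?nnegrE.
  have -> : - x ^+ 2 / (s ^+ 2 *+ 2) = - ((1 - delta) * x ^+ 2 / (2 * s ^+ 2)) +
      - x ^+ 2 / (s ^+ 2 / delta *+ 2) by field; rewrite s0 gt_eqF.
  rewrite lerD2r lerN2; apply: ler_wpM2r; first by rewrite invr_ge0 mulr_ge0 ?sqr_ge0.
  by rewrite ler_wpM2l// subr_ge0 ltW.
have mA := measurable_norm_ge a.
apply: (@le_trans _ _ (\int[mu]_(x in [set x : R | (a <= `|x|)%R]) (K%:E * (normal_pdf 0 s' x)%:E))%E).
  apply: ge0_le_integral => //.
  - by move=> x _; rewrite lee_fin normal_pdf_ge0.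
  - by apply/measurable_EFinP/measurable_funTS; exact: measurable_normal_pdf.
  - apply/measurable_funTS; apply: emeasurable_funM => //.
    by apply/measurable_EFinP; exact: measurable_normal_pdf.
rewrite -[leRHS]mule1 -[X in (_ <= _ * X)%E](@integral_normal_pdf R 0 s').
rewrite -ge0_integralZl_EFin//; last 2 first.
- by move=> x _; rewrite lee_fin normal_pdf_ge0.
- by apply/measurable_EFinP; exact: measurable_normal_pdf.
apply: ge0_subset_integral => //.
- apply: emeasurable_funM => //.
  by apply/measurable_EFinP; exact: measurable_normal_pdf.
- by move=> x _; rewrite -EFinM lee_fin mulr_ge0// normal_pdf_ge0.
Qed.

(** The density is at least its value at distance [M] from the origin. *)
Lemma normal_prob_interval b c M s : s != 0 -> b < c -> `|b| <= M -> `|c| <= M ->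
  (((c - b) * (normal_peak s * expR (- (M ^+ 2 / (2 * s ^+ 2)))))%:E <=
    normal_prob 0 s `]b, c[%classic)%E.
Proof.
move=> s0 bc bM cM.
have s20 : 0 < s ^+ 2 by rewrite exprn_even_gt0.
have M0 : 0 <= M := le_trans (normr_ge0 b) bM.
set k := normal_peak s * _.
have k0 : 0 <= k by rewrite mulr_ge0 ?normal_peak_ge0 ?expR_ge0.
have -> : ((c - b) * k)%:E = (\int[mu]_(x in `]b, c[) k%:E)%E.
  rewrite integral_cst//=.
  have := @lebesgue_measure_itv R `]b, c[; rewrite /= lte_fin bc -EFinD => ->.
  by rewrite -EFinM mulrC.
apply: ge0_le_integral => //.
- by apply/measurable_EFinP/measurable_funTS; exact: measurable_normal_pdf.
- move=> x; rewrite /= in_itv/= => /andP[bx xc]; rewrite lee_fin normal_pdfE// /k.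
  rewrite ler_pM2l ?normal_peak_gt0// /normal_fun subr0 ler_expR mulNr lerN2.
  have -> : s ^+ 2 *+ 2 = 2 * s ^+ 2 by ring.
  apply: ler_wpM2r; first by rewrite invr_ge0 mulr_ge0 ?sqr_ge0.
  have xM : `|x| <= M.
    move: bM cM; rewrite !ler_norml => /andP[h1 h2] /andP[h3 h4].
    by apply/andP; split; lra.
  by rewrite -[x ^+ 2]ger0_norm ?sqr_ge0// normrX lerXn2r ?nnegrE.
Qed.

End normal_tails.

Section fbm_law.
Context d (T : measurableType d) (R : realType) (P : probability T R).
Variables (H : R) (W : R -> {RV P >-> R}).
Hypothesis H01 : 0 < H < 1.
Hypothesis fW : fractional_brownian_motion H W.
Implicit Types (l a b c M delta : R).

Lemma fbm_marginal l : 0 < l -> exists s : R, [/\ s != 0, s ^+ 2 = l `^ (2 * H) &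
  forall B : set R, measurable B -> P (W l @^-1` B) = normal_prob 0 s B].
Proof.
move=> l0; have v0 : 0 < l `^ (2 * H) by rewrite powR_gt0.
apply: centered_gaussian_law => //.
- have [m [s law]] := fbm_gaussian fW (fun _ : 'I_1 => 1) (fun _ => l).
  exists m, s => B mB; rewrite -law//; congr (P _).
  by apply/seteqP; split=> w /=; rewrite big_ord1 mul1r.
- exact: fbm_centered fW l.
- rewrite (fbm_covariance fW) subrr normr0 powR0 ?subr0; last first.
    by case/andP: H01 => h _; rewrite mulf_neq0// gt_eqF.
  by rewrite gtr0_norm//; congr (_%:E); field.
Qed.

Lemma fbm_tail l a delta : 0 < l -> 0 <= a -> 0 < delta < 1 ->
  (P [set w | (a <= `|W l w|)%R] <=
    ((Num.sqrt delta)^-1 * expR (- ((1 - delta) * a ^+ 2 / (2 * l `^ (2 * H)))))%:E)%E.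
Proof.
move=> l0 a0 d01; have [s [s0 sE law]] := fbm_marginal l0.
have mA := measurable_norm_ge a.
by rewrite [X in (X <= _)%E](law _ mA) -sE; exact: normal_prob_tail.
Qed.

Lemma fbm_interval l b c M : 0 < l -> b < c -> `|b| <= M -> `|c| <= M ->
  (((c - b) * ((Num.sqrt (l `^ (2 * H) * pi *+ 2))^-1 *
      expR (- (M ^+ 2 / (2 * l `^ (2 * H))))))%:E <=
    P (W l @^-1` `]b, c[%classic))%E.
Proof.
move=> l0 bc bM cM; have [s [s0 sE law]] := fbm_marginal l0.
rewrite law; last exact: measurable_itv.
by rewrite -sE; exact: normal_prob_interval.
Qed.

End fbm_law.

(** * Conditioning on the local time *)

Section joint_measurability.
Context d (T : measurableType d) (R : realType).
Variable Y : R -> T -> R.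
Hypothesis mY : forall t, measurable_fun setT (Y t).
Hypothesis cY : forall w, continuous (Y ^~ w).

(** Step functions in time are jointly measurable and converge by continuity. The
    cells of width [1 / (m + 1)] cover a time interval that grows with [m]. *)
Lemma continuous_process_measurable_ge0 :
  measurable_fun setT (fun z : R * T => Y (Num.max z.1 0) z.2).
Proof.
pose h m : R := m.+1%:R^-1.
pose f m (z : R * T) := right_step (Y ^~ z.2) (h m) (m.+1 * m.+1) (Num.max z.1 0).
apply: (@measurable_fun_cvg _ _ _ _ f).
  move=> m; apply: measurable_sum => k; apply: measurable_funM.
    exact: measurableT_comp (mY _) _.
  apply: measurableT_comp => //.
  by apply: measurable_maxr => //; exact: measurable_fst.
move=> [l w] _ /=; set u := Num.max l 0; have u0 : 0 <= u by rewrite le_max lexx orbT.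
apply/cvgrPdist_lt => e e0.
have cu : Y v w @[v --> u] --> Y u w by exact: cY.
move/cvgrPdist_lt: cu => /(_ e e0)[dl /= dl0 dlP].
have hc : h m @[m --> \oo] --> 0 by exact: cvg_harmonic.
move/cvgrPdist_lt: hc => /(_ dl dl0) hc.
have uc : \forall m \near \oo, u < m%:R by exact: nbhs_infty_gtr.
apply: filterS2 hc uc => m; rewrite sub0r normrN gtr0_norm ?invr_gt0// => hd um.
have h0 : 0 < h m by rewrite invr_gt0.
rewrite /f /=; have [||r [/andP[ur ru] ->]] := @right_stepE _ (Y ^~ w) (h m) (m.+1 * m.+1) u => //.
  rewrite u0 natrM mulfK ?gt_eqF//=.
  by rewrite (lt_le_trans um)// ler_nat.
apply: dlP => /=; rewrite distrC gtr0_norm ?subr_gt0//.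
by rewrite ltrBlDl (le_lt_trans ru)// ltrD2l.
Qed.

End joint_measurability.

(** Splitting time at the origin extends the previous lemma to negative times. *)
Lemma continuous_process_measurable d (T : measurableType d) (R : realType)
    (Y : R -> T -> R) : (forall t, measurable_fun setT (Y t)) ->
  (forall w, continuous (Y ^~ w)) -> measurable_fun setT (fun z : R * T => Y z.1 z.2).
Proof.
move=> mY cY.
have m1 := continuous_process_measurable_ge0 mY cY.
have cY' w : continuous ((fun t => Y (- t)) ^~ w).
  move=> t; apply: (@continuous_comp _ _ _ (@GRing.opp R) (Y ^~ w)); last exact: cY.
  exact: opp_continuous.
have m2 := continuous_process_measurable_ge0 (fun t => mY (- t)) cY'.
have m3 : measurable_fun setT (fun z : R * T => Y (- Num.max (- z.1) 0) z.2).
  pose N (z : R * T) := (- z.1, z.2).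
  have mN : measurable_fun setT N.
    by apply: measurable_fun_pair => //; exact: measurableT_comp.
  exact: (measurableT_comp m2 mN).
have m4 : measurable_fun setT (fun z : R * T => Y 0 z.2).
  exact: measurableT_comp (mY 0) _.
have -> : (fun z : R * T => Y z.1 z.2) = (fun z => Y (Num.max z.1 0) z.2 +
    Y (- Num.max (- z.1) 0) z.2 - Y 0 z.2).
  apply/funext => -[l w] /=; have [l0|l0] := leP 0 l.
    have /max_idPr -> : - l <= 0 by rewrite oppr_le0.
    by rewrite oppr0; ring.
  have /max_idPl -> : 0 <= - l by rewrite oppr_ge0 ltW.
  by rewrite opprK; ring.
by apply: measurable_funB => //; exact: measurable_funD.
Qed.

Section subordination.
Context d (T : measurableType d) (R : realType) (P : probability T R).
Variables (H : R) (W X : R -> {RV P >-> R}) (L : R -> R -> {RV P >-> R}).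
Hypothesis fW : fractional_brownian_motion H W.
Hypothesis lX : levy_process X.
Hypothesis lL : local_time X L.
Hypothesis indep : independent_processes P [set: R] [set t | 0 <= t] W X.

Let genW : set (set T) :=
  \bigcup_(t in [set: R]) preimage_set_system [set: T] (W t) measurable.
Let genX : set (set T) :=
  \bigcup_(t in [set t : R | 0 <= t]) preimage_set_system [set: T] (X t) measurable.

Let mW t : measurable_fun (setT : set (g_sigma_algebraType genW)) (W t).
Proof.
move=> _ B mB; apply: sub_sigma_algebra; exists t => //.
by exists B.
Qed.

Let mX t : 0 <= t -> measurable_fun (setT : set (g_sigma_algebraType genX)) (X t).
Proof.
move=> t0 _ B mB; apply: sub_sigma_algebra; exists t => //.
by exists B.
Qed.

Let genW_sub A : <<s genW >> A -> d.-measurable A.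
Proof.
apply: smallest_sub; first exact: sigma_algebra_measurable.
by move=> _ [t _ [B mB <-]]; exact: (measurable_funP (W t)).
Qed.

Let genX_sub A : <<s genX >> A -> d.-measurable A.
Proof.
apply: smallest_sub; first exact: sigma_algebra_measurable.
by move=> _ [t _ [B mB <-]]; exact: (measurable_funP (X t)).
Qed.

(** Local time is only almost surely determined by the path of [X]; this version
    is a function of that path, so that independence applies to it. *)
Let version t w : R := Num.max
  (fine (limn_esup (fun n => limn_esup (fun m => (occupation_sum X t n m w)%:E)))) 0.

Let version_measurable t : 0 < t ->
  measurable_fun (setT : set (g_sigma_algebraType genX)) (version t).
Proof.
move=> t0; apply: (@measurable_maxr _ (g_sigma_algebraType genX)) => //.
apply: measurableT_comp; first exact: fine_measurable.
apply: (@measurable_fun_limn_esup _ (g_sigma_algebraType genX)) => n.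
apply: (@measurable_fun_limn_esup _ (g_sigma_algebraType genX)) => m.
apply/measurable_EFinP; apply: measurable_funM => //; apply: measurable_funM => //.
apply: measurable_sum => k; apply: measurableT_comp => //.
by apply: measurable_funB; apply: mX; rewrite // mulr_ge0 ?divr_ge0// ltW.
Qed.

Let versionE t : 0 < t -> {ae P, forall w, version t w = L 0 t w}.
Proof.
move=> t0; apply: filterS (occupation_sum_cvg lX lL t0) => w [B AB BL].
have B0 n : 0 <= B n.
  rewrite -(cvg_lim _ (AB n))//; apply: limr_ge; first by apply/cvg_ex; exists (B n).
  by apply: nearW => m; rewrite occupation_sum_ge0// ltW.
have L0 : 0 <= L 0 t w.
  rewrite -(cvg_lim _ BL)//; apply: limr_ge; first by apply/cvg_ex; exists (L 0 t w).
  exact: nearW.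
have E1 n : limn_esup (fun m => (occupation_sum X t n m w)%:E) = (B n)%:E.
  have : (occupation_sum X t n m w)%:E @[m --> \oo] --> (B n)%:E.
    by apply: cvg_EFin (AB n); near=> m0.
  by move=> /cvg_limn_einf_sup[].
have E2 : limn_esup (fun n => (B n)%:E) = (L 0 t w)%:E.
  have : (B n)%:E @[n --> \oo] --> (L 0 t w)%:E by apply: cvg_EFin BL; near=> m0.
  by move=> /cvg_limn_einf_sup[].
rewrite /version; under eq_fun do rewrite E1.
by rewrite E2/=; apply/max_idPl.
Unshelve. all: by end_near.
Qed.

(** The version [V] of the local time is measurable for the sigma-algebra of [X],
    and [W] is jointly measurable for its own sigma-algebra, so that the product
    formula applies to [W (V w) w]. Keeping [V] nonnegative everywhere avoids an
    exceptional set later. *)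
Lemma local_time_fbm_law t : 0 < t -> exists V : {RV P >-> R},
  [/\ forall w, 0 <= V w, {ae P, forall w, V w = L 0 t w} &
  forall B : set R, measurable B ->
    measurable_fun setT (fun w => P (W (V w) @^-1` B)) /\
    (P [set w | B (local_time_fbm W L t w)] = \int[P]_w P (W (V w) @^-1` B))%E].
Proof.
move=> t0.
have mV : measurable_fun setT (version t).
  by move=> _ B mB; apply: genX_sub; exact: version_measurable.
pose V : {RV P >-> R} := mfun_Sub (mem_set mV).
have V0 w : 0 <= V w by rewrite /= /version le_max lexx orbT.
exists V; split=> [//||B mB]; first exact: versionE.
have indicP w : (\int[P]_y (\1_B (W (V w) y))%:E = P (W (V w) @^-1` B))%E.
  transitivity (\int[P]_y (\1_(W (V w) @^-1` B) y)%:E)%E.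
    by apply: eq_integral => y _; rewrite !indicE.
  by rewrite integral_indic ?setIT//; exact: measurable_funPTI.
have jW := continuous_process_measurable (fun t => measurable_funP (W t)) (fbm_continuous fW).
have jW' := continuous_process_measurable mW (fbm_continuous fW).
split.
  pose F (z : R * T) := (\1_B (W z.1 z.2))%:E : \bar R.
  have mF : measurable_fun setT F.
    by apply/measurable_EFinP; apply: measurableT_comp jW; exact: measurable_indic.
  rewrite (_ : (fun w => _) = (fubini_F P F) \o V); last first.
    by apply/funext => w; rewrite -indicP.
  apply: measurableT_comp => //; apply: measurable_fun_fubini_tonelli_F => //.
  by move=> z; rewrite lee_fin.
pose WT := g_sigma_algebraType genW.
have mid : @measurable_fun _ _ T WT setT id.
  by move=> _ A mA; rewrite setTI; exact: genW_sub.
pose U := @mfun_Sub _ _ T WT id (mem_set mid).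
pose F (z : R * WT) := (\1_B (W z.1 z.2))%:E : \bar R.
have mF : measurable_fun setT F.
  by apply/measurable_EFinP; apply: measurableT_comp jW'; exact: measurable_indic.
have VU C A : measurable C -> measurable A ->
    P (V @^-1` C `&` U @^-1` A) = (P (V @^-1` C) * P (U @^-1` A))%E.
  move=> mC mA; rewrite setIC muleC; apply: indep; first exact: mA.
  have := version_measurable t0 measurableT mC.
  by rewrite setTI.
have F0 z : (0 <= F z)%E by rewrite lee_fin.
have fub := independent_fubini VU mF F0.
have mS (Y : {RV P >-> R}) : measurable [set w | B (W (Y w) w)].
  have mYi : measurable_fun setT (fun w => (Y w, w)) by apply: measurable_fun_pair.
  have := measurableT_comp jW mYi measurableT mB.
  by rewrite setTI.
transitivity (P [set w | B (W (V w) w)]).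
  apply: probability_ae_eq.
  - exact: mS.
  - exact: mS.
  - by apply: filterS (versionE t0) => w Vw; rewrite /= /local_time_fbm -Vw.
transitivity (\int[P]_w F (V w, U w))%E.
  transitivity (\int[P]_w (\1_[set w | B (W (V w) w)] w)%:E)%E.
    by rewrite integral_indic ?setIT//; exact: mS.
  by apply: eq_integral => w _; rewrite /F !indicE.
by rewrite fub; apply: eq_integral => w _; rewrite -indicP.
Qed.

End subordination.

(** * The rate function *)

Section rate_function.
Context {R : realType}.
Variables (H alpha nu chi : R).
Hypothesis H01 : 0 < H < 1.
Hypothesis alpha12 : 1 < alpha <= 2.
Hypothesis Halpha : 2 * H < alpha.
Hypothesis chi0 : 0 < chi.
Implicit Types (x l theta : R).

Let A := A1 alpha nu chi.
Let A0 : 0 < A. Proof. exact: A1_gt0. Qed.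
Let b := alpha / (alpha - 1).
Let be := 1 - 1 / alpha.
(** With this constant the minimiser below is [(M x ^ 2) ^ (1 / (alpha + 2
    H))]. *)
Let M := H * A `^ alpha / be `^ (alpha - 1).

Let H0 : 0 < H. Proof. by case/andP: H01. Qed.
Let al1 : 1 < alpha. Proof. by case/andP: alpha12. Qed.
Let be0 : 0 < be. Proof. by rewrite /be subr_gt0 div1r invf_lt1// (lt_trans _ al1). Qed.
Let M0 : 0 < M. Proof. by rewrite /M !mulr_gt0 ?invr_gt0 ?powR_gt0. Qed.
Let s0 : 0 < alpha + 2 * H. Proof. by have := H0; have := al1; lra. Qed.

(** The limit of the logarithmic moment generating functions of the rescaled local
    time. *)
Definition cumulant theta : R := (theta * A1 alpha nu chi) `^ (alpha / (alpha - 1)).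

Lemma Lambda1_starE x : Lambda1_star H alpha nu chi x =
  (alpha + 2 * H) / (2 * alpha) * M `^ (- (2 * H / (alpha + 2 * H))) *
  (x ^+ 2) `^ (alpha / (alpha + 2 * H)).
Proof.
rewrite /Lambda1_star; congr (_ * _ * _); rewrite /B1 -/A -/be -/M.
have al0 : alpha != 0 by rewrite gt_eqF// (lt_trans _ al1).
have d0 : alpha - 2 * H != 0 by rewrite subr_eq0 gt_eqF.
have Mp : M `^ (2 * H / (alpha - 2 * H)) != 0 by rewrite gt_eqF// powR_gt0.
have -> : (alpha - 2 * H) / (2 * alpha * ((alpha - 2 * H) / (2 * alpha) *
    M `^ (2 * H / (alpha - 2 * H)))) = (M `^ (2 * H / (alpha - 2 * H)))^-1.
  by field; rewrite Mp d0 al0.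
rewrite -powRN -powRrM; congr (_ `^ _); field.
by rewrite d0 gt_eqF.
Qed.

(** The rate is the minimum over [l] of [x ^ 2 / (2 l ^ (2 H))] plus the Legendre
    transform of the cumulant. At the minimiser, the first equation says that
    [theta] is the tilt dual to [l], as [cumulant] is homogeneous of degree [alpha
    / (alpha - 1)], and the second that the derivatives of the two terms cancel;
    the last one is the value of the minimum. *)
Lemma rate_data x : x != 0 -> exists l theta : R,
  [/\ 0 < l, 0 < theta, theta * l = alpha / (alpha - 1) * cumulant theta,
     theta * l = H * (x ^+ 2 / l `^ (2 * H)) &
     x ^+ 2 / l `^ (2 * H) / 2 + theta * l - cumulant theta = Lambda1_star H alpha nu chi x].
Proof.
move=> x0; have x20 : 0 < x ^+ 2 by rewrite exprn_even_gt0.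
pose l := (M * x ^+ 2) `^ (alpha + 2 * H)^-1.
have Mx0 : 0 < M * x ^+ 2 by rewrite mulr_gt0.
have l0 : 0 < l by rewrite powR_gt0.
pose G := x ^+ 2 / l `^ (2 * H).
have G0 : 0 < G by rewrite divr_gt0// powR_gt0.
have al0 : alpha != 0 by rewrite gt_eqF// (lt_trans _ al1).
have al10 : alpha - 1 != 0 by rewrite subr_eq0 gt_eqF.
have GE : G = M `^ (- (2 * H / (alpha + 2 * H))) * (x ^+ 2) `^ (alpha / (alpha + 2 * H)).
  rewrite /G /l -powRrM powRM ?(ltW M0) ?(ltW x20)// invfM -!powRN mulrCA; congr (_ * _).
    by rewrite [_^-1 * _]mulrC.
  rewrite -{1}(powRr1 (ltW x20)) -powRD ?(gt_eqF x20) ?implybT//.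
  by congr (_ `^ _); field; rewrite gt_eqF.
pose theta := H * G / l.
have th0 : 0 < theta by rewrite divr_gt0// mulr_gt0.
have thl : theta * l = H * G by rewrite /theta divfK// gt_eqF.
have lpow : l `^ (alpha + 2 * H) = M * x ^+ 2.
  by rewrite /l -powRrM mulVf ?gt_eqF// powRr1// ltW.
have thA : theta * A = (l * be / A) `^ (alpha - 1).
  have lbe : 0 < l * be by rewrite mulr_gt0.
  rewrite powRM ?invr_ge0 ?(ltW lbe) ?(ltW A0)// powRM ?(ltW l0) ?(ltW be0)//.
  have AV : A^-1 `^ (alpha - 1) = A / A `^ alpha.
    have -> : A^-1 = A `^ (-1) by rewrite powR_inv1// ltW.
    rewrite -powRrM -{2}(powRr1 (ltW A0)) -powRB// ?(gt_eqF A0) ?implybT//.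
    by congr (_ `^ _); ring.
  have lE : l `^ (alpha - 1) = M * x ^+ 2 / (l `^ (2 * H) * l).
    rewrite -lpow -{4}(powRr1 (ltW l0)) -powRD ?(gt_eqF l0) ?implybT//.
    rewrite -powRB ?(gt_eqF l0) ?implybT//.
    by congr (_ `^ _); ring.
  rewrite AV lE /theta /G /M.
  have [n1 n2 n3 n4] : [/\ l `^ (2 * H) != 0, l != 0, A `^ alpha != 0 & be `^ (alpha - 1) != 0].
    by split; rewrite gt_eqF ?powR_gt0.
  move: (be `^ (alpha - 1)) (A `^ alpha) (l `^ (2 * H)) n1 n3 n4 => u v z n1 n3 n4.
  by field; rewrite n1 n2 n3 n4.
have cE : alpha / (alpha - 1) * cumulant theta = theta * l.
  rewrite /cumulant -/A thA -powRrM.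
  have lbeA : 0 < l * be / A by rewrite divr_gt0// mulr_gt0.
  have -> : (alpha - 1) * (alpha / (alpha - 1)) = (alpha - 1) + 1 by field.
  rewrite powRD ?(gt_eqF lbeA) ?implybT// powRr1 ?(ltW lbeA)// -thA.
  by rewrite /be; field; rewrite al10 al0 gt_eqF.
exists l, theta; split=> //.
rewrite -/G thl Lambda1_starE -mulrA -GE.
have -> : cumulant theta = (alpha - 1) / alpha * (H * G).
  by rewrite -thl -cE; field; rewrite al0 al10.
by field.
Qed.

(** The rate is a strictly increasing function of [|x|] onto the half-line.
    Passing through the point [a] with a prescribed value reduces any set to the
    complement of a centred interval. *)
Lemma Lambda1_star_inv (v : R) : 0 < v -> exists2 a, 0 < a &
  Lambda1_star H alpha nu chi a = v /\
  forall x, v <= Lambda1_star H alpha nu chi x -> a <= `|x|.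
Proof.
move=> v0; pose c := (alpha + 2 * H) / (2 * alpha) * M `^ (- (2 * H / (alpha + 2 * H))).
have al0 : 0 < alpha by rewrite (lt_trans _ al1).
have c0 : 0 < c by rewrite !mulr_gt0 ?invr_gt0 ?powR_gt0// mulr_gt0.
pose e := alpha / (alpha + 2 * H); have e0 : 0 < e by rewrite divr_gt0.
have vc0 : 0 < v / c by rewrite divr_gt0.
pose a := Num.sqrt ((v / c) `^ e^-1).
have a0 : 0 < a by rewrite sqrtr_gt0 powR_gt0.
have aE : Lambda1_star H alpha nu chi a = v.
  rewrite Lambda1_starE -/c -/e sqr_sqrtr ?powR_ge0// -powRrM mulVf ?gt_eqF//.
  by rewrite powRr1 ?(ltW vc0)// mulrC divfK// gt_eqF.
exists a => //; split=> // x; rewrite -aE !Lambda1_starE -/c -/e ler_pM2l//.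
move=> ax; rewrite leNgt; apply/negP => xa; move: ax; apply/negP; rewrite -ltNge.
apply: gt0_ltr_powR => //; rewrite ?nnegrE ?sqr_ge0//.
by rewrite -[x ^+ 2]ger0_norm ?sqr_ge0// normrX ltrXn2r// ?nnegrE ?(ltW a0).
Qed.

Lemma Lambda1_star_ge0 x : 0 <= Lambda1_star H alpha nu chi x.
Proof.
have al0 : 0 < alpha by rewrite (lt_trans _ al1).
by rewrite Lambda1_starE !mulr_ge0 ?powR_ge0 ?invr_ge0 ?mulr_ge0 ?(ltW s0) ?(ltW al0).
Qed.

Lemma Lambda1_star_small (e : R) : 0 < e -> exists2 dl, 0 < dl &
  forall x, `|x| < dl -> Lambda1_star H alpha nu chi x < e.
Proof.
move=> e0; have [a a0 [_ aP]] := Lambda1_star_inv e0.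
exists a => // x xa; rewrite ltNge; apply/negP => /aP.
by rewrite leNgt xa.
Qed.

End rate_function.

(** * Concentration of the local time under tilting *)

Section window.
Context d (T : measurableType d) (R : realType) (P : probability T R).
Variables (H alpha nu chi : R) (X : R -> {RV P >-> R}) (L : R -> R -> {RV P >-> R}).
Hypothesis H01 : 0 < H < 1.
Hypothesis alpha12 : 1 < alpha <= 2.
Hypothesis Halpha : 2 * H < alpha.
Hypothesis chi0 : 0 < chi.
Hypothesis stX : stable_levy_process alpha nu chi X.
Hypothesis lL : local_time X L.
Implicit Types (t theta delta e kappa u : R).

Let A := A1 alpha nu chi.
Let A0 : 0 < A. Proof. exact: A1_gt0. Qed.
Let b := alpha / (alpha - 1).
Let K := cumulant alpha nu chi.
Let p := ldp_exponent H alpha.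
Let al1 : 1 < alpha. Proof. by case/andP: alpha12. Qed.
Let H0 : 0 < H. Proof. by case/andP: H01. Qed.
Let b0 : 0 < b. Proof. by rewrite /b divr_gt0 ?subr_gt0// (lt_trans _ al1). Qed.

(** The local time is of order [t] to this power on the events that matter; it is
    larger than the typical order [1 - 1 / alpha]. *)
Definition growth_exponent : R := (alpha - 1) / (alpha - 2 * H).
Let r := growth_exponent.

Lemma growth_exponentE : r * (2 * H) = p.
Proof. by rewrite /r /growth_exponent /p /ldp_exponent; field; rewrite subr_eq0 gt_eqF. Qed.

Lemma ldp_exponent_gt0 : 0 < p.
Proof.
by rewrite /p /ldp_exponent divr_gt0 ?subr_gt0// !mulr_gt0// subr_gt0.
Qed.

Lemma growth_scale t (x : R) : 0 < t -> t `^ (p - r) * (x * t `^ r) = x * t `^ p.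
Proof.
by move=> t0; rewrite mulrCA -powRD ?subrK// (gt_eqF t0) implybT.
Qed.

Let tilt_scale t (x : R) : 0 < t -> 0 <= x ->
  t * (x * t `^ (p - r)) `^ b = t `^ p * x `^ b.
Proof.
move=> t0 x0; rewrite powRM ?powR_ge0// -powRrM mulrCA mulrC; congr (_ * _).
rewrite -{1}(powRr1 (ltW t0)) -powRD ?(gt_eqF t0) ?implybT//; congr (_ `^ _).
rewrite /p /r /b /ldp_exponent /growth_exponent; field.
by rewrite !subr_eq0 !gt_eqF.
Qed.

(** Self-similarity of the local time at the level of exponential moments: the
    tilt [theta t ^ (p - r)] multiplies the rate by [t ^ (p - 1)]. *)
Lemma scaled_exp_le delta : 0 < delta -> exists2 C, 0 < C &
  forall theta t, 0 < theta -> 0 < t ->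
  (\int[P]_w (expR (theta * t `^ (p - r) * L 0 t w))%:E <=
    (C * expR (t `^ p * K ((1 + delta) * theta)))%:E)%E.
Proof.
move=> d0; have [C C0 CP] := local_time_exp_le alpha12 chi0 stX lL d0.
exists C; first exact: C0.
move=> theta t th0 t0.
have tp0 : 0 < theta * t `^ (p - r) by rewrite mulr_gt0// powR_gt0.
apply: le_trans (CP _ _ tp0 t0) _.
rewrite -/b -/A lee_fin ler_wpM2l ?(ltW C0)// ler_expR.
rewrite (_ : _ * (_ * A) = (1 + delta) * theta * A * t `^ (p - r)); last by ring.
rewrite tilt_scale//; apply: mulr_ge0 (ltW A0); apply: mulr_ge0 (ltW th0).
by rewrite addr_ge0// ltW.
Qed.

Lemma scaled_exp_ge delta : 0 < delta < 1 -> exists2 c, 0 < c &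
  forall theta t, 0 < theta -> 0 < t ->
  ((c * expR (t `^ p * K ((1 - delta) * theta)))%:E <=
    \int[P]_w (expR (theta * t `^ (p - r) * L 0 t w))%:E)%E.
Proof.
move=> d01; have [C C0 CP] := local_time_exp_ge alpha12 chi0 stX lL d01.
exists C; first exact: C0.
move=> theta t th0 t0.
have tp0 : 0 < theta * t `^ (p - r) by rewrite mulr_gt0// powR_gt0.
apply: le_trans _ (CP _ _ tp0 t0).
rewrite -/b -/A lee_fin ler_wpM2l ?(ltW C0)// ler_expR.
rewrite (_ : _ * (_ * A) = (1 - delta) * theta * A * t `^ (p - r)); last by ring.
rewrite tilt_scale//; apply: mulr_ge0 (ltW A0); apply: mulr_ge0 (ltW th0).
by case/andP: d01 => _ d1; rewrite subr_ge0 ltW.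
Qed.

Let cumulant_gt0 theta : 0 < theta -> 0 < K theta.
Proof. by move=> th0; rewrite powR_gt0// mulr_gt0. Qed.

Let cumulantM (x theta : R) : 0 <= x -> 0 <= theta -> K (x * theta) = x `^ b * K theta.
Proof.
by move=> x0 th0; rewrite /K /cumulant -mulrA powRM// mulr_ge0// ltW.
Qed.

(** A one-sided Taylor expansion of the power at one, with an explicit remainder. *)
Let power_le u : -1 < u -> b * u < 1 -> (1 + u) `^ b <= (1 - b * u)^-1.
Proof.
move=> u1 bu; have u0 : 0 < 1 + u by lra.
rewrite /powR gt_eqF//; apply: (@le_trans _ _ (expR (b * u))).
  rewrite ler_expR ler_wpM2l ?(ltW b0)//.
  have := expR_ge1Dx (ln (1 + u)); rewrite lnK ?posrE//; lra.
have := expR_ge1Dx (- (b * u)); rewrite expRN => h.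
by rewrite -[leLHS]invrK lef_pV2 ?posrE ?invr_gt0 ?expR_gt0//; lra.
Qed.

Let cumulant_cvg (sg : R) theta : 0 < theta ->
  K ((1 + sg * delta) * theta) @[delta --> 0^'+] --> K theta.
Proof.
move=> th0; apply: cvg_at_right_filter.
have -> : K theta = K ((1 + sg * 0) * theta) by rewrite mulr0 addr0 mul1r.
rewrite /K /cumulant.
apply: (@cvg_comp _ _ _ (fun delta : R => (1 + sg * delta) * theta * A)
  (fun y : R => y `^ b) _ (nbhs ((1 + sg * 0) * theta * A))).
  apply: cvgM; last exact: cvg_cst.
  apply: cvgM; last exact: cvg_cst.
  by apply: cvgD; [exact: cvg_cst|apply: cvgM; [exact: cvg_cst|exact: cvg_id]].
by apply: continuous_powR; rewrite mulr0 addr0 mul1r mulr_gt0.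
Qed.

(** The derivative of the cumulant at [theta] is [l]. Hence a small shift of
    the tilt changes the cumulant by about [l] times the shift, which is
    strictly less than [l2] and strictly more than [l1] times the shift. *)
Let tilt_gap l1 l2 l theta : 0 < theta -> theta * l = b * K theta -> 0 < l1 < l -> l < l2 ->
  exists kappa, [/\ 0 < kappa < theta,
    K (theta + kappa) - kappa * l2 < K theta &
    K (theta - kappa) + kappa * l1 < K theta].
Proof.
move=> th0 thl /andP[l10 l1l] ll2.
have K0 := cumulant_gt0 th0.
have l0 : 0 < l by rewrite (lt_trans l10).
have l20 : 0 < l2 by rewrite (lt_trans l0).
pose m := Num.min ((l2 - l) / l2) ((l - l1) / l1).
have m0 : 0 < m by rewrite lt_min !divr_gt0 ?subr_gt0.
(* small enough for [l < l2 (1 - b u)] and [l1 (1 + b u) < l] *)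
pose u := Num.min (1 / 2) (m / (2 * b)).
have u0 : 0 < u by rewrite lt_min !divr_gt0// mulr_gt0.
have u1 : u < 1 by rewrite gt_min ltr_pdivrMr// mul1r ltr1n.
have bu : b * u < m.
  apply: (@le_lt_trans _ _ (b * (m / (2 * b)))).
    by rewrite ler_wpM2l ?(ltW b0)// ge_min lexx orbT.
  have -> : b * (m / (2 * b)) = m / 2 by field; rewrite gt_eqF.
  by rewrite ltr_pdivrMr//; lra.
have bu0 : 0 < b * u by rewrite mulr_gt0.
have [bu1 bu2] : l < l2 * (1 - b * u) /\ l1 * (1 + b * u) < l.
  have : b * u < (l2 - l) / l2 by rewrite (lt_le_trans bu)// ge_min lexx.
  have : b * u < (l - l1) / l1 by rewrite (lt_le_trans bu)// ge_min lexx orbT.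
  rewrite !ltr_pdivlMr// => h1 h2; split; lra.
have bu3 : b * u < 1.
  rewrite (lt_trans bu)// gt_min ltr_pdivrMr// mul1r.
  by apply/orP; left; lra.
have Kl : K theta * (b * u) = theta * u * l by rewrite mulrCA mulrA -thl; ring.
exists (theta * u); split.
- by rewrite mulr_gt0//= gtr_pMr.
- have -> : theta + theta * u = (1 + u) * theta by ring.
  rewrite cumulantM ?addr_ge0 ?(ltW u0) ?(ltW th0)//.
  have h := @power_le u (lt_trans (ltrN10 _) u0) bu3.
  apply: (@le_lt_trans _ _ ((1 - b * u)^-1 * K theta - theta * u * l2)).
    by rewrite lerD2r ler_wpM2r// ltW.
  have d0 : 0 < 1 - b * u by rewrite subr_gt0.
  rewrite ltrBlDr mulrC ltr_pdivrMr// mulrDl mulrBr mulr1 Kl -addrA ltrDl.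
  by rewrite addrC subr_gt0 -[ltRHS]mulrA ltr_pM2l ?mulr_gt0.
- have -> : theta - theta * u = (1 - u) * theta by ring.
  rewrite cumulantM ?subr_ge0 ?(ltW u1) ?(ltW th0)//.
  have := @power_le (- u); rewrite mulrN opprK => /(_ _ _) h.
  have {}h : (1 - u) `^ b <= (1 + b * u)^-1.
    by apply: h; [rewrite ltrN2|rewrite (lt_trans _ ltr01)// oppr_lt0].
  apply: (@le_lt_trans _ _ ((1 + b * u)^-1 * K theta + theta * u * l1)).
    by rewrite lerD2r ler_wpM2r// ltW.
  have d0 : 0 < 1 + b * u by rewrite addr_gt0.
  rewrite -ltrBrDr mulrC ltr_pdivrMr// mulrBl mulrDr mulr1 Kl -addrA ltrDl.
  by rewrite subr_gt0 -[ltLHS]mulrA ltr_pM2l ?mulr_gt0.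
Qed.

(** Outside the window, Markov's inequality at the tilts [theta + kappa] and
    [theta - kappa] shows that the contribution to the exponential moment at tilt
    [theta] is exponentially smaller than the moment itself. So the window carries
    at least half of the lower bound of that moment, and there the exponential is
    at most [exp (theta l2 t ^ p)]. *)
Lemma local_time_window theta l l1 l2 e : 0 < theta -> theta * l = b * K theta ->
  0 < l1 < l -> l < l2 -> 0 < e -> exists2 c, 0 < c & \forall t \near +oo,
  ((c * expR (- (t `^ p * (theta * l2 - K theta + e))))%:E <=
    P [set w | (l1 * t `^ r <= L 0 t w <= l2 * t `^ r)%R])%E.
Proof.
move=> th0 thl l1l ll2 e0.
have [kappa [/andP[k0 kth] gap1 gap2]] := tilt_gap th0 thl l1l ll2.
pose g := Num.min (K theta - (K (theta + kappa) - kappa * l2))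
  (K theta - (K (theta - kappa) + kappa * l1)).
have g0 : 0 < g by rewrite lt_min !subr_gt0 gap1.
have g4 : 0 < Num.min (g / 4) e by rewrite lt_min e0 andbT divr_gt0.
have k1 : 0 < theta + kappa by lra.
have k2 : 0 < theta - kappa by lra.
have [delta [d0 d1 Kth Kp Km]] : exists delta, [/\ 0 < delta, delta < 1,
   K theta - Num.min (g / 4) e < K ((1 - delta) * theta),
   K ((1 + delta) * (theta + kappa)) < K (theta + kappa) + g / 4 &
   K ((1 + delta) * (theta - kappa)) < K (theta - kappa) + g / 4].
  have c1 : \forall delta \near 0^'+, K theta - Num.min (g / 4) e < K ((1 + -1 * delta) * theta).
    by apply: (cvgr_gt _ (cumulant_cvg (-1) th0)); rewrite ltrBlDr ltrDl.
  have c2 : \forall delta \near 0^'+, K ((1 + 1 * delta) * (theta + kappa)) < K (theta + kappa) + g / 4.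
    by apply: (cvgr_lt _ (cumulant_cvg 1 k1)); rewrite ltrDl divr_gt0.
  have c3 : \forall delta \near 0^'+, K ((1 + 1 * delta) * (theta - kappa)) < K (theta - kappa) + g / 4.
    by apply: (cvgr_lt _ (cumulant_cvg 1 k2)); rewrite ltrDl divr_gt0.
  have c4 : \forall delta \near (0 : R)^'+, 0 < delta by exact: nbhs_right_gt.
  have c5 : \forall delta \near (0 : R)^'+, delta < 1 by exact: nbhs_right_lt.
  have [delta [[h1 h2] [h3 [h4 h5]]]] := filter_ex (filterI (filterI c1 c2) (filterI c3 (filterI c4 c5))).
  by exists delta; rewrite mulN1r in h1; rewrite !mul1r in h2 h3; split.
have d01 : 0 < delta < 1 by rewrite d0.
have [c c0 cP] := scaled_exp_ge d01.
have [C C0 CP] := scaled_exp_le d0.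
exists (c / 2); first by rewrite divr_gt0.
have tp : t `^ p @[t --> +oo] --> +oo := cvgy_powR ldp_exponent_gt0.
have /cvgryPge/(_ (8 * C / (g * c))) tpA := tp.
near=> t.
have t0 : 0 < t by [].
pose N := t `^ p; have N0 : 0 < N by rewrite powR_gt0.
(* for large [t] the two outer contributions take at most half of the lower
   bound *)
have NC : 2 * C * expR (- (g / 2 * N)) <= c / 2.
  have NX : 8 * C / (g * c) <= t `^ p by near: t.
  have y0 : 0 < g / 2 * N by rewrite mulr_gt0// divr_gt0.
  apply: (@le_trans _ _ (2 * C * (g / 2 * N)^-1)).
    rewrite ler_wpM2l ?mulr_ge0 ?(ltW C0)// expRN lef_pV2 ?posrE ?expR_gt0//.
    by apply: le_trans (expR_ge1Dx _); rewrite lerDr.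
  rewrite ler_pdivrMr//; move: NX; rewrite ler_pdivrMr ?mulr_gt0// -/N.
  have -> : c / 2 * (g / 2 * N) = N * (g * c) / 4 by field.
  by move: (N * (g * c)) => y; lra.
pose win : set T := [set w | l1 * t `^ r <= L 0 t w <= l2 * t `^ r].
have mwin : measurable win.
  rewrite (_ : win = L 0 t @^-1` `[l1 * t `^ r, l2 * t `^ r]%classic).
    exact: measurable_funPTI.
  by apply/seteqP; split=> w /=; rewrite in_itv.
pose f (th : R) w := (expR (th * t `^ (p - r) * L 0 t w))%:E.
have mf th : measurable_fun setT (f th).
  by apply/measurable_EFinP; apply: measurableT_comp => //; exact: measurable_funM.
have f0 th w : (0 <= f th w)%E by rewrite lee_fin expR_ge0.
(* the window, the values above it and the values below it *)
have main : (\int[P]_w f theta w <= (expR (theta * l2 * N))%:E * P win +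
    (expR (- (kappa * l2 * N)) * (C * expR (N * K ((1 + delta) * (theta + kappa)))))%:E +
    (expR (kappa * l1 * N) * (C * expR (N * K ((1 + delta) * (theta - kappa)))))%:E)%E.
  have mfM (th y : R) : measurable_fun setT (fun w => (y%:E * f th w)%E).
    by apply: emeasurable_funM.
  have m1M (y : R) : measurable_fun setT (fun w => (y%:E * (\1_win w)%:E)%E).
    by apply: emeasurable_funM => //; exact/measurable_EFinP.
  have f0M (th y : R) w : setT w -> (0 <= (expR y)%:E * f th w)%E.
    by move=> _; rewrite mule_ge0 ?lee_fin ?expR_ge0.
  have f1M (y : R) w : setT w -> (0 <= (expR y)%:E * (\1_win w)%:E)%E.
    by move=> _; rewrite mule_ge0 ?lee_fin ?expR_ge0.
  apply: (@le_trans _ _ (\int[P]_w ((expR (theta * l2 * N))%:E * (\1_win w)%:E +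
      (expR (- (kappa * l2 * N)))%:E * f (theta + kappa)%R w +
      (expR (kappa * l1 * N))%:E * f (theta - kappa)%R w)))%E.
    apply: ge0_le_integral => //.
    - apply: emeasurable_funD; last by apply: emeasurable_funM.
      by apply: emeasurable_funD; apply: emeasurable_funM => //; exact/measurable_EFinP.
    move=> w _; rewrite /f -!EFinM -!EFinD lee_fin -!expRD.
    set s := t `^ (p - r); have s0 : 0 < s by rewrite powR_gt0.
    have sN x : s * (x * t `^ r) = x * N by rewrite growth_scale.
    have i0 : 0 <= expR (theta * l2 * N) * \1_win w by rewrite mulr_ge0 ?expR_ge0.
    have [Ll2|Ll2] := leP (L 0 t w) (l2 * t `^ r); last first.
      rewrite -[leLHS]addr0 lerD ?expR_ge0// -[leLHS]add0r lerD// ler_expR.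
      have : kappa * l2 * N <= kappa * s * L 0 t w.
        by rewrite -!mulrA -sN ler_pM2l// ler_pM2l// ltW.
      by move: (L 0 t w) => y; lra.
    have [Ll1|Ll1] := leP (l1 * t `^ r) (L 0 t w); last first.
      rewrite -[leLHS]add0r lerD ?addr_ge0 ?expR_ge0// ler_expR.
      have : kappa * s * L 0 t w <= kappa * l1 * N.
        by rewrite -!mulrA -sN ler_pM2l// ler_pM2l// ltW.
      by move: (L 0 t w) => y; lra.
    rewrite indicE mem_set ?mulr1; last by rewrite /win/= Ll1.
    rewrite -[leLHS]addr0 lerD ?expR_ge0// -[leLHS]addr0 lerD ?expR_ge0// ler_expR.
    by rewrite -!mulrA -sN ler_pM2l// ler_pM2l.
  rewrite ge0_integralD//; last 3 first.
  - by move=> w Tw; rewrite adde_ge0 ?f0M ?f1M.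
  - by apply: emeasurable_funD.
  - exact: f0M.
  rewrite ge0_integralD//; last exact: f0M.
  rewrite !ge0_integralZl_EFin ?expR_ge0//; last exact/measurable_EFinP.
  rewrite integral_indic// setIT; apply: leeD; last first.
    by rewrite EFinM lee_wpmul2l ?lee_fin ?expR_ge0//; apply: CP.
  by apply: leeD => //; rewrite EFinM lee_wpmul2l ?lee_fin ?expR_ge0//; apply: CP.
have winP : P win = (fine (P win))%:E by rewrite fineK// fin_num_measure.
have := le_trans (cP theta t th0 t0) main.
rewrite winP -EFinM -!EFinD !lee_fin -/N; move: (fine (P win)) => q.
set K1 := K ((1 - delta) * theta) in Kth *.
have g1 : g <= K theta - (K (theta + kappa) - kappa * l2) by rewrite ge_min lexx.
have g2 : g <= K theta - (K (theta - kappa) + kappa * l1) by rewrite ge_min lexx orbT.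
have m1 : Num.min (g / 4) e <= g / 4 by rewrite ge_min lexx.
have m2 : Num.min (g / 4) e <= e by rewrite ge_min lexx orbT.
have T1 : expR (- (kappa * l2 * N)) * (C * expR (N * K ((1 + delta) * (theta + kappa)))) <=
    C * expR (- (g / 2 * N)) * expR (N * K1).
  rewrite [leLHS]mulrCA -expRD -[leRHS]mulrA -expRD ler_pM2l// ler_expR.
  rewrite [leLHS](_ : _ = N * (K ((1 + delta) * (theta + kappa)) - kappa * l2)); last by ring.
  rewrite [leRHS](_ : _ = N * (K1 - g / 2)); last by ring.
  by rewrite ler_pM2l//; lra.
have T2 : expR (kappa * l1 * N) * (C * expR (N * K ((1 + delta) * (theta - kappa)))) <=
    C * expR (- (g / 2 * N)) * expR (N * K1).
  rewrite [leLHS]mulrCA -expRD -[leRHS]mulrA -expRD ler_pM2l// ler_expR.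
  rewrite [leLHS](_ : _ = N * (K ((1 + delta) * (theta - kappa)) + kappa * l1)); last by ring.
  rewrite [leRHS](_ : _ = N * (K1 - g / 2)); last by ring.
  by rewrite ler_pM2l//; lra.
have T3 : 2 * C * expR (- (g / 2 * N)) * expR (N * K1) <= c / 2 * expR (N * K1).
  by rewrite ler_wpM2r ?expR_ge0.
move=> h; have {}h : c / 2 * expR (N * K1) <= expR (theta * l2 * N) * q.
  move: h T1 T2 T3; move: (expR (N * K1)) (expR _ * (C * expR _)) (expR _ * (C * expR _)) => E X1 X2.
  move: (expR (- (g / 2 * N))) (expR (theta * l2 * N) * q) => X3 X4 h1 h2 h3 h4.
  have e1 : 2 * C * X3 * E = C * X3 * E + C * X3 * E by ring.
  have e2 : c * E = c / 2 * E + c / 2 * E by field.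
  move: h1 h2 h3 h4; rewrite e1 e2; move: (C * X3 * E) (c / 2 * E) => Y1 Y2; lra.
have -> : q = expR (theta * l2 * N) * q * expR (- (theta * l2 * N)).
  by rewrite mulrAC -expRD subrr expR0 mul1r.
apply: (@le_trans _ _ (c / 2 * expR (N * K1) * expR (- (theta * l2 * N)))); last first.
  by rewrite ler_wpM2r ?expR_ge0.
rewrite -[leRHS]mulrA -expRD ler_pM2l ?divr_gt0// ler_expR.
rewrite [leRHS](_ : _ = - (N * (theta * l2 - K1))); last by ring.
by rewrite lerN2 ler_pM2l//; lra.
Unshelve. all: by end_near.
Qed.

End window.

(** * Logarithmic rates *)

Section exponential_rate.
Context {R : realType}.
Implicit Types (f : R -> \bar R) (v : \bar R) (t p C c r e : R).

Lemma limf_esup_le f v : (\forall t \near +oo, (f t <= v)%E) ->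
  (limf_esup f (pinfty_nbhs R) <= v)%E.
Proof.
move=> fv; apply: (@le_trans _ _ (ereal_sup [set f t | t in [set t | (f t <= v)%E]])).
  by apply: ereal_inf_lbound; exists [set t | (f t <= v)%E].
by apply: ge_ereal_sup => _ [t /= tv <-].
Qed.

Lemma limf_einf_ge f v : (\forall t \near +oo, (v <= f t)%E) ->
  (v <= limf_einf f (pinfty_nbhs R))%E.
Proof.
move=> fv; rewrite /limf_einf leeNr; apply: limf_esup_le.
by apply: filterS fv => t; rewrite leeN2.
Qed.

Variables (p : R) (q : R -> \bar R).
Hypothesis p0 : 0 < p.
Hypothesis q01 : forall t, (0 <= q t <= 1)%E.

Let rate t : \bar R := ((t `^ (- p))%:E * lne (q t))%E.

Let ln_shift C r t : 0 < t -> 0 < C ->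
  t `^ (- p) * ln (C * expR (- (t `^ p * r))) = t `^ (- p) * ln C - r.
Proof.
move=> t0 C0; rewrite lnM ?posrE ?expR_gt0// expRK mulrDr mulrN mulrA powRN.
by rewrite mulVf ?mul1r// gt_eqF// powR_gt0.
Qed.

Let prefactor_cvg0 C : t `^ (- p) * ln C @[t --> +oo] --> (0 : R).
Proof.
rewrite -(mul0r (ln C)); apply: cvgM; last exact: cvg_cst.
by apply: cvgy_powRN; rewrite oppr_lt0.
Qed.

(** A prefactor does not change the exponential rate, as its logarithm is divided
    by a power of [t] that tends to infinity. *)
Lemma exponential_rate_le C r : 0 < C ->
  (\forall t \near +oo, (q t <= (C * expR (- (t `^ p * r)))%:E)%E) ->
  (limf_esup rate (pinfty_nbhs R) <= (- r)%:E)%E.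
Proof.
move=> C0 qC; apply/lee_addgt0Pr => e e0.
apply: limf_esup_le.
have small : \forall t \near +oo, t `^ (- p) * ln C < e.
  exact: (cvgr_lt _ (prefactor_cvg0 C) _ e0).
near=> t; have t0 : 0 < t by [].
have qt : (q t <= (C * expR (- (t `^ p * r)))%:E)%E by near: t.
have st : t `^ (- p) * ln C < e by near: t.
have x0 : 0 < C * expR (- (t `^ p * r)) by rewrite mulr_gt0 ?expR_gt0.
have /andP[q0 q1] := q01 t.
apply: (@le_trans _ _ ((t `^ (- p))%:E * lne (C * expR (- (t `^ p * r)))%:E)%E).
  rewrite lee_wpmul2l ?lee_fin ?powR_ge0// lee_lne// in_itv/= leey andbT//.
  by rewrite lee_fin ltW.
rewrite lne_EFin// -EFinM ln_shift// -EFinD lee_fin; lra.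
Unshelve. all: by end_near.
Qed.

Lemma exponential_rate_ge c r : 0 < c ->
  (\forall t \near +oo, ((c * expR (- (t `^ p * r)))%:E <= q t)%E) ->
  ((- r)%:E <= limf_einf rate (pinfty_nbhs R))%E.
Proof.
move=> c0 qc; apply/lee_subgt0Pr => e e0.
apply: limf_einf_ge.
have ne0 : - e < 0 by rewrite oppr_lt0.
have small : \forall t \near +oo, - e < t `^ (- p) * ln c.
  exact: (cvgr_gt _ (prefactor_cvg0 c) _ ne0).
near=> t; have t0 : 0 < t by [].
have qt : ((c * expR (- (t `^ p * r)))%:E <= q t)%E by near: t.
have st : - e < t `^ (- p) * ln c by near: t.
have x0 : 0 < c * expR (- (t `^ p * r)) by rewrite mulr_gt0 ?expR_gt0.
have /andP[q0 q1] := q01 t.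
apply: (@le_trans _ _ ((t `^ (- p))%:E * lne (c * expR (- (t `^ p * r)))%:E)%E).
  rewrite lne_EFin// -EFinM ln_shift// -EFinB lee_fin; lra.
rewrite lee_wpmul2l ?lee_fin ?powR_ge0// lee_lne// in_itv/= leey andbT//.
by rewrite lee_fin ltW.
Unshelve. all: by end_near.
Qed.

Lemma exponential_rate_le0 : (limf_esup rate (pinfty_nbhs R) <= 0)%E.
Proof.
apply: limf_esup_le; apply: nearW => t; rewrite /rate mule_ge0_le0 ?lee_fin ?powR_ge0//.
by rewrite lne_le0; case/andP: (q01 t).
Qed.

End exponential_rate.

(** * The two bounds *)

Section ldp_bounds.
Context d (T : measurableType d) (R : realType) (P : probability T R).
Variables (H alpha nu chi : R) (W X : R -> {RV P >-> R}) (L : R -> R -> {RV P >-> R}).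
Hypothesis H01 : 0 < H < 1.
Hypothesis alpha12 : 1 < alpha <= 2.
Hypothesis Halpha : 2 * H < alpha.
Hypothesis chi0 : 0 < chi.
Hypothesis fW : fractional_brownian_motion H W.
Hypothesis stX : stable_levy_process alpha nu chi X.
Hypothesis indep : independent_processes P [set: R] [set t | 0 <= t] W X.
Hypothesis lL : local_time X L.
Variable D : set R.
Hypothesis mD : measurable D.
Implicit Types (t x a e l : R).

Let K := cumulant alpha nu chi.
Let p := ldp_exponent H alpha.
Let r := growth_exponent H alpha.
Let p0 : 0 < p. Proof. exact: ldp_exponent_gt0. Qed.
Let rH : r * (2 * H) = p. Proof. exact: growth_exponentE. Qed.
Let H0 : 0 < H. Proof. by case/andP: H01. Qed.
Let Z := local_time_fbm W L.

Let D' t : set R := [set z | D (t `^ (- p) * z)].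

Let mD' t : measurable (D' t).
Proof.
have mM : measurable_fun setT (fun z : R => t `^ (- p) * z) by exact: measurable_funM.
by have := mM measurableT D mD; rewrite setTI.
Qed.

(** Bernoulli's inequality for a negative exponent. *)
Let power_tangent (s z : R) : 0 <= s -> 0 < z -> 1 - s * (z - 1) <= (z `^ s)^-1.
Proof.
move=> s0 z0; rewrite -powRN /powR gt_eqF//.
apply: le_trans (expR_ge1Dx _); rewrite mulNr lerD2l lerN2 ler_wpM2l//.
by have := expR_ge1Dx (ln z); rewrite lnK ?posrE//; lra.
Qed.

(** The tangent of the convex function [y |-> y ^ (- 2 H)] at the optimal
    local time [t ^ r l]; the duality relation between [th] and [l] identifies
    its slope. *)
Let scaled_tail t x y l G th : 0 < t -> 0 < y -> 0 < l -> G = x ^+ 2 / l `^ (2 * H) ->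
  th * l = H * G ->
  t `^ p * (G / 2 + th * l) - th * t `^ (p - r) * y <=
  (t `^ p * x) ^+ 2 / (2 * y `^ (2 * H)).
Proof.
move=> t0 y0 l0 GE thl.
have tr0 : 0 < t `^ r by rewrite powR_gt0.
have N0 : 0 < t `^ p by rewrite powR_gt0.
pose z := y / (t `^ r * l).
have z0 : 0 < z by rewrite divr_gt0 ?mulr_gt0.
have yE : y = z * (t `^ r * l) by rewrite /z divfK// gt_eqF// mulr_gt0.
have s0 : 0 <= 2 * H by rewrite mulr_ge0// ltW.
have yH : y `^ (2 * H) = z `^ (2 * H) * (t `^ p * l `^ (2 * H)).
  rewrite yE powRM ?(ltW z0)// ?mulr_ge0 ?(ltW tr0) ?(ltW l0)//.
  by rewrite powRM ?(ltW tr0) ?(ltW l0)// -powRrM rH.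
have zH : 0 < z `^ (2 * H) by rewrite powR_gt0.
have lH : 0 < l `^ (2 * H) by rewrite powR_gt0.
have -> : (t `^ p * x) ^+ 2 / (2 * y `^ (2 * H)) = t `^ p * (G / 2 * (z `^ (2 * H))^-1).
  rewrite yH GE; move: (t `^ p) N0 (z `^ (2 * H)) zH (l `^ (2 * H)) lH => N N0 u u0 v v0.
  by field; rewrite !gt_eqF.
have G0 : 0 <= G by rewrite GE mulr_ge0 ?sqr_ge0// invr_ge0 ltW.
have -> : th * t `^ (p - r) * y = t `^ p * (th * l * z).
  rewrite yE -mulrA (_ : z * (t `^ r * l) = (z * l) * t `^ r); last by ring.
  by rewrite growth_scale//; ring.
rewrite -mulrBr ler_pM2l//.
apply: (@le_trans _ _ (G / 2 * (1 - 2 * H * (z - 1)))).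
  by rewrite thl le_eqVlt; apply/orP; left; apply/eqP; field.
by rewrite ler_wpM2l ?divr_ge0//; exact: power_tangent.
Qed.

(** Conditionally on the local time, the Gaussian tail is at most an exponential
    of the local time by [scaled_tail], and the tilt is exactly the one for which
    the exponential moment gives the rate. *)
Lemma ldp_upper_exp a e : 0 < a -> (forall x, D x -> a <= `|x|) -> 0 < e ->
  exists2 C, 0 < C & forall t, 0 < t ->
  (P [set w | D (t `^ (- p) * Z t w)%R] <=
    (C * expR (- (t `^ p * (Lambda1_star H alpha nu chi a - e))))%:E)%E.
Proof.
move=> a0 Da e0.
have [l [th [l0 th0 thl thlG LaE]]] := rate_data nu H01 alpha12 Halpha chi0 (lt0r_neq0 a0).
set G := a ^+ 2 / l `^ (2 * H) in thlG LaE.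
pose S := G / 2 + th * l.
have S0 : 0 < S.
  by rewrite addr_gt0 ?mulr_gt0 ?invr_gt0 ?powR_gt0// exprn_gt0.
(* the loss [dl] serves both in the Gaussian tail and in the exponential
   moment, where [(1 + dl) (1 - dl) <= 1] *)
pose dl := Num.min (1 / 2) (e / S).
have dl0 : 0 < dl by rewrite lt_min !divr_gt0.
have dl1 : dl < 1 by rewrite gt_min ltr_pdivrMr// mul1r ltr1n.
have dlS : dl * S <= e by rewrite -ler_pdivlMr// ge_min lexx orbT.
have dl01 : 0 < dl < 1 by rewrite dl0.
have dl1' : 0 < 1 - dl by rewrite subr_gt0.
have [C C0 CP] := scaled_exp_le alpha12 Halpha chi0 stX lL dl0.
pose C1 := (Num.sqrt dl)^-1.
have C10 : 0 < C1 by rewrite invr_gt0 sqrtr_gt0.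
exists (C1 * C); first by rewrite mulr_gt0.
move=> t t0; have N0 : 0 < t `^ p by rewrite powR_gt0.
have [V [V0 VL law]] := local_time_fbm_law fW (stable_levy stX) lL indep t0.
have [mPV ->] := law _ (mD' t).
pose Ex w := expR ((1 - dl) * th * t `^ (p - r) * V w).
have bound w : (P (W (V w) @^-1` D' t) <=
    (C1 * expR (- ((1 - dl) * (t `^ p * S))))%:E * (Ex w)%:E)%E.
  have := V0 w; rewrite le_eqVlt => /predU1P[Vw|Vw].
    rewrite -Vw [X in P X](_ : _ = set0) ?measure0.
      by rewrite -EFinM lee_fin !mulr_ge0 ?expR_ge0// ltW.
    apply/seteqP; split=> // v /=; rewrite /D'/= (fbm_start fW) mulr0 => /Da.
    by rewrite normr0 leNgt a0.
  apply: (@le_trans _ _ (P [set v | (t `^ p * a <= `|W (V w) v|)%R])).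
    apply: le_measure; rewrite ?inE.
    - exact: measurable_funPTI.
    - have := measurable_norm_ge (t `^ p * a); exact: measurable_funPTI.
    - move=> v /= /Da; rewrite normrM powRN ger0_norm ?invr_ge0 ?powR_ge0//.
      by rewrite ler_pdivlMl.
  have ta0 : 0 <= t `^ p * a by rewrite mulr_ge0 ?powR_ge0// ltW.
  apply: (le_trans (fbm_tail H01 fW Vw ta0 dl01)).
  rewrite -EFinM lee_fin /Ex -[leRHS]mulrA -expRD ler_wpM2l ?(ltW C10)// ler_expR.
  have := scaled_tail t0 Vw l0 (erefl G) thlG.
  rewrite -(ler_pM2l dl1') -/S => h.
  rewrite -mulrA; move: h.
  rewrite mulrBr; set Y := _ / _; set Y1 := th * _ * _.
  have -> : (1 - dl) * th * t `^ (p - r) * V w = (1 - dl) * Y1 by rewrite /Y1; ring.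
  by lra.
have mEx : measurable_fun setT (fun w => (Ex w)%:E).
  by apply/measurable_EFinP; apply: measurableT_comp => //; exact: measurable_funM.
apply: (@le_trans _ _ (\int[P]_w ((C1 * expR (- ((1 - dl) * (t `^ p * S))))%:E * (Ex w)%:E))%E).
  apply: ge0_le_integral => //.
  by apply: emeasurable_funM.
rewrite ge0_integralZl_EFin//; last 2 first.
- by move=> w _; rewrite lee_fin expR_ge0.
- by rewrite mulr_ge0 ?expR_ge0// ltW.
have -> : (\int[P]_w (Ex w)%:E = \int[P]_w (expR ((1 - dl) * th * t `^ (p - r) * L 0 t w))%:E)%E.
  apply: ae_eq_integral => //.
    by apply/measurable_EFinP; apply: measurableT_comp => //; exact: measurable_funM.
  by apply: filterS VL => w Vw _; rewrite /Ex Vw.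
have dth0 : 0 < (1 - dl) * th by rewrite mulr_gt0.
apply: (@le_trans _ _ ((C1 * expR (- ((1 - dl) * (t `^ p * S))))%:E *
    (C * expR (t `^ p * K ((1 + dl) * ((1 - dl) * th))))%:E)%E).
  by rewrite lee_wpmul2l ?lee_fin ?mulr_ge0 ?expR_ge0 ?(ltW C10)//; exact: CP.
rewrite -EFinM lee_fin mulrACA -expRD ler_pM2l ?mulr_gt0// ler_expR.
have Kle : K ((1 + dl) * ((1 - dl) * th)) <= K th.
  have A0 := A1_gt0 nu alpha12 chi0.
  have A0' := ltW A0.
  apply: ge0_ler_powR.
  - by case/andP: alpha12 => h1 _; rewrite divr_ge0// ?subr_ge0 ltW// (lt_trans _ h1).
  - by rewrite nnegrE mulr_ge0// mulr_ge0 ?(ltW dth0)// addr_ge0// ltW.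
  - by rewrite nnegrE mulr_ge0// ltW.
  rewrite ler_pM2r// mulrA ger_pMl//.
  by have := sqr_ge0 dl; rewrite expr2; lra.
have : t `^ p * K ((1 + dl) * ((1 - dl) * th)) <= t `^ p * K th by rewrite ler_pM2l.
have : t `^ p * (dl * S) <= t `^ p * e by rewrite ler_pM2l.
have -> : Lambda1_star H alpha nu chi a = S - K th by rewrite -LaE.
move: (K _) (K th) => k1 k2; lra.
Qed.

Let near_constants x l (e1 : R) : x != 0 -> 0 < l -> 0 < e1 -> D° x ->
  exists eta, [/\ 0 < eta, eta < 1, `]x - eta, x + eta[%classic `<=` D &
    (`|x| + eta) ^+ 2 / (2 * (l * (1 - eta)) `^ (2 * H)) <=
      x ^+ 2 / l `^ (2 * H) / 2 + e1].
Proof.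
move=> x0 l0 e10 [dx /= dx0 dxD].
have c1 : (`|x| + eta) ^+ 2 / (2 * (l * (1 - eta)) `^ (2 * H)) @[eta --> (0 : R)^'+] -->
    x ^+ 2 / l `^ (2 * H) / 2.
  apply: cvg_at_right_filter.
  have -> : x ^+ 2 / l `^ (2 * H) / 2 = (`|x| + 0) ^+ 2 / (2 * (l * (1 - 0)) `^ (2 * H)).
    rewrite addr0 subr0 mulr1 -normrX ger0_norm ?sqr_ge0//; field.
    by rewrite gt_eqF// powR_gt0.
  apply: cvgM.
    apply: (@continuous_comp _ _ _ (fun eta : R => `|x| + eta) (fun y => y ^+ 2)).
      by apply: cvgD; [exact: cvg_cst|exact: cvg_id].
    exact: exprn_continuous.
  apply: cvgV.
    by rewrite subr0 mulr1 mulf_neq0// gt_eqF// powR_gt0.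
  apply: cvgM; first exact: cvg_cst.
  apply: (@cvg_comp _ _ _ (fun eta : R => l * (1 - eta)) (fun y : R => y `^ (2 * H))
    _ (nbhs (l * (1 - 0)))).
    by apply: cvgM; [exact: cvg_cst|apply: cvgB; [exact: cvg_cst|exact: cvg_id]].
  by apply: continuous_powR; rewrite subr0 mulr1.
have c2 : \forall eta \near (0 : R)^'+, (`|x| + eta) ^+ 2 / (2 * (l * (1 - eta)) `^ (2 * H)) <
    x ^+ 2 / l `^ (2 * H) / 2 + e1.
  by apply: (cvgr_lt _ c1); rewrite ltrDl.
have c3 : \forall eta \near (0 : R)^'+, 0 < eta by exact: nbhs_right_gt.
have c4 : \forall eta \near (0 : R)^'+, eta < 1 by exact: nbhs_right_lt.
have c5 : \forall eta \near (0 : R)^'+, eta < dx by exact: nbhs_right_lt.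
have [eta [[h2 h3] [h4 h5]]] := filter_ex (filterI (filterI c2 c3) (filterI c4 c5)).
exists eta; split=> //; last exact: ltW.
move=> y /=; rewrite in_itv/= => /andP[y1 y2]; apply: dxD => /=.
by rewrite ltr_norml; lra.
Qed.

(** The local time lies in a window around the optimal value with the probability
    given by [local_time_window]; on this event the Gaussian law charges a small
    interval around [t ^ p x], which is contained in the dilated set. *)
Lemma ldp_lower_exp x e : x != 0 -> D° x -> 0 < e ->
  exists2 c, 0 < c & \forall t \near +oo,
  ((c * expR (- (t `^ p * (Lambda1_star H alpha nu chi x + e))))%:E <=
    P [set w | D (t `^ (- p) * Z t w)%R])%E.
Proof.
move=> x0 Dx e0.
have [l [th [l0 th0 thl thlG LxE]]] := rate_data nu H01 alpha12 Halpha chi0 x0.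
have e3 : 0 < e / 3 by rewrite divr_gt0.
have [eta [eta0 eta1 etaD etaG]] := near_constants x0 l0 e3 Dx.
(* raising [l2] costs [theta (l2 - l)] in the exponent, one third of the
   error allowed *)
pose l1 := l * (1 - eta); pose l2 := l + e / 3 / th.
have l10 : 0 < l1 by rewrite mulr_gt0 ?subr_gt0.
have l1l : 0 < l1 < l by rewrite l10/= gtr_pMr// gtrBl.
have ll2 : l < l2 by rewrite ltrDl divr_gt0.
have [c1 c10 win] := local_time_window H01 alpha12 Halpha chi0 stX lL th0 thl l1l ll2 e3.
pose c2 := 2 * eta / Num.sqrt (l2 `^ (2 * H) * pi *+ 2).
have l20 : 0 < l2 by rewrite (lt_trans l0).
have sq0 : 0 < Num.sqrt (l2 `^ (2 * H) * pi *+ 2).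
  by rewrite sqrtr_gt0 mulrn_wgt0// mulr_gt0 ?powR_gt0 ?pi_gt0.
have c20 : 0 < c2 by rewrite divr_gt0// mulr_gt0.
exists (c2 * c1); first by rewrite mulr_gt0.
have tp : t `^ p @[t --> +oo] --> +oo := cvgy_powR p0.
have /cvgryPge/(_ 1) tp1 := tp.
near=> t; have t0 : 0 < t by [].
pose N := t `^ p; have N0 : 0 < N by rewrite powR_gt0.
have N1 : 1 <= t `^ p by near: t.
have wint : ((c1 * expR (- (t `^ p * (th * l2 - K th + e / 3))))%:E <=
    P [set w | (l1 * t `^ r <= L 0 t w <= l2 * t `^ r)%R])%E by near: t.
have [V [V0 VL law]] := local_time_fbm_law fW (stable_levy stX) lL indep t0.
have [mPV ->] := law _ (mD' t).
pose M := `|x| + eta.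
pose w2 := c2 * expR (- (N * (M ^+ 2 / (2 * l1 `^ (2 * H))))).
have w20 : 0 <= w2 by rewrite mulr_ge0 ?expR_ge0// ltW.
pose Win : set T := [set w | l1 * t `^ r <= V w <= l2 * t `^ r].
have mWin (Y : {RV P >-> R}) : measurable [set w | l1 * t `^ r <= Y w <= l2 * t `^ r].
  rewrite (_ : [set w | _] = Y @^-1` `[l1 * t `^ r, l2 * t `^ r]%classic).
    exact: measurable_funPTI.
  by apply/seteqP; split=> w /=; rewrite in_itv.
have tr0 : 0 < t `^ r by rewrite powR_gt0.
have powl (y : R) : 0 <= y -> (y * t `^ r) `^ (2 * H) = y `^ (2 * H) * N.
  by move=> y0; rewrite powRM ?(ltW tr0)// -powRrM rH.
have H20 : 0 <= 2 * H by rewrite mulr_ge0// ltW.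
have bound w : (w2%:E * (\1_Win w)%:E <= P (W (V w) @^-1` D' t))%E.
  rewrite indicE; have [|] := boolP (w \in Win); last by rewrite mule0 measure_ge0.
  rewrite inE /Win/= mule1 => /andP[Vl1 Vl2].
  have Vw : 0 < V w by rewrite (lt_le_trans _ Vl1)// mulr_gt0.
  have y1 : l1 `^ (2 * H) * N <= V w `^ (2 * H).
    rewrite -powl ?(ltW l10)//; apply: ge0_ler_powR => //; rewrite nnegrE ?(ltW Vw)//.
    by rewrite mulr_ge0// ltW.
  have y2 : V w `^ (2 * H) <= l2 `^ (2 * H) * N.
    rewrite -powl ?(ltW l20)//; apply: ge0_ler_powR => //; rewrite nnegrE ?(ltW Vw)//.
    by rewrite mulr_ge0// ltW.
  have bc : N * (x - eta) < N * (x + eta) by rewrite ltr_pM2l//; lra.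
  have xM (y : R) : `|y| <= M -> `|N * y| <= N * M.
    by move=> yM; rewrite normrM ger0_norm ?(ltW N0)// ler_pM2l.
  have b1 : `|x - eta| <= M.
    by apply: (le_trans (ler_normB _ _)); rewrite [X in _ + X]ger0_norm// ltW.
  have b2 : `|x + eta| <= M.
    by apply: (le_trans (ler_normD _ _)); rewrite [X in _ + X]ger0_norm// ltW.
  apply: (le_trans _ (le_trans (fbm_interval H01 fW Vw bc (xM _ b1) (xM _ b2)) _)); last first.
    apply: le_measure; rewrite ?inE.
    - exact: measurable_funPTI.
    - exact: measurable_funPTI.
    - move=> v /=; rewrite in_itv/= => /andP[h1 h2]; apply: etaD => /=.
      by rewrite in_itv/= powRN ltr_pdivlMl// ltr_pdivrMl// h1.
  rewrite lee_fin /w2 [leRHS]mulrA; apply: ler_pM; rewrite ?expR_ge0 ?(ltW c20)//.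
    have -> : N * (x + eta) - N * (x - eta) = 2 * eta * N by ring.
    rewrite /c2 -[leRHS]mulrA ler_pM2l ?mulr_gt0//.
    have sV0 : 0 < Num.sqrt (V w `^ (2 * H) * pi *+ 2).
      by rewrite sqrtr_gt0 mulrn_wgt0// mulr_gt0 ?powR_gt0 ?pi_gt0.
    rewrite ler_pdivlMr// mulrC ler_pdivrMr//.
    have -> : N * Num.sqrt (l2 `^ (2 * H) * pi *+ 2) =
        Num.sqrt (N ^+ 2 * (l2 `^ (2 * H) * pi *+ 2)).
      by rewrite sqrtrM ?sqr_ge0// sqrtr_sqr ger0_norm// ltW.
    apply: ler_wsqrtr; rewrite -!mulrnAr mulrA; apply: ler_wpM2r.
      by rewrite mulrn_wge0// pi_ge0.
    apply: (le_trans y2); rewrite mulrC ler_wpM2r ?powR_ge0//.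
    by rewrite expr2 ler_pMl.
  rewrite ler_expR lerN2 exprMn.
  have yl : 0 < 2 * V w `^ (2 * H) by rewrite mulr_gt0// powR_gt0.
  have ll : 0 < l1 `^ (2 * H) by rewrite powR_gt0.
  rewrite ler_pdivrMr//.
  have -> : N ^+ 2 * M ^+ 2 = N * (M ^+ 2 / (2 * l1 `^ (2 * H))) * (2 * (l1 `^ (2 * H) * N)).
    by field; rewrite gt_eqF.
  apply: ler_wpM2l; last by rewrite ler_pM2l.
  apply: mulr_ge0; first exact: ltW.
  by apply: divr_ge0; [exact: sqr_ge0|rewrite mulr_ge0// ltW].
apply: (@le_trans _ _ (\int[P]_w (w2%:E * (\1_Win w)%:E))%E); last first.
  apply: ge0_le_integral => //.
  - by move=> w _; rewrite mule_ge0.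
  - apply: emeasurable_funM => //; apply/measurable_EFinP; apply: measurable_indic.
    exact: mWin.
rewrite ge0_integralZl_EFin//; last first.
  by apply/measurable_EFinP; apply: measurable_indic; exact: mWin.
rewrite integral_indic//; last exact: mWin.
rewrite [X in (_ <= _ * X)%E](_ : _ = P [set w | (l1 * t `^ r <= L 0 t w <= l2 * t `^ r)%R]); last first.
  rewrite setIT; apply: (probability_ae_eq (mWin V) (mWin (L 0 t))).
  by apply: filterS VL => w /= ->.
apply: (@le_trans _ _ (w2%:E * (c1 * expR (- (t `^ p * (th * l2 - K th + e / 3))))%:E)%E); last first.
  by rewrite lee_wpmul2l.
rewrite -EFinM lee_fin /w2 [leRHS]mulrACA -expRD; apply: ler_wpM2l.
  by apply: mulr_ge0; exact: ltW.
rewrite ler_expR -opprD lerN2.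
rewrite -mulrDr ler_pM2l// -LxE /l2 mulrDr [th * (_ / _)]mulrC divfK ?gt_eqF//.
move: etaG; rewrite -/l1 -/M; move: (M ^+ 2 / _) (_ / _ `^ (2 * H) / 2) => *; rewrite /K.
lra.
Unshelve. all: by end_near.
Qed.

Let event_measurable t : measurable [set w | D (t `^ (- p) * Z t w)].
Proof.
have mLw : measurable_fun setT (fun w => (L 0 t w, w)) by exact: measurable_fun_pair.
have jW := continuous_process_measurable (fun t => measurable_funP (W t)) (fbm_continuous fW).
by have := measurableT_comp jW mLw measurableT (mD' t); rewrite setTI.
Qed.

Let event_prob t : (0 <= P [set w | D (t `^ (- p) * Z t w)%R] <= 1)%E.
Proof. by rewrite measure_ge0/=; apply: probability_le1; exact: event_measurable. Qed.

(** For every value [v] below the infimum of the rate over the closure, the set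
    lies outside the centred interval on which the rate is below [v]. *)
Lemma ldp_upper : (limf_esup (scaled_log_prob P p Z D) (pinfty_nbhs R)
  <= - ereal_inf [set (Lambda1_star H alpha nu chi x)%:E | x in closure D])%E.
Proof.
set I := ereal_inf _; set ls := limf_esup _ _.
have claim (v : R) : (v%:E < I)%E -> (ls <= (- v)%:E)%E.
  move=> vI; have [v0|v0] := leP v 0.
    apply: (@le_trans _ _ 0%E); last by rewrite lee_fin oppr_ge0.
    exact: (exponential_rate_le0 p event_prob).
  have [a a0 [aE aP]] := Lambda1_star_inv nu H01 alpha12 Halpha chi0 v0.
  have Da x : D x -> a <= `|x|.
    move=> Dx; apply: aP; rewrite -lee_fin; apply: (le_trans (ltW vI)).
    by apply: ereal_inf_lbound; exists x => //; exact: subset_closure.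
  apply/lee_addgt0Pr => e e0.
  have [C C0 CP] := ldp_upper_exp a0 Da e0; rewrite aE in CP.
  rewrite -EFinD (_ : - v + e = - (v - e)); last by ring.
  apply: (exponential_rate_le p0 event_prob C0).
  by near=> t; apply: CP.
rewrite leeNr; move: claim; case: I => [r0||] claim.
- apply/lee_subgt0Pr => e e0; rewrite -EFinB leeNr; apply: claim.
  by rewrite lte_fin ltrBlDr ltrDl.
- by rewrite (eq_infty (x := (- ls)%E))// => v; rewrite leeNr; apply: claim; rewrite ltry.
- exact: leNye.
Unshelve. all: by end_near.
Qed.

(** At the origin the optimal local time is zero and there is no dual tilt; points
    of the interior close to the origin, whose rate is small, are used instead. *)
Lemma ldp_lower : (- ereal_inf [set (Lambda1_star H alpha nu chi x)%:E | x in D°]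
  <= limf_einf (scaled_log_prob P p Z D) (pinfty_nbhs R))%E.
Proof.
set li := limf_einf _ _.
have claim x : x != 0 -> D° x -> ((- Lambda1_star H alpha nu chi x)%:E <= li)%E.
  move=> x0 Dx; apply/lee_subgt0Pr => e e0.
  have [c c0 cP] := ldp_lower_exp x0 Dx e0.
  by rewrite -EFinB -opprD; exact: (exponential_rate_ge p0 event_prob c0 cP).
rewrite leeNl; apply: le_ereal_inf_tmp => _ [x Dx <-]; rewrite leeNl -EFinN.
have [x0|] := eqVneq x 0; last by move=> x0; exact: claim.
apply: (@le_trans _ _ 0%E).
  by rewrite lee_fin oppr_le0 Lambda1_star_ge0.
apply/lee_subgt0Pr => e e0; rewrite -EFinB sub0r.
have [dl dl0 dlP] := Lambda1_star_small nu H01 alpha12 Halpha chi0 e0.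
have [dx /= dx0 dxD] : nbhs (0 : R) D° by apply: nbhs_interior; rewrite -x0.
pose y := Num.min dl dx / 2.
have m0 : 0 < Num.min dl dx by rewrite lt_min dl0.
have y0 : 0 < y by rewrite divr_gt0.
have ym : y < Num.min dl dx by rewrite ltr_pdivrMr//; lra.
have [y1 y2] : y < dl /\ y < dx by move: ym; rewrite lt_min => /andP.
have Dy : D° y by apply: dxD; rewrite /= sub0r normrN gtr0_norm.
apply: le_trans (claim y (lt0r_neq0 y0) Dy).
by rewrite lee_fin lerN2 ltW// dlP// gtr0_norm.
Qed.

End ldp_bounds.

Theorem theorem1p1 (d : measure_display) (T : measurableType d) (R : realType)
    (P : probability T R) (H alpha nu chi : R)
    (W X : R -> {RV P >-> R}) (L : R -> R -> {RV P >-> R}) :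
  0 < H < 1 -> 1 < alpha <= 2 -> 2 * H < alpha ->
  -1 <= nu <= 1 -> 0 < chi ->
  fractional_brownian_motion H W ->
  stable_levy_process alpha nu chi X ->
  independent_processes P [set: R] [set t | 0 <= t] W X ->
  local_time X L ->
  forall D : set R, measurable D ->
    (limf_esup (scaled_log_prob P (ldp_exponent H alpha) (local_time_fbm W L) D)
       (pinfty_nbhs R)
     <= - ereal_inf [set (Lambda1_star H alpha nu chi x)%:E | x in closure D])%E
    /\
    (- ereal_inf [set (Lambda1_star H alpha nu chi x)%:E | x in D°]
     <= limf_einf (scaled_log_prob P (ldp_exponent H alpha) (local_time_fbm W L) D)
       (pinfty_nbhs R))%E.
Proof.
move=> H01 alpha12 Halpha _ chi0 fW stX indep lL D mD; split.
  exact: (ldp_upper H01 alpha12 Halpha chi0 fW stX indep lL mD).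
exact: (ldp_lower H01 alpha12 Halpha chi0 fW stX indep lL mD).
Qed.
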